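(* Let $m\ge1$ be an integer and $\alpha>-1$ a real number with $\alpha-2m+1>0$. Suppose that $\mathcal{S}(\alpha,m)$ admits a minimizer $z\in\mathcal{D}^{m,2}_\infty(\alpha)$ that is $(2m-1)$-th nonsingular at $r=0$ and satisfies $z^{(i)}(0)=0$ for $i=1,3,\dots,2m-1$. Then the best constant $\mathcal{S}^{-\frac12}(\alpha,m)$ is given by $$\mathcal{S}^{-\frac12}(\alpha,m)=\mathcal{P}^{-\frac12}\left[\frac{2\,\Gamma(\alpha+1)}{\Gamma(\frac{\alpha+1}{2})\,\Gamma(\frac{\alpha+1}{2})}\right]^{\frac{m}{\alpha+1}},\qquad \mathcal{P}=\prod_{h=-m}^{m-1}(\alpha+1+2h),$$ where $\Gamma(x)=\int_0^1(-\ln t)^{x-1}\,dt$, $x>0$, is Euler's gamma function.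
   Context: For $q\ge1$ and $\theta>-1$, $L^q_\theta$ is the space of measurable $u:(0,\infty)\to\mathbb{R}$ with $\|u\|_{L^q_\theta}=(\int_0^\infty|u|^q r^\theta dr)^{1/q}<\infty$. $AC^{m-1}_{loc}(0,\infty)$ is the set of functions $u$ on $(0,\infty)$ having derivatives up to order $m-1$ with $u^{(m-1)}$ locally absolutely continuous. $\mathcal{D}^{m,2}_\infty(\alpha)$ is the completion of $\{u\in AC^{m-1}_{loc}(0,\infty): \lim_{r\to\infty}u^{(j)}(r)=0\ (0\le j\le m-1),\ u^{(m)}\in L^2_\alpha\}$ under the norm $\|u^{(m)}\|_{L^2_\alpha}$; since $\alpha-2m+1>0$, its elements are identified with functions in $AC^{m-1}_{loc}(0,\infty)$ with $u^{(j)}\in L^2_{\alpha-2(m-j)}$ for $0\le j\le m$. $\Delta_\alpha u=r^{-\alpha}(r^\alpha u')'=u''+\frac{\alpha}{r}u'$; $\nabla^m_\alpha u=\Delta^k_\alpha u$ if $m=2k$ and $\nabla^m_\alpha u=(\Delta^k_\alpha u)'$ if $m=2k+1$; $2^*=\frac{2(\alpha+1)}{\alpha-2m+1}$. Set $$\mathcal{S}(\alpha,m)=\inf\left\{\frac{\|\nabla^m_\alpha u\|^2_{L^2_\alpha}}{\|u\|^2_{L^{2^*}_\alpha}}: u\in\mathcal{D}^{m,2}_\infty(\alpha)\setminus\{0\}\right\};$$ a minimizer is a nonzero $u\in\mathcal{D}^{m,2}_\infty(\alpha)$ attaining the infimum. $\mathcal{S}^{-1/2}(\alpha,m)$ is the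 best constant of the embedding $\mathcal{D}^{m,2}_\infty(\alpha)\hookrightarrow L^{2^*}_\alpha$. Every minimizer is of class $C^{2m}(0,\infty)$. A function $u\in C^{2m}(0,\infty)$ is $\ell$-th nonsingular at $r=0$ if for each $0\le i\le\ell$ the (finite) limit $\lim_{r\to0^+}u^{(i)}(r)=:u^{(i)}(0)$ exists. *)

(* Defs.v *)
From HB Require Import structures.
From mathcomp Require Import all_boot all_order all_algebra.
From mathcomp Require Import all_classical all_reals all_analysis.

Set Implicit Arguments.
Unset Strict Implicit.
Unset Printing Implicit Defensive.

Import Order.TTheory GRing.Theory Num.Theory.
Import numFieldNormedType.Exports.

Local Open Scope ring_scope.
Local Open Scope classical_set_scope.

(* Functions on (0, +oo) are represented by total functions u : R -> R; every
   definition below depends only on the restriction of u to (0, +oo), since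
   u^`(j) r with 0 < r depends only on u near r. *)

Section WeightedSpaces.
Variable R : realType.
Implicit Types (q theta : R) (u : R -> R).

Definition Lwnorm q theta u : \bar R :=
  poweR (\int[lebesgue_measure]_(r in `]0%R, +oo[) (`|u r| `^ q * r `^ theta)%:E)
    q^-1.

Definition Lw q theta u : Prop :=
  measurable_fun (`]0%R, +oo[ : set R) u /\ (Lwnorm q theta u < +oo)%E.

Definition abs_continuous_on (a b : R) u : Prop :=
  forall e : R, 0 < e -> exists2 d : R, 0 < d &
    forall (n : nat) (x y : 'I_n -> R),
      (forall i, [/\ a <= x i, x i <= y i & y i <= b]) ->
      trivIset setT (fun i => [set` `]x i, y i[]) ->
      \sum_(i < n) (y i - x i) < d ->
      \sum_(i < n) `|u (y i) - u (x i)| < e.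

Definition loc_abs_continuous u : Prop :=
  forall a b : R, 0 < a -> a <= b -> abs_continuous_on a b u.

(* AC^k_loc(0, +oo) *)
Definition ACloc (k : nat) u : Prop :=
  (forall (j : nat) (r : R), (j < k)%N -> 0 < r -> derivable (u^`(j)) r 1) /\
  loc_abs_continuous (u^`(k)).

(* C^k(0, +oo) *)
Definition Cclass (k : nat) u : Prop :=
  (forall (j : nat) (r : R), (j < k)%N -> 0 < r -> derivable (u^`(j)) r 1) /\
  (forall r : R, 0 < r -> {for r, continuous (u^`(k))}).

End WeightedSpaces.

Section SobolevConstant.
Variable R : realType.
Implicit Types (alpha : R) (m : nat) (u : R -> R).

(* The space that is completed to define D^{m,2}_oo(alpha). For u in
   AC^{m-1}_loc the derivative u^`(m) exists almost everywhere; it takes a fixed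
   default value at the remaining points. *)
Definition Dpre alpha m u : Prop :=
  [/\ ACloc m.-1 u,
      forall j : nat, (j < m)%N -> u^`(j) r @[r --> +oo] --> (0 : R)
    & Lw 2 alpha (u^`(m))].

(* The completion of Dpre under || u^(m) ||_{L^2_alpha}, realized as a space of
   functions: a Cauchy sequence (v n) of Dpre is identified with the function u
   such that (v n)^(m) tends to u^(m) in L^2_alpha and
   u^(j) is in L^2_{alpha - 2(m - j)} for all 0 <= j <= m. There is exactly one
   such u when alpha - 2m + 1 > 0: existence is Hardy's inequality, and no
   nonzero polynomial belongs to L^2_{alpha - 2m}. *)
Definition Dspace alpha m u : Prop :=
  [/\ ACloc m.-1 u,
      forall j : nat, (j <= m)%N -> Lw 2 (alpha - 2 * (m%:R - j%:R)) (u^`(j))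
    & exists2 v : nat -> R -> R, (forall n, Dpre alpha m (v n)) &
        Lwnorm 2 alpha ((v n)^`(m)%classic \- u^`(m)%classic) @[n --> \oo]
          --> (0%R)%:E].

Definition Dnonzero u : Prop := exists2 r : R, 0 < r & u r != 0.

Definition Lap alpha u : R -> R := fun r => u^`(2)%classic r + alpha / r * u^`()%classic r.

Definition grad alpha m u : R -> R :=
  if odd m then (iter m./2 (Lap alpha) u)^`() else iter m./2 (Lap alpha) u.

Definition critexp alpha m : R := 2 * (alpha + 1) / (alpha - 2 * m%:R + 1).

(* On Dspace both norms are finite: the first by the integrability of the
   u^(j), the second by the embedding of Dspace into L^{2*}_alpha. *)
Definition quotient alpha m u : R :=
  fine (Lwnorm 2 alpha (grad alpha m u)) ^+ 2 /
  fine (Lwnorm (critexp alpha m) alpha u) ^+ 2.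

Definition Sconst alpha m : R :=
  inf [set quotient alpha m u | u in [set u | Dspace alpha m u /\ Dnonzero u]].

Definition minimizer alpha m u : Prop :=
  [/\ Dspace alpha m u, Dnonzero u & quotient alpha m u = Sconst alpha m].

Definition deriv_at0 (i : nat) u : R := lim (u^`(i) r @[r --> 0^'+]).

Definition nonsingular m (l : nat) u : Prop :=
  Cclass (2 * m) u /\
  forall i : nat, (i <= l)%N -> cvg (u^`(i) r @[r --> 0^'+]).

Definition Gamma (x : R) : R :=
  \int[lebesgue_measure]_(t in `]0, 1[) ((- ln t) `^ (x - 1)).

(* The factor of index h = i - m, for -m <= h <= m - 1. *)
Definition Pprod alpha m : R :=
  \prod_(i < 2 * m) (alpha + 1 + 2 * (i%:R - m%:R)).

End SobolevConstant.

(* Main.v *)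
Require Import Defs.
From HB Require Import structures.
From mathcomp Require Import all_boot all_order all_algebra.
From mathcomp Require Import all_classical all_reals all_analysis.
From mathcomp Require Import measurable_realfun zify ring lra.

Set Implicit Arguments.
Unset Strict Implicit.
Unset Printing Implicit Defensive.

Import Order.TTheory GRing.Theory Num.Theory.
Import numFieldNormedType.Exports.

Local Open Scope ring_scope.
Local Open Scope classical_set_scope.

(* Emden-Fowler transformation: [phi t = e ^ (lam t) z(e ^ t)], with
   [lam = (alpha - 2 m + 1) / 2], turns the weighted norms into unweighted
   integrals over the line and the Euler-Lagrange equation of a minimizer into
   the autonomous equation
     [(-1) ^ m prod_(i < m) (D ^ 2 - (lam + 2 i) ^ 2) phi = c |phi| ^ q phi],
   with [q = 2 m / lam] and [D = d/dt]. It is solved by the multiples of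
   [(2 cosh (t - tau)) ^ (- lam)]. Choose such a multiple [psi] (or [0]) with the
   same limit of [e ^ (- lam t) psi t] at [-oo] as [phi]; then the [2 m] partial
   products of the operator applied to [W = phi - psi] form a chain
   [Y_k' = nu_k Y_k + Y_(k+1)]. By Rolle's theorem each alternation of sign of
   [Y_0 = W] is passed along the chain, and one more is gained, since both
   ends of the first equation vanish. But [Y_(2m)] has the sign of [+-W] by
   monotonicity of the nonlinearity, so [W] would alternate infinitely often;
   a solution that does so is excluded by isolated zeros and by its
   exponential decay at both ends. Hence [phi] is a bubble, and evaluating the
   quotient on it is a beta integral. *)

(** * Calculus on the line and Rolle's theorem for alternating signs *)

(** The order of the factors makes the count of alternations work. The positive exponents come
    first: for [k < m] the function [Y_k] involves only derivatives of order below [m], bounded at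
    +oo by the energy, so [e ^ (- nu_k t) Y_k] vanishes there. The negative exponents come when
    derivatives up to order [2 m - 1] enter; these are bounded at -oo because [z] is nonsingular at
    [0]. So each equation has at least one vanishing end, just enough for Rolle's theorem not to
    lose an alternation, and the matched limits at -oo give the first equation its second end.
    Isolated zeros could still accumulate at the ends; there the difference would decay faster than
    every exponential, and then vanish. The [L ^ (q + 2)] norm is never differentiated: convexity
    bounds it below by its tangent, and minimality becomes that of an explicit function of one real
    variable. The energy of a bubble is not computed either: the constant of the Euler-Lagrange
    equation determines the infimum once the mass of the bubble is known. *)

Section RealCalculus.
Variable R : realType.
Implicit Types (f g u y h : R -> R).

(* restated so that its norm is syntactically the one elaborated for a [realType] *)
Lemma le_normr (x : R) : x <= `|x|.
Proof. exact: ler_norm. Qed.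

Lemma is_derive_continuous f (a d : R) : is_derive a 1 f d -> {for a, continuous f}.
Proof. by move=> [df _]; apply: differentiable_continuous; apply/derivable1_diffP. Qed.

Lemma continuous_fM f g (a : R) : {for a, continuous f} -> {for a, continuous g} ->
  {for a, continuous (fun t => f t * g t)}.
Proof. by move=> cf cg; exact: continuousM. Qed.

Lemma continuous_fD f g (a : R) : {for a, continuous f} -> {for a, continuous g} ->
  {for a, continuous (fun t => f t + g t)}.
Proof. by move=> cf cg; exact: continuousD. Qed.

Lemma continuous_fcomp f g (a : R) : {for a, continuous f} -> {for f a, continuous g} ->
  {for a, continuous (fun t => g (f t))}.
Proof. by move=> cf cg; exact: continuous_comp. Qed.

Lemma continuous_affine (a b t : R) : {for t, continuous (fun s => a * s + b)}.
Proof.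
apply: continuous_fD; last exact: cst_continuous.
by apply: continuous_fM; [exact: cst_continuous|exact: cvg_id].
Qed.

Lemma mvt f g (a b : R) : (forall t : R, is_derive t 1 f (g t)) -> a < b ->
  exists c, [/\ a < c, c < b & f b - f a = g c * (b - a)].
Proof.
move=> df ab; have cf : {within `[a, b], continuous f}.
  by apply: continuous_subspaceT => x; exact: is_derive_continuous (df x).
have [c] := MVT ab (fun x _ => df x) cf.
by rewrite in_itv /= => /andP[ac cb] E; exists c.
Qed.

Lemma ge0_derive_le f g (a b : R) : (forall t : R, is_derive t 1 f (g t)) ->
  (forall t, a < t -> t < b -> 0 <= g t) -> a <= b -> f a <= f b.
Proof.
move=> df g0; rewrite le_eqVlt => /orP[/eqP->//|ab].
have [c [ac cb E]] := mvt df ab.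
by rewrite -subr_ge0 E mulr_ge0 ?g0// subr_ge0 ltW.
Qed.

Lemma gt0_derive_lt f g (a b : R) : (forall t : R, is_derive t 1 f (g t)) ->
  (forall t, a < t -> t < b -> 0 < g t) -> a < b -> f a < f b.
Proof.
move=> df g0 ab; have [c [ac cb E]] := mvt df ab.
by rewrite -subr_gt0 E mulr_gt0 ?g0// subr_gt0.
Qed.

Lemma is_derive_cast f (t d d' : R) : is_derive t 1 f d -> d = d' ->
  is_derive t 1 f d'.
Proof. by move=> H <-. Qed.

Lemma is_derive_expRM (a t : R) :
  is_derive t 1 (fun s => expR (a * s)) (a * expR (a * t)).
Proof.
have := @is_derive1_comp R expR (fun s => a * s) t (expR (a * t)) a.
move=> /(_ (is_derive_expR _)); rewrite mulrC; apply.
apply: (is_derive_cast (is_deriveZ a (is_derive_id t (1:R)))).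
by rewrite /GRing.scale /= mulr1.
Qed.

Lemma is_derive_fM f g (t df dg : R) : is_derive t 1 f df -> is_derive t 1 g dg ->
  is_derive t 1 (fun s => f s * g s) (df * g t + f t * dg).
Proof.
move=> Hf Hg; apply: (is_derive_cast (is_deriveM Hf Hg)).
by rewrite /GRing.scale /= addrC (mulrC (g t)).
Qed.

Lemma is_derive_fD f g (t df dg : R) : is_derive t 1 f df -> is_derive t 1 g dg ->
  is_derive t 1 (fun s => f s + g s) (df + dg).
Proof. by move=> Hf Hg; exact: is_deriveD. Qed.

Lemma is_derive_fB f g (t df dg : R) : is_derive t 1 f df -> is_derive t 1 g dg ->
  is_derive t 1 (fun s => f s - g s) (df - dg).
Proof. by move=> Hf Hg; exact: is_deriveB. Qed.

Lemma is_derive_fN f (t df : R) : is_derive t 1 f df ->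
  is_derive t 1 (fun s => - f s) (- df).
Proof. by move=> Hf; exact: is_deriveN. Qed.

Lemma is_derive_fZ a f (t df : R) : is_derive t 1 f df ->
  is_derive t 1 (fun s => a * f s) (a * df).
Proof. by move=> Hf; exact: is_deriveZ. Qed.

Lemma is_derive_reflect f (t df : R) : is_derive (- t) 1 f df ->
  is_derive t 1 (fun s => f (- s)) (- df).
Proof.
move=> Hf; have := @is_derive1_comp R f -%R t df (-1) Hf (is_deriveNid _ _).
by rewrite mulrN1.
Qed.

(** Integrating factor. The weight is positive, so Rolle's theorem and monotonicity arguments apply
    with [h] in the place of the derivative, and no sign changes. *)
Lemma is_derive_factor y h (nu t : R) : is_derive t 1 y (nu * y t + h t) ->
  is_derive t 1 (fun s => expR (- nu * s) * y s) (expR (- nu * t) * h t).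
Proof.
move=> Hy; by apply: (is_derive_cast (is_derive_fM (is_derive_expRM (- nu) t) Hy)); ring.
Qed.

End RealCalculus.

Section Alternation.
Variable R : realType.
Implicit Types (u g : R -> R).

Definition altr u : rel R := fun a b => (a < b) && (u a * u b < 0).

(** The test on the first point matters for a singleton, from which the counting of alternations
    starts. *)
Definition alternates u (s : seq R) : bool :=
  if s is a :: s' then (u a != 0) && path (altr u) a s' else true.

(** A weak form of convergence to 0 at +oo: a smaller absolute value beyond [a] is all that the mean
    value theorem needs to find a derivative of sign opposite to [u a]. *)
Definition vanishes_right u := forall a, u a != 0 -> exists2 b, a < b & `|u b| < `|u a|.
Definition vanishes_left u := forall a, u a != 0 -> exists2 b, b < a & `|u b| < `|u a|.

Lemma norm_lt_sign (x y : R) : `|y| < `|x| -> 0 < x * (x - y).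
Proof.
case: (ltrgt0P x) => [x0|x0|->]; last by rewrite normr_lt0.
  by rewrite ltr_norml => /andP[_ yx]; rewrite mulr_gt0// subr_gt0.
by rewrite ltr_norml opprK => /andP[yx _]; rewrite nmulr_rgt0// subr_lt0.
Qed.

Lemma mulr_lt0_trans (x y z : R) : 0 < x * y -> x * z < 0 -> y * z < 0.
Proof.
move=> xy xz; have x0 : x != 0 by apply: contraTneq xy => ->; rewrite mul0r ltxx.
have x2 : 0 < x ^+ 2 by rewrite exprn_even_gt0.
rewrite -(pmulr_rlt0 _ x2).
have -> : x ^+ 2 * (y * z) = (x * y) * (x * z) by ring.
by rewrite pmulr_rlt0.
Qed.

(** The invariant is a point [d <= a] where the derivative has the sign of [u a]. Between [a] and
    the next alternation [b] the mean value has the sign of [u b], which restores the invariant; a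
    vanishing right end yields one last point. *)
Lemma rolle_path u g (vr : bool) (s : seq R) (a d : R) : (forall t : R, is_derive t 1 u (g t)) ->
  (vr -> vanishes_right u) ->
  d <= a -> 0 < g d * u a -> path (altr u) a s ->
  exists2 s', size s' = (size s + vr)%N & path (altr g) d s'.
Proof.
move=> du van; elim: s a d => [|b s IH] a d da gd /=.
  move=> _; case: vr van => van; last by exists [::].
  have ua : u a != 0 by apply: contraTneq gd => ->; rewrite mulr0 ltxx.
  have [b ab uba] := van isT a ua.
  have [c [ac cb E]] := mvt du ab.
  exists [:: c] => //=; rewrite andbT /altr (le_lt_trans da ac) /=.
  have := norm_lt_sign uba; rewrite -opprB E mulrN oppr_gt0 mulrA pmulr_llt0 ?subr_gt0//.
  by apply: mulr_lt0_trans; rewrite mulrC.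
move=> /andP[/andP[ab uab] pth].
have [c [ac cb E]] := mvt du ab.
have gc : 0 < g c * u b.
  have ba0 : 0 < b - a by rewrite subr_gt0.
  rewrite -(pmulr_rgt0 _ ba0) mulrA [_ * g c]mulrC -E.
  by rewrite mulrBl subr_gt0; apply: lt_le_trans uab _; exact: sqr_ge0.
have [s' ss' ps'] := IH b c (ltW cb) gc pth.
exists (c :: s'); first by rewrite /= ss' addSn.
rewrite /= ps' andbT /altr (le_lt_trans da ac) /=.
apply: (@mulr_lt0_trans (u a)); first by rewrite mulrC.
by rewrite mulrC; apply: (@mulr_lt0_trans (u b)); rewrite mulrC.
Qed.

(** A vanishing left end supplies the first point for the derivative, so the number of points is
    kept; vanishing at the right as well adds one. *)
Lemma rolle_left u g (vr : bool) (a : R) s : (forall t : R, is_derive t 1 u (g t)) ->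
  vanishes_left u -> (vr -> vanishes_right u) -> alternates u (a :: s) ->
  exists2 s', size s' = (size s + vr).+1 & alternates g s'.
Proof.
move=> du vl van /= /andP[ua pth].
have [b ba uba] := vl a ua; have [c [bc ca E]] := mvt du ba.
have gc : 0 < g c * u a.
  have ba0 : 0 < a - b by rewrite subr_gt0.
  rewrite -(pmulr_rgt0 _ ba0) mulrA [_ * g c]mulrC -E.
  by rewrite mulrC norm_lt_sign.
have [s' ss' ps'] := rolle_path du van (ltW ca) gc pth.
exists (c :: s'); first by rewrite /= ss'.
by rewrite /= ps' andbT; apply: contraTneq gc => ->; rewrite mul0r ltxx.
Qed.

(** Here the first gap between alternations starts the path and the right end supplies the last
    point, so the number of points is again kept. *)
Lemma rolle_right u g (a : R) s : (forall t : R, is_derive t 1 u (g t)) ->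
  vanishes_right u -> alternates u (a :: s) ->
  exists2 s', size s' = (size s).+1 & alternates g s'.
Proof.
move=> du van /= /andP[ua].
case: s => [_|b s /= /andP[/andP[ab uab] pth]].
  have [b ab uba] := van a ua; have [c [ac cb E]] := mvt du ab.
  exists [:: c] => //=; rewrite andbT; apply: contraTneq uba => gc0.
  by move: E; rewrite gc0 mul0r => /eqP; rewrite subr_eq0 => /eqP ->; rewrite ltxx.
have [c [ac cb E]] := mvt du ab.
have gc : 0 < g c * u b.
  have ba0 : 0 < b - a by rewrite subr_gt0.
  rewrite -(pmulr_rgt0 _ ba0) mulrA [_ * g c]mulrC -E.
  by rewrite mulrBl subr_gt0; apply: lt_le_trans uab _; exact: sqr_ge0.
have [s' ss' ps'] := @rolle_path u g true s b c du (fun=> van) (ltW cb) gc pth.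
exists (c :: s'); first by rewrite /= ss' addn1.
by rewrite /= ps' andbT; apply: contraTneq gc => ->; rewrite mul0r ltxx.
Qed.

Lemma alternates_imp u g s : (forall a, u a != 0 -> g a != 0) ->
  (forall a b, u a * u b < 0 -> g a * g b < 0) -> alternates u s -> alternates g s.
Proof.
move=> H0 H; case: s => //= a s /andP[ua pth]; rewrite H0//=.
by apply: sub_path pth => x y /andP[xy uxy]; rewrite /altr xy H.
Qed.

Lemma alternates_weight u (c : R -> R) s : (forall t, 0 < c t) ->
  alternates (fun t => c t * u t) s = alternates u s.
Proof.
move=> c0; have E a b : (c a * u a * (c b * u b) < 0) = (u a * u b < 0).
  have -> : c a * u a * (c b * u b) = c a * c b * (u a * u b) by ring.
  by rewrite pmulr_rlt0// mulr_gt0.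
apply/idP/idP; apply: alternates_imp => [a|a b]; rewrite ?E//.
  by rewrite mulf_eq0 negb_or => /andP[].
by move=> ua; rewrite mulf_eq0 negb_or ua andbT gt_eqF.
Qed.

End Alternation.

(** * Chains of first-order equations *)

Section Chains.
Variable R : realType.
Implicit Types (n : nat) (nu : nat -> R) (Y : nat -> R -> R) (u g : R -> R).

(** [Y k.+1] is [D - nu k] applied to [Y k]; nothing is asked of the regularity of the last member
    [Y n]. *)
Definition chain n nu Y := forall (k : nat) (t : R), (k < n)%N ->
  is_derive t 1 (Y k) (nu k * Y k t + Y k.+1 t).

(** Turns results about +oo, or about one side of a point, into results about the other side. *)
Lemma chain_reflect n nu Y : chain n nu Y ->
  chain n (fun k => - nu k) (fun k t => (-1) ^+ k * Y k (- t)).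
Proof.
move=> cY k t kn; have H := is_derive_reflect (cY k (- t) kn).
by apply: (is_derive_cast (is_derive_fZ ((-1) ^+ k) H)); rewrite exprS; ring.
Qed.

Lemma chainB n nu Y Z : chain n nu Y -> chain n nu Z ->
  chain n nu (fun k t => Y k t - Z k t).
Proof.
move=> cY cZ k t kn.
by apply: (is_derive_cast (is_derive_fB (cY k t kn) (cZ k t kn))); ring.
Qed.

Lemma chainZ n nu Y a : chain n nu Y -> chain n nu (fun k t => a * Y k t).
Proof.
move=> cY k t kn.
by apply: (is_derive_cast (is_derive_fZ a (cY k t kn))); ring.
Qed.

(* [u] has a constant strict sign on a left neighbourhood of [b <= +oo] *)
Definition signed_before (b : \bar R) u := exists s a : R,
  (a%:E < b)%E /\ forall t, a < t -> (t%:E < b)%E -> 0 < s * u t.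

(** Under a signed derivative [s * u] increases strictly: either it reaches a nonnegative value and
    is positive from then on, or it stays negative up to [b]. *)
Lemma signed_before_primitive b u g : (forall t : R, is_derive t 1 u (g t)) ->
  signed_before b g -> signed_before b u.
Proof.
move=> du [s [a [ab gs]]].
have incr x y : a < x -> x < y -> (y%:E < b)%E -> s * u x < s * u y.
  move=> ax xy yb; apply: (gt0_derive_lt (fun t => is_derive_fZ s (du t))) => // t xt ty.
  by apply: gs; [exact: lt_trans xt|apply: lt_trans yb; rewrite lte_fin].
have [[c [ac cb uc]]|no] := pselect (exists c, [/\ a < c, (c%:E < b)%E & 0 <= s * u c]).
  by exists s, c; split=> // t ct tb; apply: le_lt_trans uc (incr _ _ ac ct tb).
exists (- s), a; split=> // t ta tb; rewrite mulNr oppr_gt0 ltNge.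
by apply: contra_notN no => ut; exists t.
Qed.

Lemma signed_before_weight b u (c : R -> R) : (forall t, 0 < c t) ->
  signed_before b (fun t => c t * u t) <-> signed_before b u.
Proof.
move=> c0; split=> -[s [a [ab H]]]; exists s, a; split=> // t ta tb;
  by move: (H t ta tb); rewrite mulrCA (pmulr_rgt0 _ (c0 t)).
Qed.

Lemma chain_signed_before n nu Y k b : chain n nu Y -> (k < n)%N ->
  signed_before b (Y k) -> signed_before b (Y 0%N).
Proof.
move=> cY; elim: k => [//|k IH] kn Yk1; apply: IH; first exact: ltnW.
have kn' : (k < n)%N by exact: ltnW.
apply/(signed_before_weight _ _ (fun t => expR_gt0 (- nu k * t))).
apply: (signed_before_primitive (fun t => is_derive_factor (cY k t kn'))).
by apply/(signed_before_weight _ _ (fun t => expR_gt0 (- nu k * t))).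
Qed.

Lemma signed_before_continuous u (t0 : R) : {for t0, continuous u} -> u t0 != 0 ->
  signed_before t0%:E u.
Proof.
move=> cu u0; have : 0 < u t0 * u t0 by rewrite lt_def sqr_ge0 mulf_neq0.
have cv : u t0 * u x @[x --> t0] --> u t0 * u t0 by apply: cvgM => //; exact: cvg_cst.
move=> /(cvgr_gt _ cv); rewrite -nbhs_nearE => /nbhs_ballP[e /= e0 H].
exists (u t0), (t0 - e); rewrite lte_fin ltrBlDr ltrDl; split=> // t te; rewrite lte_fin => tt.
by apply: H => /=; rewrite /ball /= ger0_norm ?subr_ge0 ?(ltW tt)// ltrBlDr -ltrBlDl.
Qed.

(** Gronwall's inequality for the sum of the squares of the [Y k]; the bound on [Y n] by [Y 0]
    closes the system. *)
Lemma chain_unique_forward n nu Y (K t0 : R) : chain n nu Y ->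
  (forall t, t0 <= t -> `|Y n t| <= K * `|Y 0%N t|) ->
  (forall k, (k < n)%N -> Y k t0 = 0) -> (0 < n)%N ->
  forall t, t0 <= t -> Y 0%N t = 0.
Proof.
move=> cY YK Y0 n0 t t0t.
pose E t := \sum_(k < n) Y k t ^+ 2.
pose dE t := \sum_(k < n) (2 * Y k t * (nu k * Y k t + Y k.+1 t)).
have dEP (t' : R) : is_derive t' 1 E (dE t').
  have -> : E = \sum_(k < n) (fun t => Y k t ^+ 2) by apply/funext => x; rewrite /E fct_sumE.
  apply: is_derive_sum => k; have H := cY k t' (ltn_ord k).
  by apply: (is_derive_cast (is_derive_fM H H)); ring.
have EY k t' : (k < n)%N -> Y k t' ^+ 2 <= E t'.
  move=> kn; rewrite /E (bigD1 (Ordinal kn))//= lerDl.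
  by apply: sumr_ge0 => i _; exact: sqr_ge0.
have E0 t' : 0 <= E t' by apply: sumr_ge0 => i _; exact: sqr_ge0.
(* The cross term [2 Y_k Y_(k+1)] costs [Y_k ^ 2 + Y_(k+1) ^ 2]; the factor [1 + K ^ 2] bounds the
   second square both inside the chain and for [Y n]. *)
pose C := \sum_(k < n) (2 * `|nu k| + 2 + K ^+ 2).
have dEC t' : t0 <= t' -> dE t' <= C * E t'.
  move=> tt'; rewrite /C mulr_suml; apply: ler_sum => k _.
  have Yk := EY k t' (ltn_ord k).
  have Yk1 : Y k.+1 t' ^+ 2 <= (1 + K ^+ 2) * E t'.
    have [kn|] := ltnP k.+1 n.
      apply: le_trans (EY _ t' kn) _; rewrite mulrDl mul1r lerDl.
      by rewrite mulr_ge0 ?sqr_ge0.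
    move=> nk; have -> : k.+1 = n by apply/eqP; rewrite eqn_leq nk ltn_ord.
    apply: (@le_trans _ _ ((K * `|Y 0%N t'|) ^+ 2)).
      rewrite -(real_normK (num_real (Y n t'))).
      by rewrite ler_sqr ?nnegrE// ?(YK _ tt')// (le_trans _ (YK _ tt')).
    rewrite exprMn real_normK ?num_real// mulrDl mul1r.
    have := EY 0%N t' n0; have := E0 t'; have := sqr_ge0 K => K2 e0 eY.
    have := ler_wpM2l K2 eY; lra.
  have h1 : 2 * Y k t' * Y k.+1 t' <= Y k t' ^+ 2 + Y k.+1 t' ^+ 2.
    have := sqr_ge0 (Y k t' - Y k.+1 t'); rewrite sqrrB -mulr_natl; lra.
  have h2 : nu k * Y k t' ^+ 2 <= `|nu k| * E t'.
    apply: le_trans (ler_wpM2l (normr_ge0 _) Yk).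
    by apply: ler_wpM2r; [exact: sqr_ge0|exact: ler_norm].
  have -> : 2 * Y k t' * (nu k * Y k t' + Y k.+1 t') =
    2 * (nu k * Y k t' ^+ 2) + 2 * Y k t' * Y k.+1 t' by ring.
  have -> : (2 * `|nu k| + 2 + K ^+ 2) * E t' =
    2 * (`|nu k| * E t') + (E t' + (1 + K ^+ 2) * E t') by ring.
  lra.
pose F t := - (expR (- C * t) * E t).
have dF (t' : R) : is_derive t' 1 F (- (expR (- C * t') * (dE t' - C * E t'))).
  apply: is_derive_fN.
  by apply: (is_derive_cast (is_derive_fM (is_derive_expRM (- C) t') (dEP t'))); ring.
have Et : E t = 0.
  apply/le_anti/andP; split=> //.
  have : F t0 <= F t.
    apply: (ge0_derive_le dF) => // t' tt' _.
    by rewrite oppr_ge0 pmulr_rle0 ?expR_gt0// subr_le0 dEC// ltW.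
  have -> : F t0 = 0.
    by rewrite /F /E big1 ?mulr0 ?oppr0// => i _; rewrite Y0 ?expr0n.
  by rewrite /F oppr_ge0 pmulr_rle0// expR_gt0.
have := EY 0%N t n0; rewrite Et => Y2.
by apply/eqP; rewrite -sqrf_eq0 eq_le Y2 sqr_ge0.
Qed.

Lemma chain_unique n nu Y (K t0 : R) : chain n nu Y ->
  (forall t, `|Y n t| <= K * `|Y 0%N t|) ->
  (forall k, (k < n)%N -> Y k t0 = 0) -> (0 < n)%N ->
  forall t, Y 0%N t = 0.
Proof.
move=> cY YK Y0 n0 t; have [tt|tt] := leP t0 t.
  exact: (chain_unique_forward cY (fun t _ => YK t) Y0 n0 tt).
have H : forall s, - t0 <= s -> (-1) ^+ 0 * Y 0%N (- s) = 0.
  apply: (@chain_unique_forward n _ _ K (- t0) (chain_reflect cY)) => //.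
    by move=> s _; rewrite expr0 mul1r normrM normrX normrN1 expr1n mul1r.
  by move=> k kn; rewrite opprK Y0// mulr0.
by have := H (- t); rewrite lerN2 expr0 mul1r opprK; apply; exact: ltW.
Qed.

End Chains.

(** * Supersolutions of first-order linear equations *)

Section Comparison.
Variable R : realType.
Implicit Types (nu t T : R) (y h B dB : R -> R).

(** [B] is a supersolution for both [y] and [- y], so the gap weighted by the integrating factor
    cannot decrease; the defect at [T] is carried along by the homogeneous solution. *)
Lemma compare_forward y h B dB nu T : (forall t : R, is_derive t 1 y (nu * y t + h t)) ->
  (forall t : R, is_derive t 1 B (dB t)) ->
  (forall t, T <= t -> nu * B t + `|h t| <= dB t) -> 0 <= B T ->
  forall t, T <= t -> `|y t| <= B t + expR (nu * (t - T)) * `|y T|.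
Proof.
move=> dy dB' hB BT t Tt.
suff H (z g : R -> R) : (forall t : R, is_derive t 1 z (nu * z t + g t)) ->
    (forall t, `|g t| = `|h t|) -> z t <= B t + expR (nu * (t - T)) * `|z T|.
  rewrite ler_norml (H y h)// andbT -lerNl -(normrN (y T)).
  apply: (H (fun t => - y t) (fun t => - h t)) => s; last by rewrite normrN.
  by apply: (is_derive_cast (is_derive_fN (dy s))); ring.
move=> dz gh.
have dBz (s : R) : is_derive s 1 (fun s => B s - z s) (nu * (B s - z s) + (dB s - nu * B s - g s)).
  by apply: (is_derive_cast (is_derive_fB (dB' s) (dz s))); ring.
have : expR (- nu * T) * (B T - z T) <= expR (- nu * t) * (B t - z t).
  apply: (ge0_derive_le (fun s => @is_derive_factor R _ (fun s => dB s - nu * B s - g s) nu s (dBz s))) => // s Ts _.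
  rewrite mulr_ge0 ?expR_ge0//; have := hB s (ltW Ts); have := le_normr (g s).
  by rewrite gh; lra.
rewrite -(ler_pM2l (expR_gt0 (nu * t))) !mulrA -!expRD.
have -> : nu * t + - nu * T = nu * (t - T) by ring.
have -> : nu * t + - nu * t = 0 by ring.
rewrite expR0 mul1r => H; have e0 := expR_gt0 (nu * (t - T)).
have : expR (nu * (t - T)) * (- `|z T|) <= expR (nu * (t - T)) * (B T - z T).
  by rewrite ler_pM2l//; have := le_normr (z T); lra.
by rewrite mulrN; lra.
Qed.

(** Integration from +oo: the weighted gap cannot increase, and it is almost nonnegative at
    arbitrarily late times. Such times come either from a bound on [y] when [nu > 0], or from late
    zeros of [y]. *)
Lemma compare_backward y h B dB nu T : (forall t : R, is_derive t 1 y (nu * y t + h t)) ->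
  (forall t : R, is_derive t 1 B (dB t)) ->
  (forall t, T <= t -> dB t <= nu * B t - `|h t|) ->
  (forall s e, T <= s -> 0 < e ->
     exists2 t, s <= t & - e <= expR (- nu * t) * (B t - `|y t|)) ->
  forall t, T <= t -> `|y t| <= B t.
Proof.
move=> dy dB' hB By t Tt.
suff H (z g : R -> R) : (forall t : R, is_derive t 1 z (nu * z t + g t)) ->
    (forall t, `|g t| = `|h t|) -> (forall t, `|z t| = `|y t|) -> z t <= B t.
  rewrite ler_norml (H y h)// andbT -lerNl.
  apply: (H (fun t => - y t) (fun t => - h t)) => s; rewrite ?normrN//.
  by apply: (is_derive_cast (is_derive_fN (dy s))); ring.
move=> dz gh zy; rewrite -subr_ge0 -(pmulr_rge0 _ (expR_gt0 (- nu * t))).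
apply/ler_addgt0Pr => e e0; rewrite -lerBlDr sub0r.
have [s ts] := By t e Tt e0; move/le_trans; apply.
apply: (@le_trans _ _ (expR (- nu * s) * (B s - z s))).
  by rewrite ler_pM2l ?expR_gt0// lerB// -zy ler_norm.
rewrite -lerN2.
have dBz (x : R) : is_derive x 1 (fun s => B s - z s) (nu * (B x - z x) + (dB x - nu * B x - g x)).
  by apply: (is_derive_cast (is_derive_fB (dB' x) (dz x))); ring.
apply: (ge0_derive_le (fun s => is_derive_fN
  (@is_derive_factor R _ (fun s => dB s - nu * B s - g s) nu s (dBz s)))) => // x tx _.
rewrite oppr_ge0 pmulr_rle0 ?expR_gt0//; have := hB x (ltW (le_lt_trans Tt tx)).
by have := le_normr (- g x); rewrite normrN gh; lra.
Qed.

Lemma le_halves_limit (x y M : R) : (forall j : nat, x <= y + M / 2 ^+ j) -> x <= y.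
Proof.
move=> H; apply/ler_addgt0Pr => e e0.
pose j := Num.bound (`|M| / e).
have Mj : `|M| / e < 2 ^+ j.
  apply: lt_trans (archi_boundP _) _; first by rewrite divr_ge0// ltW.
  by rewrite -natrX ltr_nat ltn_expl.
apply: le_trans (H j) _; rewrite lerD2l ler_pdivrMr ?exprn_gt0//.
apply: le_trans (ler_norm _) _; move: Mj; rewrite ltr_pdivrMr// mulrC.
by move/ltW.
Qed.

End Comparison.

(** * Decay at +oo along a chain *)

Section Decay.
Variable R : realType.
Implicit Types (n : nat) (nu : nat -> R) (Y : nat -> R -> R) (u g y h : R -> R) (t T : R).

(** Each equation is solved at the price of a factor [1 / d]: forward from [T] if its exponent is at
    most [- 2 d], which leaves a boundary term in [C], and backward from +oo if it is at least
    [2 d], thanks to the boundedness assumed there. *)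
Lemma chain_bound_transfer n nu Y k d T : chain n nu Y -> (k <= n)%N -> 0 < d ->
  (forall i, (i < n)%N ->
     (nu i <= - (2 * d)) \/ (2 * d <= nu i /\ exists M, forall t, T <= t -> `|Y i t| <= M)) ->
  exists2 C, 0 <= C & forall a c, 0 <= a -> 0 <= c ->
    (forall t, T <= t -> `|Y k t| <= a * expR (- d * t) + c) ->
    forall t, T <= t -> `|Y 0%N t| <= (a / d ^+ k + C) * expR (- d * t) + c / d ^+ k.
Proof.
move=> cY + d0 Hn; elim: k => [_|k IH kn].
  exists 0 => // a c a0 c0 H t Tt; rewrite expr0 !divr1 addr0; exact: H.
have [C C0 HC] := IH (ltnW kn).
(* In the forward case the homogeneous solution started at [T] is at most [C1 * expR (- d * t)]. *)
pose C1 := expR (d * T) * `|Y k T|.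
have C10 : 0 <= C1 by rewrite mulr_ge0 ?expR_ge0.
have dn0 : d != 0 by rewrite gt_eqF.
exists (C1 / d ^+ k + C).
  by rewrite addr_ge0// divr_ge0// exprn_ge0// ltW.
move=> a c a0 c0 H t Tt.
have ad0 : 0 <= a / d by rewrite divr_ge0// ltW.
have cd0 : 0 <= c / d by rewrite divr_ge0// ltW.
suff : forall t, T <= t -> `|Y k t| <= (a / d + C1) * expR (- d * t) + c / d.
  move/(HC _ _ (addr_ge0 ad0 C10) cd0)/(_ t Tt); rewrite exprSr invfM !mulrA.
  rewrite -[a / d ^+ k / d]mulrA [_^-1 / d]mulrC mulrA.
  rewrite -[c / d ^+ k / d]mulrA [_^-1 / d]mulrC mulrA.
  by rewrite !mulrDl addrA.
move=> {t Tt}.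
(* [d * B] is the bound on [Y k.+1], whence [B' = - d B + c]; exponents at distance [2 d] from 0
   leave a margin of [d B] for the source. *)
pose B t := a / d * expR (- d * t) + c / d.
pose dB t := a / d * (- d * expR (- d * t)).
have dBP (t : R) : is_derive t 1 B (dB t).
  apply: (is_derive_cast (is_derive_fD (is_derive_fZ (a / d) (is_derive_expRM (- d) t))
    (is_derive_cst (c / d) t 1))).
  by rewrite addr0.
have B0 t : 0 <= B t by rewrite addr_ge0// mulr_ge0// expR_ge0.
have dy (t : R) : is_derive t 1 (Y k) (nu k * Y k t + Y k.+1 t) by exact: cY.
have BdE t : B t * d = a * expR (- d * t) + c by rewrite /B; field.
have dBE t : dB t = - (B t * d) + c by rewrite BdE /dB; field.
have [nuk|[nuk [M HM]]] := Hn k kn.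
  move=> t Tt; apply: le_trans (compare_forward dy dBP _ (B0 T) Tt) _.
    move=> s Ts; rewrite dBE; have := H s Ts; rewrite -BdE.
    have := ler_wpM2r (B0 s) nuk; have := B0 s; move: (B s) => b b0; lra.
  rewrite /B mulrDl [leRHS]addrAC lerD2l /C1 mulrAC ler_wpM2r//.
  rewrite -expRD ler_expR.
  have -> : d * T + - d * t = - d * (t - T) by ring.
  by rewrite ler_wpM2r ?subr_ge0//; lra.
move=> t Tt; apply: (@le_trans _ _ (B t)); last first.
  by rewrite /B lerD2r ler_wpM2r ?expR_ge0// lerDl.
apply: (compare_backward dy dBP) Tt.
  move=> s Ts; rewrite dBE; have := H s Ts; rewrite -BdE.
  have cB : c <= B s * d by rewrite BdE lerDr mulr_ge0// expR_ge0.
  have := ler_wpM2r (B0 s) nuk; have := B0 s; move: (B s) cB => b cB b0; lra.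
move=> s e Ts e0.
have M0 : 0 <= M by apply: le_trans (HM T (lexx _)).
have nuk0 : 0 < nu k by apply: lt_le_trans nuk; rewrite mulr_gt0.
(* Gives [nu k * t1 >= M / e], so that the exponential exceeds [M / e]. *)
pose t1 := Num.max s (M / e / nu k).
have st : s <= t1 by rewrite le_max lexx.
exists t1 => //; rewrite -lerN2 opprK -mulrN opprB mulNr expRN mulrC ler_pdivrMr ?expR_gt0//.
apply: (@le_trans _ _ M).
  by have := HM t1 (le_trans Ts st); have := B0 t1; lra.
have : M / e <= nu k * t1 by rewrite [nu k * _]mulrC -ler_pdivrMr// le_max lexx orbT.
move=> Met; have := expR_ge1Dx (nu k * t1) => ge1.
rewrite mulrC -ler_pdivrMr//; lra.
Qed.

(* The bound [a e^{-dt} + c] improves to [(a/2 + C) e^{-dt} + c/2]; the constant part is iterated away. *)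
Lemma chain_exponential_decay n nu Y d T M : chain n nu Y -> 0 < d ->
  (forall i, (i < n)%N ->
     (nu i <= - (2 * d)) \/ (2 * d <= nu i /\ exists M, forall t, T <= t -> `|Y i t| <= M)) ->
  (forall t, T <= t -> `|Y 0%N t| <= M) ->
  (forall t, T <= t -> `|Y n t| <= d ^+ n / 2 * `|Y 0%N t|) ->
  exists C, forall t, T <= t -> `|Y 0%N t| <= C * expR (- d * t).
Proof.
move=> cY d0 Hn YM Ynn; have [C C0 HC] := chain_bound_transfer cY (leqnn n) d0 Hn.
have M0 : 0 <= M by apply: le_trans (YM T (lexx _)).
have dn0 : 0 < d ^+ n by exact: exprn_gt0.
(* [2 * C] is the fixed point of [a |-> a / 2 + C]: the exponential part stays put while the
   constant part is halved [j] times. *)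
exists (2 * C) => t Tt; apply: (@le_halves_limit _ _ _ M) => j; move: t Tt.
elim: j => [|j IH] t Tt.
  rewrite expr0 divr1; apply: le_trans (YM t Tt) _.
  by rewrite lerDr mulr_ge0 ?expR_ge0// mulr_ge0.
have H s : T <= s -> `|Y n s| <=
    d ^+ n * C * expR (- d * s) + d ^+ n * (M / 2 ^+ j / 2).
  move=> Ts; apply: le_trans (Ynn s Ts) _.
  have := ler_wpM2l (ltW dn0) (IH s Ts); lra.
have c0 : 0 <= d ^+ n * (M / 2 ^+ j / 2).
  by rewrite mulr_ge0 ?(ltW dn0)// divr_ge0// divr_ge0// exprn_ge0.
have := HC _ _ (mulr_ge0 (ltW dn0) C0) c0 H t Tt.
have -> : d ^+ n * C / d ^+ n = C by field; rewrite gt_eqF.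
have -> : d ^+ n * (M / 2 ^+ j / 2) / d ^+ n = M / 2 ^+ j.+1.
  by rewrite exprS; field; rewrite expf_neq0 ?gt_eqF.
have -> : C + C = 2 * C by ring.
by [].
Qed.

Definition decays (gam : R) y :=
  exists M T, 0 <= M /\ forall t, T <= t -> `|y t| <= M * expR (- gam * t).

Lemma decaysW (g1 g2 : R) y : g2 <= g1 -> decays g1 y -> decays g2 y.
Proof.
move=> g21 [M [T [M0 H]]]; exists M, (Num.max T 0); split=> // t.
rewrite ge_max => /andP[Tt t0]; apply: le_trans (H t Tt) _.
by rewrite ler_wpM2l// ler_expR ler_wpM2r// lerN2.
Qed.

(** The decay rate of [h] passes to [y]: by forward comparison when the homogeneous solution decays
    faster, and otherwise from the late zeros of [y]. Only the resonance [g1 = - nu] costs part of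
    the rate. *)
Lemma decays_peel (g1 g2 nu : R) y h : (forall t : R, is_derive t 1 y (nu * y t + h t)) ->
  g2 < g1 -> (forall T, exists2 t, T <= t & y t = 0) -> decays g1 h -> decays g2 y.
Proof.
move=> dy g21 zy; wlog gn : g1 g21 / g1 + nu != 0.
  move=> W; have [gn|gn] := eqVneq (g1 + nu) 0; last exact: W gn.
  pose g3 := (g1 + g2) / 2; move=> /(@decaysW _ g3) D; apply: (W g3).
  - by rewrite /g3; lra.
  - have -> : g3 + nu = (g2 - g1) / 2 by rewrite /g3; lra.
    by rewrite lt_eqF//; lra.
  - by apply: D; rewrite /g3; lra.
move=> [M [T [M0 H]]]; apply: (@decaysW g1); first exact: ltW.
(* Then [dB - nu * B] is [M * expR (- g1 * t)] up to a sign opposite to that of [g1 + nu], and this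
   sign selects forward or backward comparison. *)
pose A := M / `|g1 + nu|; have A0 : 0 <= A by rewrite divr_ge0.
pose B t := A * expR (- g1 * t); pose dB t := A * (- g1 * expR (- g1 * t)).
have dBP (t : R) : is_derive t 1 B (dB t) by exact: is_derive_fZ (is_derive_expRM _ _).
have B0 t : 0 <= B t by rewrite mulr_ge0// expR_ge0.
have AE : A * `|g1 + nu| = M by rewrite /A divfK// normr_eq0.
case: (ltrgt0P (g1 + nu)) gn AE => // gn _ AE; last first.
  exists (A + expR (g1 * T) * `|y T|), T; split.
    by rewrite addr_ge0// mulr_ge0// expR_ge0.
  move=> t Tt; apply: le_trans (compare_forward dy dBP _ (B0 T) Tt) _.
    move=> s Ts; apply: le_trans (lerD (lexx _) (H s Ts)) _.
    by rewrite -AE /B /dB le_eqVlt; apply/orP; left; apply/eqP; ring.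
  rewrite mulrDl lerD2l mulrAC ler_wpM2r// -expRD ler_expR.
  have -> : g1 * T + - g1 * t = - g1 * (t - T) by ring.
  by rewrite ler_wpM2r ?subr_ge0//; lra.
exists A, T; split=> // t Tt; apply: (compare_backward dy dBP _ _ Tt).
  move=> s Ts; apply: le_trans (lerB (lexx _) (H s Ts)).
  by rewrite -AE /B /dB le_eqVlt; apply/orP; left; apply/eqP; ring.
move=> s e Ts e0; have [t' st yt] := zy s; exists t' => //.
by rewrite yt normr0 subr0 (@le_trans _ _ 0) ?oppr_le0 ?(ltW e0)// mulr_ge0 ?expR_ge0.
Qed.

Lemma chain_decays n nu Y k (g1 g2 : R) : chain n nu Y -> (k <= n)%N ->
  (forall i T, (i < n)%N -> exists2 t, T <= t & Y i t = 0) ->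
  g2 < g1 -> decays g1 (Y k) -> decays g2 (Y 0%N).
Proof.
move=> cY + zY; elim: k g1 => [|k IH] g1 kn g21 D; first exact: decaysW (ltW g21) D.
apply: (IH ((g1 + g2) / 2)) (ltnW kn) _ _; first lra.
apply: (decays_peel (fun t => cY k t kn) _ _ D); first lra.
by move=> T; exact: zY.
Qed.

(** [Y n] decays faster than [Y 0] by [d], and solving the equations of the chain loses at most
    [d / 2], so the decay rate of [Y 0] is unbounded. Beyond a rate that dominates all exponents,
    backward comparison keeps constants, and the small factor in the bound on [Y n] halves them
    again and again. *)
Lemma chain_oscillating_eq0 n nu Y (C d T0 M : R) : chain n nu Y -> 0 < d ->
  (forall t, T0 <= t -> `|Y n t| <= C * expR (- d * t) * `|Y 0%N t|) ->
  (forall t, T0 <= t -> `|Y 0%N t| <= M) ->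
  (forall i T, (i < n)%N -> exists2 t, T <= t & Y i t = 0) ->
  exists T, forall t, T <= t -> Y 0%N t = 0.
Proof.
move=> cY d0 Yn YM zY.
wlog C0 : C Yn / 0 < C.
  move=> W; apply: (W (`|C| + 1)); last by rewrite ltr_wpDl.
  move=> t T0t; apply: le_trans (Yn t T0t) _; rewrite ler_wpM2r// ler_wpM2r ?expR_ge0//.
  by apply: le_trans (ler_norm _) _; rewrite lerDl.
have Dn (g : R) : decays g (Y 0%N) -> decays (g + d) (Y n).
  move=> [A [T [A0 H]]]; exists (C * A), (Num.max T T0); split; first by rewrite mulr_ge0// ltW.
  move=> t; rewrite ge_max => /andP[Tt T0t]; apply: le_trans (Yn t T0t) _.
  apply: le_trans (ler_wpM2l _ (H t Tt)) _; first by rewrite mulr_ge0 ?expR_ge0// ltW.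
  rewrite mulrACA -expRD le_eqVlt; apply/orP; left; apply/eqP; congr (_ * expR _); ring.
have Dj (j : nat) : decays (j%:R * (d / 2)) (Y 0%N).
  elim: j => [|j IH].
    exists M, T0; split; first by apply: le_trans (YM T0 (lexx _)).
    by move=> t Tt; rewrite mul0r oppr0 mul0r expR0 mulr1 YM.
  apply: (chain_decays cY (leqnn n) zY _ (Dn _ IH)); rewrite -natr1; lra.
(* With [nu k + g >= 1], backward comparison reproduces a bound [a * expR (- g * t)] with the same
   [a]. *)
pose g := 1 + \sum_(k < n) `|nu k|.
have gnu k : (k < n)%N -> 1 <= nu k + g.
  move=> kn; rewrite /g (bigD1 (Ordinal kn))//=.
  have : 0 <= \sum_(i < n | i != Ordinal kn) `|nu i| by apply: sumr_ge0.
  by have := le_normr (- nu k); rewrite normrN; lra.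
have [A [T1 [A0 H1]]] : decays g (Y 0%N).
  apply: (decaysW _ (Dj (Num.bound (g / (d / 2))))).
  rewrite -ler_pdivrMr ?divr_gt0//; apply/ltW/archi_boundP.
  by rewrite divr_ge0 ?divr_ge0 ?(ltW d0)// /g addr_ge0// sumr_ge0.
(* From [T] on, [Y n] is at most half of [Y 0] in absolute value. *)
pose T := Num.max (Num.max T0 T1) (2 * C / d).
have CT t : T <= t -> C * expR (- d * t) <= 2^-1.
  rewrite ge_max => /andP[_]; rewrite ler_pdivrMr// => Ct.
  rewrite mulNr expRN ler_pdivrMr ?expR_gt0// [_ * expR _]mulrC ler_pdivlMr//.
  by have := expR_ge1Dx (d * t); rewrite [d * t]mulrC; lra.
have back k (a : R) : (k <= n)%N -> 0 <= a ->
    (forall t, T <= t -> `|Y k t| <= a * expR (- g * t)) ->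
    forall t, T <= t -> `|Y 0%N t| <= a * expR (- g * t).
  move=> + a0; elim: k => [//|k IH] kn Hk; apply: IH; first exact: ltnW.
  move=> t Tt; pose B t := a * expR (- g * t); pose dB t := a * (- g * expR (- g * t)).
  have dBP (s : R) : is_derive s 1 B (dB s) by exact: is_derive_fZ (is_derive_expRM _ _).
  have B0 s : 0 <= B s by rewrite mulr_ge0// expR_ge0.
  apply: (compare_backward (fun t => cY k t kn) dBP _ _ Tt).
    move=> s Ts; have := Hk s Ts; rewrite -/(B s).
    have -> : dB s = - g * B s by rewrite /dB /B; ring.
    have := ler_wpM2r (B0 s) (gnu k kn); rewrite mul1r mulrDl; lra.
  move=> s e Ts e0; have [t' st yt] := zY k s kn; exists t' => //.
  by rewrite yt normr0 subr0 (@le_trans _ _ 0) ?oppr_le0 ?(ltW e0)// mulr_ge0 ?expR_ge0.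
have Hj (j : nat) : forall t, T <= t -> `|Y 0%N t| <= A / 2 ^+ j * expR (- g * t).
  elim: j => [|j IH].
    by move=> t; rewrite ge_max expr0 divr1 => /andP[]; rewrite ge_max => /andP[_ +] _; exact: H1.
  apply: (back n) => //; first by rewrite divr_ge0// exprn_ge0.
  move=> t Tt; have T0t : T0 <= t by apply: le_trans Tt; rewrite !le_max lexx.
  apply: le_trans (Yn t T0t) _; apply: le_trans (ler_pM _ _ (CT t Tt) (IH t Tt)) _ => //.
    by rewrite mulr_ge0 ?expR_ge0// ltW.
  by rewrite exprSr invfM !mulrA [2^-1 * A]mulrC -![A / _ / _]mulrA [2^-1 / _]mulrC.
exists T => t Tt; apply/eqP; rewrite -normr_le0.
apply: (@le_halves_limit _ _ _ (A * expR (- g * t))) => j.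
by rewrite add0r mulrAC Hj.
Qed.

End Decay.

(** * Zeros and alternations of the first member of a chain *)

Section ZeroCount.
Variable R : realType.
Implicit Types (n : nat) (nu : nat -> R) (Y : nat -> R -> R) (u : R -> R).

(** Finitely many balls of isolation cover [[- T, T]], and each contains no zero except possibly its
    centre. *)
Lemma isolated_zeros_finite u (T : R) :
  (forall t0, exists2 e, 0 < e & forall t, t != t0 -> `|t - t0| < e -> u t != 0) ->
  (forall t, T < `|t| -> u t != 0) ->
  exists D : seq R, forall t, u t = 0 -> t \in D.
Proof.
move=> iso outT.
have /choice[e He] : forall t0, exists e, 0 < e /\
    forall t, t != t0 -> `|t - t0| < e -> u t != 0.
  by move=> t0; have [e e0 H] := iso t0; exists e.
have := @segment_compact R (- T) T; rewrite compact_cover.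
move=> /(_ R setT (fun x => ball x (e x))) [].
- by move=> x _; apply: ball_open; case: (He x).
- by move=> x _; exists x => //; apply: ballxx; case: (He x).
move=> D _ cov; exists (finmap.enum_fset D) => t ut.
have : [set` `[- T, T]%R] t.
  rewrite /= in_itv /= -ler_norml leNgt; apply/negP => /outT.
  by rewrite ut eqxx.
move=> /cov[x /= xD]; rewrite /ball /= => xt.
have [->//|tx] := eqVneq t x.
by have := (He x).2 t tx; rewrite distrC ut eqxx => /(_ xt).
Qed.

Lemma path_alternates_zeros u (a : R) (s : seq R) : continuous u ->
  path (altr u) a s ->
  exists2 z : seq R, size z = size s & path <%R a z /\ all (fun t => u t == 0) z.
Proof.
move=> cu; elim: s a => [|b s IH] a /=; first by exists [::].
move=> /andP[/andP[ab uab] /IH[z sz [pz z0]]].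
have [c acb uc] : exists2 c, c \in `[a, b]%R & u c = 0.
  apply: IVT; first exact: ltW.
    exact: continuous_subspaceT.
  rewrite ge_min le_max; move: uab; rewrite mulr_lt0.
  by case/and3P=> ua ub; case: (ltrgt0P (u a)) ua => // _ _; case: (ltrgt0P (u b)) ub.
have ca : c != a by apply: contraTneq uab => <-; rewrite uc mul0r ltxx.
have cb : c != b by apply: contraTneq uab => <-; rewrite uc mulr0 ltxx.
move: acb; rewrite in_itv /= !le_eqVlt [a == c]eq_sym (negbTE ca) (negbTE cb) /= => /andP[ac cb'].
exists (c :: z); first by rewrite /= sz.
rewrite /= ac uc eqxx; split=> //.
by move: pz; case: (z) => //= d z' /andP[bd ->]; rewrite (lt_trans cb').
Qed.

Lemma alternates_bounded u (D : seq R) : continuous u ->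
  (forall t, u t = 0 -> t \in D) ->
  forall s, alternates u s -> (size s <= (size D).+1)%N.
Proof.
move=> cu HD [//|a s] /andP[_ /(path_alternates_zeros cu)[z sz [pz z0]]].
rewrite /= -sz ltnS; apply: uniq_leq_size.
  by apply: (sorted_uniq lt_trans ltxx); exact: path_sorted pz.
by move=> t /(allP z0)/eqP/HD.
Qed.

(** If all members vanish at [t0], uniqueness makes [Y 0] zero. Otherwise some [Y k] has a sign just
    before [t0], which descends to [Y 0]; the reflected chain treats the other side. *)
Lemma chain_isolated_zeros n nu Y (K t0 : R) : chain n nu Y -> (0 < n)%N ->
  (forall t, `|Y n t| <= K * `|Y 0%N t|) ->
  (exists t, Y 0%N t != 0) ->
  exists2 e, 0 < e & forall t, t != t0 -> `|t - t0| < e -> Y 0%N t != 0.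
Proof.
move=> cY n0 YK [t1 Yt1].
have [[k kn Yk]|no] := pselect (exists2 k, (k < n)%N & Y k t0 != 0); last first.
  case/eqP: Yt1; apply: (chain_unique (t0 := t0) cY YK _ n0) => k kn.
  by apply/eqP; apply/negP => /negP H; apply: no; exists k.
have [s [a [at0 Ha]]] : signed_before t0%:E (Y 0%N).
  apply: (chain_signed_before cY kn); apply: signed_before_continuous => //.
  exact: is_derive_continuous (cY k t0 kn).
pose Z (k : nat) t := (-1) ^+ k * Y k (- t).
have [s' [a' [at0' Ha']]] : signed_before (- t0)%:E (Z 0%N).
  have cZ : chain n (fun k => - nu k) Z := chain_reflect cY.
  apply: (chain_signed_before cZ kn); apply: signed_before_continuous.
    exact: is_derive_continuous (cZ k (- t0) kn).
  by rewrite /Z opprK mulf_neq0// signr_eq0.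
move: at0 at0'; rewrite !lte_fin => at0 at0'.
exists (Num.min (t0 - a) (- a' - t0)).
  by rewrite lt_min !subr_gt0 at0 ltrNr.
move=> t tt0; rewrite lt_min !ltr_norml => /andP[/andP[h1 _] /andP[_ h2]].
have [tlt|tgt|E] := ltgtP t t0; last by rewrite E eqxx in tt0.
  have := Ha t; rewrite lte_fin => /(_ _ tlt) H.
  have : 0 < s * Y 0%N t by apply: H; lra.
  by apply: contraTneq => ->; rewrite mulr0 ltxx.
have := Ha' (- t); rewrite lte_fin ltrN2 => /(_ _ tgt); rewrite /Z opprK => H.
have : 0 < s' * ((-1) ^+ 0 * Y 0%N t) by apply: H; lra.
by apply: contraTneq => ->; rewrite !mulr0 ltxx.
Qed.

Lemma signed_beforeyP u : signed_before +oo u -> exists T : R, forall t, T < t -> u t != 0.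
Proof.
move=> [s [a [_ H]]]; exists a => t at_; have := H t at_ (ltry t).
by apply: contraTneq => ->; rewrite mulr0 ltxx.
Qed.

Lemma not_signed_beforey_zero u : continuous u -> ~ signed_before +oo u ->
  forall T, exists2 t, T <= t & u t = 0.
Proof.
move=> cu nu T; apply: contrapT => no; apply: nu.
have u0 t : T <= t -> u t != 0 by move=> Tt; apply/eqP => ut; apply: no; exists t.
exists (u T), T; split; first exact: ltry.
move=> t Tt _; rewrite lt_def mulf_neq0 ?u0 ?(ltW Tt)//=.
rewrite leNgt; apply/negP => neg; apply: no.
have [c] : exists2 c, c \in `[T, t]%R & u c = 0.
  apply: IVT; [exact: ltW|exact: continuous_subspaceT|].
  rewrite ge_min le_max; move: neg; rewrite mulr_lt0.
  by case/and3P=> ua ub; case: (ltrgt0P (u T)) ua => // _ _; case: (ltrgt0P (u t)) ub.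
by rewrite in_itv /= => /andP[Tc _] uc; exists c.
Qed.

(** If [Y 0] has no final sign, neither has any [Y i], so all members have arbitrarily late zeros;
    then [Y 0] vanishes on a half-line, against the isolation of its zeros. *)
Lemma chain_nonoscillating n nu Y (C d T0 M : R) : chain n nu Y -> (0 < n)%N -> 0 < d ->
  (forall t, `|Y n t| <= C * `|Y 0%N t|) ->
  (forall t, T0 <= t -> `|Y n t| <= C * expR (- d * t) * `|Y 0%N t|) ->
  (forall t, T0 <= t -> `|Y 0%N t| <= M) ->
  (exists t, Y 0%N t != 0) ->
  exists T, forall t, T < t -> Y 0%N t != 0.
Proof.
move=> cY n0 d0 YK Yn YM [t1 Yt1].
have [S|nS] := pselect (signed_before +oo (Y 0%N)); first exact: signed_beforeyP.
have [T HT] : exists T, forall t, T <= t -> Y 0%N t = 0.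
  apply: (chain_oscillating_eq0 cY d0 Yn YM) => i T iltn.
  apply: not_signed_beforey_zero.
    by move=> t; exact: is_derive_continuous (cY i t iltn).
  by move=> S; apply: nS; exact: chain_signed_before cY iltn S.
have [e e0 He] := chain_isolated_zeros T cY n0 YK (ex_intro _ t1 Yt1).
have := He (T + e / 2); rewrite HT ?eqxx; last by rewrite lerDl divr_ge0 ?ltW.
have -> : T + e / 2 - T = e / 2 by ring.
rewrite ger0_norm ?divr_ge0 ?(ltW e0)// => H.
suff : false by [].
apply: H; last lra.
by rewrite gt_eqF// ltrDl divr_gt0.
Qed.

(** One vanishing end per equation is enough to carry all the alternating points from [Y i] to
    [Y n]. *)
Lemma chain_alternates n nu Y i a s : chain n nu Y -> (i <= n)%N ->
  (forall k, (i <= k < n)%N -> vanishes_left (fun t => expR (- nu k * t) * Y k t) \/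
                   vanishes_right (fun t => expR (- nu k * t) * Y k t)) ->
  alternates (Y i) (a :: s) ->
  exists a' s', size s' = size s /\ alternates (Y n) (a' :: s').
Proof.
move=> cY + vk As; move E : (n - i)%N => d; elim: d i a s E vk As => [|d IH] i a s E vk As i_n.
  exists a, s; split=> //.
  by have -> : n = i; [apply/eqP; rewrite eqn_leq i_n -subn_eq0 E|].
have iltn : (i < n)%N by rewrite -subn_gt0 E.
have wt s1 : alternates (fun t => expR (- nu i * t) * Y i t) s1 = alternates (Y i) s1.
  by apply: alternates_weight => t; exact: expR_gt0.
have wt' s1 : alternates (fun t => expR (- nu i * t) * Y i.+1 t) s1 = alternates (Y i.+1) s1.
  by apply: alternates_weight => t; exact: expR_gt0.
have dfac (t : R) := is_derive_factor (cY i t iltn).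
have [a1 [s1 [ss1 A1]]] : exists a' s', size s' = size s /\ alternates (Y i.+1) (a' :: s').
  move: As; rewrite -wt => As.
  have [|vl|vr] := vk i; first by rewrite leqnn iltn.
    have nof : false -> vanishes_right (fun t => expR (- nu i * t) * Y i t) by [].
    have [[//|a2 s2] [ss2]] := rolle_left dfac vl nof As.
    by rewrite wt' => A2; exists a2, s2; rewrite ss2 addn0.
  have [[//|a2 s2] [ss2]] := @rolle_right R _ _ a s dfac vr As.
  by rewrite wt' => A2; exists a2, s2; rewrite ss2.
rewrite -ss1; apply: (IH i.+1 a1 s1) => //; first by rewrite subnS E.
by move=> k /andP[ik kn]; apply: vk; rewrite kn (ltnW ik).
Qed.

(* Rolle's theorem along the chain produces one more alternation of [Y n] than of [Y 0], and
   [Y n] alternates exactly where [Y 0] does. *)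
Lemma chain_eq0 n nu Y (C d M : R) : chain n nu Y -> (0 < n)%N -> 0 < d ->
  (forall t, `|Y n t| <= C * `|Y 0%N t|) ->
  (forall t, `|Y n t| <= C * expR (- d * `|t|) * `|Y 0%N t|) ->
  (forall t, `|Y 0%N t| <= M) ->
  (forall a b, Y n a * Y n b < 0 -> Y 0%N a * Y 0%N b < 0) ->
  vanishes_left (fun t => expR (- nu 0%N * t) * Y 0%N t) ->
  vanishes_right (fun t => expR (- nu 0%N * t) * Y 0%N t) ->
  (forall k, (0 < k < n)%N -> vanishes_left (fun t => expR (- nu k * t) * Y k t) \/
                   vanishes_right (fun t => expR (- nu k * t) * Y k t)) ->
  forall t, Y 0%N t = 0.
Proof.
move=> cY n0 d0 YC YCd YM Ysgn vl0 vr0 vk t1; apply/eqP; apply/negP => /negP Yt1.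
have {}Yt1 : Y 0%N t1 != 0 by exact: Yt1.
have nz : exists t, Y 0%N t != 0 by exists t1.
have C0 : 0 <= C.
  have y0 : 0 < `|Y 0%N t1| by rewrite normr_gt0.
  by rewrite -(pmulr_lge0 _ y0); exact: le_trans (normr_ge0 _) (YC t1).
have cont : continuous (Y 0%N) by move=> t; exact: is_derive_continuous (cY 0%N t n0).
have [Tr HTr] : exists T, forall t, T < t -> Y 0%N t != 0.
  apply: (@chain_nonoscillating n nu Y C d 0 M) => // t t0.
  by have := YCd t; rewrite (ger0_norm t0).
(* The left end is the right end of the reflected chain. *)
have [Tl HTl] : exists T, forall t, T < t -> (-1) ^+ 0 * Y 0%N (- t) != 0.
  apply: (@chain_nonoscillating n _ _ C d 0 M (chain_reflect cY)) => //.
  - by move=> t; rewrite expr0 mul1r normrM normrX normrN1 expr1n mul1r.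
  - move=> t t0; have := YCd (- t).
    by rewrite expr0 mul1r normrM normrX normrN1 expr1n mul1r normrN (ger0_norm t0).
  - by move=> t _; rewrite expr0 mul1r.
  - by exists (- t1); rewrite opprK expr0 mul1r.
have : exists D : seq R, forall t, Y 0%N t = 0 -> t \in D.
  apply: (@isolated_zeros_finite (Y 0%N) (Num.max Tr Tl)).
    by move=> t0; exact: (chain_isolated_zeros t0 cY n0 YC nz).
  move=> t; rewrite gt_max => /andP[h1 h2].
  have [t0|t0] := leP 0 t; first by apply: HTr; rewrite -(ger0_norm t0).
  by have := HTl (- t); rewrite opprK expr0 mul1r; apply; rewrite -(ltr0_norm t0).
move=> [D /(alternates_bounded cont) HD].
have step a s : alternates (Y 0%N) (a :: s) ->
    exists a' s', size s' = (size s).+1 /\ alternates (Y n) (a' :: s').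
  have wt k s1 : alternates (fun t => expR (- nu 0%N * t) * Y k t) s1 = alternates (Y k) s1.
    by apply: alternates_weight => t; exact: expR_gt0.
  have dfac (t : R) := is_derive_factor (cY 0%N t n0).
  rewrite -wt => /(@rolle_left R _ _ true a s dfac vl0 (fun=> vr0))[[//|a1 s1] [ss1]].
  rewrite wt => /(chain_alternates cY n0 vk)[a2 [s2 [ss2 A2]]].
  by exists a2, s2; rewrite ss2 ss1 addn1.
have Yn0 a : Y n a != 0 -> Y 0%N a != 0.
  by apply: contraNneq => Ya; rewrite -normr_le0; have := YC a; rewrite Ya normr0 mulr0.
have all_sizes j : exists a s, size s = j /\ alternates (Y 0%N) (a :: s).
  elim: j => [|j [a [s [sj As]]]]; first by exists t1, [::]; rewrite /= Yt1.
  have [a' [s' [ss' As']]] := step a s As.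
  exists a', s'; split; first by rewrite ss' sj.
  exact: alternates_imp Yn0 Ysgn As'.
have [a [s [sj As]]] := all_sizes (size D).+1.
by have := HD _ As; rewrite /= sj ltnn.
Qed.

End ZeroCount.

(** * Constant-coefficient differential operators *)

Section DifferentialPolynomials.
Variable R : realType.
Implicit Types (n k : nat) (nu : nat -> R) (Y J : nat -> R -> R) (f g : R -> R) (p q : {poly R}).

(** [n]-fold differentiability, without continuity of the derivative of order [n]. *)
Definition smooth n f := forall (j : nat) (t : R), (j < n)%N -> derivable (f^`(j)) t 1.

(* p(d/dt) f *)
Definition Pop p f (t : R) := \sum_(i < size p) p`_i * derive1n i f t.

Lemma derive1nE n f (t : R) : smooth n.+1 f -> is_derive t 1 (f^`(n)) (f^`(n.+1) t).
Proof.
move=> sf; have d := sf n t (ltnSn n); rewrite derive1nS derive1E.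
exact: derivableP.
Qed.

Lemma smooth0 f : smooth 0 f.
Proof. by move=> j t; rewrite ltn0. Qed.

Lemma smoothW n k f : (k <= n)%N -> smooth n f -> smooth k f.
Proof. by move=> kn sf j t jk; apply: sf; exact: leq_trans jk kn. Qed.

Lemma smoothS n f g : (forall t : R, is_derive t 1 f (g t)) -> smooth n g -> smooth n.+1 f.
Proof.
move=> df sg; have E : f^`() = g.
  by apply/funext => t; rewrite derive1E; exact: derive_val.
case=> [|j] t jn; first by rewrite derive1n0; case: (df t).
by rewrite derive1Sn E; exact: sg.
Qed.

Lemma smooth_derive1 n f : smooth n.+1 f -> smooth n f^`().
Proof. by move=> sf j t jn; rewrite -derive1Sn; exact: sf. Qed.

Lemma smooth_is_derive n f (t : R) : smooth n.+1 f -> is_derive t 1 f (f^`() t).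
Proof. by move=> sf; have := @derive1nE 0 f t (smoothW (ltn0Sn n) sf). Qed.

Lemma smoothD n f g : smooth n f -> smooth n g -> smooth n (fun t => f t + g t).
Proof.
elim: n f g => [f g _ _|n IH f g sf sg]; first exact: smooth0.
apply: (smoothS (fun t => is_derive_fD (smooth_is_derive t sf) (smooth_is_derive t sg))).
exact: IH (smooth_derive1 sf) (smooth_derive1 sg).
Qed.

Lemma smoothM n f g : smooth n f -> smooth n g -> smooth n (fun t => f t * g t).
Proof.
elim: n f g => [f g _ _|n IH f g sf sg]; first exact: smooth0.
apply: (smoothS (fun t => is_derive_fM (smooth_is_derive t sf) (smooth_is_derive t sg))).
apply: smoothD.
  exact: IH (smooth_derive1 sf) (smoothW (leqnSn n) sg).
exact: IH (smoothW (leqnSn n) sf) (smooth_derive1 sg).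
Qed.

Lemma smooth_cst n (c : R) : smooth n (fun=> c).
Proof.
elim: n c => [c|n IH c]; first exact: smooth0.
by apply: (@smoothS n _ (fun=> 0)); exact: IH.
Qed.

Lemma smoothZ n (a : R) f : smooth n f -> smooth n (fun t => a * f t).
Proof. by move=> sf; exact: smoothM (@smooth_cst n a) sf. Qed.

Lemma smooth_reflect n f : smooth n f -> smooth n (fun t => f (- t)).
Proof.
elim: n f => [f _|n IH f sf]; first exact: smooth0.
apply: (smoothS (fun t => is_derive_reflect (smooth_is_derive (- t) sf))).
have := @smoothZ n (-1) _ (IH _ (smooth_derive1 sf)).
by congr smooth; apply/funext => t; rewrite mulN1r.
Qed.

Lemma chain_smooth n nu J k i : chain n nu J -> (k + i <= n)%N -> smooth i (J k).
Proof.
move=> cJ; elim: i k => [k _|i IH k kin]; first exact: smooth0.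
have kn : (k < n)%N by apply: leq_trans kin; rewrite addnS ltnS leq_addr.
apply: (smoothS (fun t => cJ k t kn)); apply: smoothD.
  by apply: smoothZ; apply: IH; apply: leq_trans kin; rewrite addnS.
by apply: IH; rewrite addSn -addnS.
Qed.

Lemma PopE N p f (t : R) : (size p <= N)%N -> Pop p f t = \sum_(i < N) p`_i * derive1n i f t.
Proof.
move=> pN; rewrite /Pop (big_ord_widen N (fun i => p`_i * derive1n i f t) pN).
rewrite big_mkcond; apply: eq_bigr => i _; case: ltnP => // pi.
by rewrite nth_default// mul0r.
Qed.

Lemma PopD p q f (t : R) : Pop (p + q) f t = Pop p f t + Pop q f t.
Proof.
pose N := maxn (size p) (size q).
rewrite (@PopE N p) ?leq_maxl// (@PopE N q) ?leq_maxr// (@PopE N) ?size_polyD//.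
by rewrite -big_split; apply: eq_bigr => i _ /=; rewrite coefD mulrDl.
Qed.

Lemma PopZ (a : R) p f (t : R) : Pop (a *: p) f t = a * Pop p f t.
Proof.
rewrite (@PopE (size p)) ?size_scale_leq// /Pop mulr_sumr.
by apply: eq_bigr => i _; rewrite coefZ mulrA.
Qed.

Lemma Pop1 f (t : R) : Pop 1 f t = f t.
Proof. by rewrite /Pop size_poly1 big_ord1 coef1 mul1r. Qed.

Lemma PopXM n p f (t : R) : smooth n f -> (size p <= n)%N ->
  is_derive t 1 (Pop p f) (Pop ('X * p) f t).
Proof.
move=> sf pn.
have -> : Pop p f = \sum_(i < n) (fun t => p`_i * derive1n i f t).
  by apply/funext => x; rewrite (PopE _ _ pn) fct_sumE.
rewrite (@PopE n.+1); last first.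
  have [->|p0] := eqVneq p 0; first by rewrite mulr0 size_poly0.
  by rewrite -commr_polyX size_mulX// ltnS.
rewrite big_ord_recl coefXM mul0r add0r.
apply: is_derive_sum => i; rewrite coefXM /=.
by apply: is_derive_fZ; apply: derive1nE; apply: smoothW sf; exact: ltn_ord.
Qed.

Lemma Pop_zero p f (t : R) : (forall i, (i < size p)%N -> f^`(i) t = 0) -> Pop p f t = 0.
Proof. by move=> H; rewrite /Pop big1// => i _; rewrite H ?mulr0. Qed.

Lemma PopDf n p f g (t : R) : smooth n f -> smooth n g -> (size p <= n.+1)%N ->
  Pop p (fun t => f t + g t) t = Pop p f t + Pop p g t.
Proof.
move=> sf sg pn; rewrite /Pop -big_split; apply: eq_bigr => i _ /=.
rewrite -mulrDr; congr (_ * _).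
have {pn} : (i <= n)%N by rewrite -ltnS; exact: leq_trans (ltn_ord i) pn.
move: (nat_of_ord i) => {}i.
elim: i n f g sf sg => [|i IH] n f g sf sg; first by rewrite !derive1n0.
case: n sf sg => [|n] sf sg i_n; first by rewrite ltn0 in i_n.
rewrite !derive1Sn -(IH n _ _ (smooth_derive1 sf) (smooth_derive1 sg) i_n).
congr (derive1n i _ t); apply/funext => x; rewrite derive1E.
have := is_derive_fD (smooth_is_derive x sf) (smooth_is_derive x sg).
by move=> ?; exact: derive_val.
Qed.

Lemma PopZf n (a : R) p f (t : R) : smooth n f -> (size p <= n.+1)%N ->
  Pop p (fun t => a * f t) t = a * Pop p f t.
Proof.
move=> sf pn; rewrite /Pop mulr_sumr; apply: eq_bigr => i _ /=.
rewrite mulrCA; congr (_ * _).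
have {pn} : (i <= n)%N by rewrite -ltnS; exact: leq_trans (ltn_ord i) pn.
move: (nat_of_ord i) => {}i.
elim: i n f sf => [|i IH] n f sf; first by rewrite !derive1n0.
case: n sf => [|n] sf i_n; first by rewrite ltn0 in i_n.
rewrite !derive1Sn -(IH n _ (smooth_derive1 sf) i_n).
congr (derive1n i _ t); apply/funext => x; rewrite derive1E.
have := is_derive_fZ a (smooth_is_derive x sf).
by move=> ?; exact: derive_val.
Qed.

(** The Newton basis with nodes [nu i]; as operators, the partial products of the [D - nu i]. *)
Definition newton nu k : {poly R} := \prod_(i < k) ('X - (nu i)%:P).

Lemma newtonS nu k : newton nu k.+1 = 'X * newton nu k - nu k *: newton nu k.
Proof. by rewrite /newton big_ord_recr /= mulrBr mulrC -mul_polyC; congr (_ - _); rewrite mulrC. Qed.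

Lemma newton_monic nu k : newton nu k \is monic.
Proof. exact: monic_prod_XsubC. Qed.

Lemma size_newton nu k : size (newton nu k) = k.+1.
Proof. by rewrite /newton size_prod_XsubC /index_enum -enumT size_enum_ord. Qed.

Lemma Pop_newton_chain n nu f : smooth n f -> chain n nu (fun k => Pop (newton nu k) f).
Proof.
move=> sf k t kn; apply: (is_derive_cast (PopXM t sf _)); first by rewrite size_newton.
rewrite newtonS -scaleNr PopD PopZ; ring.
Qed.

Lemma chain_Pop_newton n nu J k (t : R) : chain n nu J -> (k <= n)%N ->
  J k t = Pop (newton nu k) (J 0%N) t.
Proof.
move=> cJ; have sJ : smooth n (J 0%N) by apply: (chain_smooth cJ).
elim: k t => [|k IH] t kn; first by rewrite /newton big_ord0 Pop1.
have E : J k = Pop (newton nu k) (J 0%N) by apply/funext => x; apply: IH; exact: ltnW.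
have d1 := cJ k t kn; have d2 := Pop_newton_chain nu sJ t kn.
have := @derive_val _ _ _ _ _ _ _ d1; rewrite E (@derive_val _ _ _ _ _ _ _ d2).
by rewrite -E => /addrI.
Qed.

(** Expansion of [p] in the Newton basis, by removing the leading term. Through it bounds,
    continuity and integrability of the chain members pass to all differential polynomials of
    [J 0]. *)
Lemma chain_Pop_span n nu J k p : chain n nu J -> (k <= n)%N -> (size p <= k.+1)%N ->
  exists c : nat -> R, forall t, Pop p (J 0%N) t = \sum_(i < k.+1) c i * J i t.
Proof.
move=> cJ; elim: k p => [|k IH] p kn pk.
  exists (fun=> p`_0) => t; rewrite big_ord1.
  by rewrite (size1_polyC pk) -alg_polyC PopZ Pop1 alg_polyC coefC.
pose r := p - p`_k.+1 *: newton nu k.+1.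
have rk : (size r <= k.+1)%N.
  apply/leq_sizeP => j; rewrite leq_eqVlt => /orP[/eqP <-|kj].
    have := newton_monic nu k.+1; rewrite monicE lead_coefE size_newton /= => /eqP E.
    by rewrite coefB coefZ E mulr1 subrr.
  have E : (newton nu k.+1)`_j = 0 by rewrite nth_default// size_newton.
  by rewrite coefB coefZ (nth_default _ (leq_trans pk kj)) E mulr0 subr0.
have [c Hc] := IH r (ltnW kn) rk.
exists (fun i => if i == k.+1 then p`_k.+1 else c i) => t.
rewrite big_ord_recr /= eqxx (chain_Pop_newton t cJ kn) -PopZ.
have -> : p = r + p`_k.+1 *: newton nu k.+1 by rewrite /r subrK.
rewrite PopD Hc; congr (_ + _); last by rewrite /r subrK.
by apply: eq_bigr => i _; rewrite ltn_eqF.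
Qed.

Lemma chain_Pop_bounded n nu J k p (A : set R) : chain n nu J -> (k <= n)%N ->
  (size p <= k.+1)%N -> (forall i, (i <= k)%N -> exists M, forall t, A t -> `|J i t| <= M) ->
  exists M, forall t, A t -> `|Pop p (J 0%N) t| <= M.
Proof.
move=> cJ kn pk HJ; have [c Hc] := chain_Pop_span cJ kn pk.
have /choice[M HM] : forall i, exists M, (i <= k)%N -> forall t, A t -> `|J i t| <= M.
  move=> i; have [ik|] := leqP i k; last by exists 0.
  by have [M HM] := HJ i ik; exists M.
exists (\sum_(i < k.+1) `|c i| * M i) => t At; rewrite Hc.
apply: le_trans (ler_norm_sum _ _ _) _; apply: ler_sum => i _.
by rewrite normrM ler_wpM2l// HM// -ltnS.
Qed.

Lemma chain_shift n nu J (tau : R) : chain n nu J -> chain n nu (fun k t => J k (t - tau)).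
Proof.
move=> cJ k t kn.
have d := is_derive_fB (is_derive_id t (1 : R)) (is_derive_cst tau t 1).
apply: (is_derive_cast (@is_derive1_comp R (J k) _ t _ _ (cJ k (t - tau) kn) d)).
by rewrite subr0 mulr1.
Qed.

End DifferentialPolynomials.

(** * The bubbles *)

Section PowerNonlinearity.
Variable R : realType.
Implicit Types (q r a b x y M : R).

Definition fpow q x := `|x| `^ q * x.

Lemma fpow_ge0E q x : 0 < q -> 0 <= x -> fpow q x = x `^ (q + 1).
Proof.
move=> q0 x0; rewrite /fpow ger0_norm// mulrC.
have := @mulr_powRB1 R x (q + 1) x0; rewrite addrK; apply.
by rewrite addr_gt0.
Qed.

Lemma fpowN q x : fpow q (- x) = - fpow q x.
Proof. by rewrite /fpow normrN mulrN. Qed.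

(** Convexity of the power, from Young's inequality for [x ^ (r - 1)] and [y] with the exponents
    [r / (r - 1)] and [r]. *)
Lemma powR_tangent r x y : 1 < r -> 0 <= x -> 0 <= y ->
  x `^ r + r * x `^ (r - 1) * (y - x) <= y `^ r.
Proof.
move=> r1 x0 y0; have r0 : 0 < r by apply: lt_trans r1.
pose r' := r / (r - 1).
have r10 : 0 < r - 1 by rewrite subr_gt0.
have := @conjugate_powR R (x `^ (r - 1)) y r' r (powR_ge0 _ _) y0.
rewrite -powRrM.
have -> : (r - 1) * r' = r by rewrite /r'; field; rewrite gt_eqF.
move=> /(_ (divr_gt0 r0 r10) r0) H.
have {}H : x `^ (r - 1) * y <= x `^ r / r' + y `^ r / r.
  by apply: H; rewrite /r'; field; rewrite !gt_eqF.
have xr : x * x `^ (r - 1) = x `^ r by exact: mulr_powRB1.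
have := ler_wpM2l (ltW r0) H.
have -> : r * (x `^ r / r' + y `^ r / r) = (r - 1) * x `^ r + y `^ r.
  by rewrite /r'; field; rewrite !gt_eqF.
have -> : r * x `^ (r - 1) * (y - x) = r * (x `^ (r - 1) * y) - r * x `^ r.
  by rewrite -xr; ring.
lra.
Qed.

(** Once integrated, this replaces differentiation of the mass under the integral sign. *)
Lemma powR_norm_tangent q x y : 0 < q ->
  `|x| `^ (q + 2) + (q + 2) * (fpow q x * (y - x)) <= `|y| `^ (q + 2).
Proof.
move=> q0; have q1 : 1 < q + 2 by lra.
apply: le_trans (powR_tangent q1 (normr_ge0 x) (normr_ge0 y)).
rewrite lerD2l -mulrA ler_wpM2l//; first lra.
have -> : q + 2 - 1 = q + 1 by ring.
have <- : `|x| * `|x| `^ q = `|x| `^ (q + 1).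
  have := @mulr_powRB1 R `|x| (q + 1) (normr_ge0 _); rewrite addrK; apply; lra.
rewrite /fpow -!mulrA [leRHS]mulrCA ler_wpM2l ?powR_ge0//.
rewrite !mulrBr lerB//; first by rewrite -normrM ler_norm.
by rewrite -normrM ger0_norm// sqr_ge0.
Qed.

Lemma fpow_lt q a b : 0 < q -> a < b -> fpow q a < fpow q b.
Proof.
move=> q0; have H x y : 0 <= x -> x < y -> fpow q x < fpow q y.
  move=> x0 xy; have y0 : 0 <= y by apply: le_trans (ltW xy).
  by rewrite !fpow_ge0E//; apply: gt0_ltr_powR => //; rewrite ?addr_gt0// nnegrE.
have [a0|a0] := leP 0 a; first exact: H.
move=> ab; have [b0|b0] := leP b 0.
  by rewrite -ltrN2 -!fpowN; apply: H; rewrite ?oppr_ge0// ltrN2.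
apply: (@lt_le_trans _ _ 0); last by rewrite mulr_ge0 ?powR_ge0// ltW.
by rewrite /fpow nmulr_llt0// powR_gt0// normr_gt0 lt_eqF.
Qed.

(** The tangent inequality at the larger of two nonnegative numbers gives the constant; oddness
    covers two negative numbers, and for opposite signs each term is at most [M ^ q] times its
    argument. *)
Lemma fpow_lipschitz q a b M : 0 < q -> `|a| <= M -> `|b| <= M ->
  `|fpow q a - fpow q b| <= (q + 1) * M `^ q * `|a - b|.
Proof.
move=> q0; wlog ba : a b / b <= a.
  move=> W aM bM; have [|ab] := leP b a; first by move/W; apply.
  by rewrite distrC [`|a - b|]distrC; apply: W => //; exact: ltW.
have q1 : 0 <= q + 1 by lra.
have qM x : 0 <= x -> x <= M -> x `^ q <= M `^ q.
  by move=> x0 xM; apply: ge0_ler_powR; rewrite ?nnegrE ?(ltW q0)// (le_trans x0).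
have pos x y : 0 <= y -> y <= x -> x <= M ->
    fpow q x - fpow q y <= (q + 1) * M `^ q * (x - y).
  move=> y0 yx xM; have x0 : 0 <= x by apply: le_trans yx.
  rewrite !fpow_ge0E//; have q11 : 1 < q + 1 by lra.
  have := powR_tangent q11 x0 y0; rewrite addrK => H.
  have h2 : (q + 1) * x `^ q * (x - y) <= (q + 1) * M `^ q * (x - y).
    by rewrite ler_wpM2r ?subr_ge0// ler_wpM2l// qM.
  by have : (q + 1) * x `^ q * (y - x) = - ((q + 1) * x `^ q * (x - y)); [ring|lra].
rewrite ![`|_| <= M]ler_norml => /andP[aM1 aM] /andP[bM1 bM].
have fab : fpow q b <= fpow q a.
  by move: ba; rewrite le_eqVlt => /orP[/eqP->//|/(fpow_lt q0)/ltW].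
have -> : `|fpow q a - fpow q b| = fpow q a - fpow q b by rewrite ger0_norm// subr_ge0.
have -> : `|a - b| = a - b by rewrite ger0_norm// subr_ge0.
have [b0|b0] := leP 0 b; first exact: pos b0 ba aM.
have [a0|a0] := leP a 0.
  have := pos (- b) (- a); rewrite !fpowN !opprK [- b + a]addrC [- fpow _ _ + _]addrC.
  by apply; rewrite ?oppr_ge0 ?lerN2//; lra.
apply: (@le_trans _ _ (M `^ q * (a - b))); last first.
  by rewrite ler_wpM2r ?subr_ge0// ler_peMl ?powR_ge0//; lra.
rewrite mulrBr -mulrN -[leLHS]/(fpow q a - fpow q b) -fpowN /fpow normrN lerD//.
  by rewrite ler_wpM2r ?(ltW a0)// ger0_norm ?qM ?(ltW a0).
by rewrite ler_wpM2r ?oppr_ge0 ?(ltW b0)// ltr0_norm// qM; lra.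
Qed.

End PowerNonlinearity.

Section Bubble.
Variable R : realType.
Implicit Types (s t : R).

(* [bubble s t = (2 cosh t) ^ (- s)] *)
Definition bubble s t : R := expR (- s * ln (expR t + expR (- t))).
(** [2 sinh t (2 cosh t) ^ (- s - 1)]. *)
Definition bubble_sinh s t : R := (expR t - expR (- t)) * bubble (s + 1) t.

Lemma expRDN_gt0 t : 0 < expR t + expR (- t).
Proof. by rewrite addr_gt0 ?expR_gt0. Qed.

Lemma bubble_gt0 s t : 0 < bubble s t.
Proof. exact: expR_gt0. Qed.

Lemma bubbleS s t : (expR t + expR (- t)) * bubble (s + 1) t = bubble s t.
Proof.
rewrite /bubble -[X in X * _]lnK ?posrE ?expRDN_gt0// -expRD.
by congr expR; ring.
Qed.

Lemma is_derive_expRN t : is_derive t 1 (fun s => expR (- s)) (- expR (- t)).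
Proof. exact: is_derive_reflect. Qed.

Lemma is_derive_bubble s t : is_derive t 1 (bubble s) (- s * bubble_sinh s t).
Proof.
have d1 := is_derive_fD (is_derive_expR t) (is_derive_expRN t).
have d2 := @is_derive1_comp R (@ln R) _ t _ _ (is_derive1_ln (expRDN_gt0 t)) d1.
have d3 := @is_derive1_comp R expR _ t _ _ (is_derive_expR _) (is_derive_fZ (- s) d2).
apply: (is_derive_cast d3); rewrite /bubble_sinh -/(bubble s t) -bubbleS.
by field; rewrite gt_eqF// expRDN_gt0.
Qed.

(** Together with [is_derive_bubble] this says [(D ^ 2 - s ^ 2) bubble s = - 4 s (s + 1) bubble (s +
    2)], so the factors of the operator act one after the other. It rests on
    [(x - y) ^ 2 = (x + y) ^ 2 - 4 x y] with [x y = 1]. *)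
Lemma is_derive_bubble_sinh s t :
  is_derive t 1 (bubble_sinh s) (- s * bubble s t + 4 * (s + 1) * bubble (s + 2) t).
Proof.
have d1 := is_derive_fB (is_derive_expR t) (is_derive_expRN t).
apply: (is_derive_cast (is_derive_fM d1 (is_derive_bubble (s + 1) t))).
rewrite opprK bubbleS /bubble_sinh.
have E2 : s + 1 + 1 = s + 2 by ring.
rewrite E2 -(bubbleS s) -(bubbleS (s + 1)) E2.
have := expRxMexpNx_1 t; move: (expR t) (expR (- t)) (bubble _ _) => x y b xy.
have -> : (x - y) * (- (s + 1) * ((x - y) * b)) =
  - (s + 1) * ((x + y) ^+ 2 * b) + 4 * (s + 1) * (x * y) * b by ring.
by rewrite xy; ring.
Qed.

Fixpoint bubble_coef s (k : nat) : R :=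
  if k is k'.+1 then - (4 * (s + 2 * k'%:R) * (s + 2 * k'%:R + 1)) * bubble_coef s k' else 1.

(** The exponents come in opposite pairs, so that two successive steps make up one factor
    [D ^ 2 - (s + 2 i) ^ 2]. Only the product matters here, so the order may differ from that of
    [exponents]. *)
Definition bubble_nu s (k : nat) : R :=
  if odd k then - (s + 2 * (k./2)%:R) else s + 2 * (k./2)%:R.

Definition bubble_jet s (k : nat) t : R :=
  let mu := s + 2 * (k./2)%:R in
  if odd k then - mu * bubble_coef s k./2 * (bubble_sinh mu t + bubble mu t)
  else bubble_coef s k./2 * bubble mu t.

Lemma bubble_chain n s : chain n (bubble_nu s) (bubble_jet s).
Proof.
move=> k t _; rewrite /bubble_nu /bubble_jet /= uphalf_half.
have [ok|ek] := boolP (odd k); last first.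
  rewrite /= add0n.
  set mu := s + _.
  by apply: (is_derive_cast (is_derive_fZ _ (is_derive_bubble mu t))); ring.
rewrite /= add1n.
have -> : s + 2 * k./2.+1%:R = s + 2 * k./2%:R + 2 by rewrite -natr1; ring.
rewrite /=; set mu := s + _.
have d := is_derive_fD (is_derive_bubble_sinh mu t) (is_derive_bubble mu t).
by apply: (is_derive_cast (is_derive_fZ _ d)); ring.
Qed.

Lemma bubble_jet0 s : bubble_jet s 0 = bubble s.
Proof. by apply/funext => t; rewrite /bubble_jet /= mulr0 addr0 mul1r. Qed.

Lemma newton_bubble s m : newton (bubble_nu s) (2 * m) =
  \prod_(i < m) ('X^2 - ((s + 2 * i%:R) ^+ 2)%:P).
Proof.
elim: m => [|m IH]; first by rewrite muln0 /newton !big_ord0.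
rewrite mulnS addnC addn2 /newton !big_ord_recr /= -/(newton _ (2 * m)) IH.
rewrite -mulrA; congr (_ * _).
rewrite /bubble_nu oddM /= mul2n doubleK uphalf_double odd_double /= polyCN opprK.
by rewrite polyC_exp; ring.
Qed.

(** [4 (s + 2 k) (s + 2 k + 1)] is the product of [2 s + 2 i] over [i = 2 k] and [i = 2 k + 1]; at
    [s = lam] these become the factors of [Pprod]. *)
Lemma bubble_coefE s m :
  bubble_coef s m = (-1) ^+ m * \prod_(i < 2 * m) (2 * s + 2 * i%:R).
Proof.
elim: m => [|m IH]; first by rewrite muln0 big_ord0 mulr1.
rewrite mulnS addnC addn2 !big_ord_recr /= IH exprS -natr1 natrM.
by move: (\prod_(i < _) _) => P; ring.
Qed.

Lemma bubble_le_exp s t : 0 <= s -> bubble s t <= expR (- s * `|t|).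
Proof.
move=> s0; rewrite ler_expR ler_wnM2l ?oppr_le0//.
rewrite -(expRK `|t|) ler_ln ?posrE ?expR_gt0 ?expRDN_gt0//.
by case: (ger0P t) => _; rewrite ?lerDl ?lerDr ?expR_ge0.
Qed.

Lemma bubble_le1 s t : 0 <= s -> bubble s t <= 1.
Proof.
move=> s0; apply: le_trans (bubble_le_exp t s0) _.
by rewrite expR_le1 mulNr oppr_le0 mulr_ge0.
Qed.

Lemma bubble_sinh_le1 s t : 0 <= s -> `|bubble_sinh s t| <= 1.
Proof.
move=> s0; apply: le_trans (bubble_le1 t s0); rewrite -bubbleS /bubble_sinh normrM.
rewrite [`|bubble _ _|]ger0_norm ?(ltW (bubble_gt0 _ _))// ler_wpM2r ?(ltW (bubble_gt0 _ _))//.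
apply: le_trans (ler_normB _ _) _.
by rewrite !ger0_norm ?expR_ge0.
Qed.

Lemma bubble_jet_bounded s i : 0 <= s -> exists M, forall t, `|bubble_jet s i t| <= M.
Proof.
move=> s0; exists (`|bubble_coef s i./2| * (1 + (s + 2 * (i./2)%:R) * 2)) => t.
rewrite /bubble_jet; set mu := s + _; have mu0 : 0 <= mu by rewrite addr_ge0// mulr_ge0.
have b0 := ltW (bubble_gt0 mu t).
case: (odd i); rewrite !normrM.
  rewrite normrN (ger0_norm mu0) [leLHS]mulrAC mulrC ler_wpM2l//.
  apply: (@le_trans _ _ (mu * 2)); last by rewrite lerDr.
  rewrite ler_wpM2l//; apply: le_trans (ler_normD _ _) _.
  by rewrite (ger0_norm b0) -[2]/(1 + 1) lerD ?bubble_sinh_le1 ?bubble_le1.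
rewrite ler_wpM2l// (ger0_norm b0); apply: le_trans (bubble_le1 t mu0) _.
by rewrite lerDl mulr_ge0.
Qed.

Definition profile k s tau t := k * bubble s (t - tau).

Lemma profile_chain n k s tau :
  chain n (bubble_nu s) (fun i t => k * bubble_jet s i (t - tau)).
Proof. exact: chainZ (chain_shift tau (@bubble_chain n s)). Qed.

Lemma profile_jet0 k s tau : (fun t => k * bubble_jet s 0 (t - tau)) = profile k s tau.
Proof. by rewrite bubble_jet0. Qed.

Lemma smooth_profile n k s tau : smooth n (profile k s tau).
Proof. by rewrite -profile_jet0; apply: (chain_smooth (@profile_chain n k s tau)). Qed.

Lemma profile_equation k s tau m t :
  Pop (\prod_(i < m) ('X^2 - ((s + 2 * i%:R) ^+ 2)%:P)) (profile k s tau) t =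
  k * (bubble_coef s m * bubble (s + 2 * m%:R) (t - tau)).
Proof.
rewrite -newton_bubble -profile_jet0.
rewrite -(chain_Pop_newton t (@profile_chain (2 * m) k s tau) (leqnn _)) /bubble_jet.
by rewrite mul2n odd_double doubleK.
Qed.

Lemma Pop_profile_bounded k s tau (p : {poly R}) : 0 <= s ->
  exists M, forall t, `|Pop p (profile k s tau) t| <= M.
Proof.
move=> s0; rewrite -profile_jet0.
have [|M HM] := @chain_Pop_bounded R _ _ _ (size p) p setT
  (@profile_chain (size p) k s tau) (leqnn _) (leqnSn _).
  move=> i _; have [M HM] := bubble_jet_bounded i s0.
  by exists (`|k| * M) => t _; rewrite normrM ler_wpM2l.
by exists M => t; exact: HM.
Qed.

Lemma bubble_pow s (q t : R) : bubble s t `^ q = bubble (s * q) t.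
Proof. by rewrite /bubble -expRM; congr expR; ring. Qed.

End Bubble.

(** * Classification of the profiles *)

Section ProfileUniqueness.
Variable R : realType.
Implicit Types (m : nat) (lam q c d t : R) (u y phi psi : R -> R) (p : {poly R}).

Lemma vanishes_right_small u :
  (forall e, 0 < e -> exists T, forall t, T <= t -> `|u t| < e) -> vanishes_right u.
Proof.
move=> H a ua; have [|T HT] := H `|u a|; first by rewrite normr_gt0.
exists (Num.max T (a + 1)); last by apply: HT; rewrite le_max lexx.
by rewrite lt_max ltrDl ltr01 orbT.
Qed.

Lemma vanishes_left_small u :
  (forall e, 0 < e -> exists T, forall t, t <= T -> `|u t| < e) -> vanishes_left u.
Proof.
move=> H a ua; have [|T HT] := H `|u a|; first by rewrite normr_gt0.
exists (Num.min T (a - 1)); last by apply: HT; rewrite ge_min lexx.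
by rewrite gt_min ltrBlDr ltrDl ltr01 orbT.
Qed.

Lemma small_exp_right y (nu M e : R) : 0 < nu -> (forall t, 0 <= t -> `|y t| <= M) -> 0 < e ->
  exists T, forall t, T <= t -> `|expR (- nu * t) * y t| < e.
Proof.
move=> nu0 yM e0; exists (Num.max 0 (M / e / nu)) => t.
rewrite ge_max => /andP[t0]; rewrite ler_pdivrMr// ler_pdivrMr// => Mt.
rewrite normrM ger0_norm ?expR_ge0// mulNr expRN mulrC ltr_pdivrMr ?expR_gt0//.
apply: le_lt_trans (yM t t0) _; apply: le_lt_trans Mt _.
rewrite mulrC ltr_pM2l//; apply: lt_le_trans (expR_ge1Dx _).
by rewrite mulrC; lra.
Qed.

Lemma small_exp_left y (nu M e : R) : nu < 0 -> (forall t, t <= 0 -> `|y t| <= M) -> 0 < e ->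
  exists T, forall t, t <= T -> `|expR (- nu * t) * y t| < e.
Proof.
move=> nu0 yM e0.
have [|t t0|T HT] := @small_exp_right (fun t => y (- t)) (- nu) M e _ _ e0.
- by rewrite oppr_gt0.
- by apply: yM; rewrite oppr_le0.
exists (- T) => t tT; have := HT (- t); rewrite opprK; rewrite mulrN -mulNr opprK.
by rewrite lerNr => /(_ tT); rewrite mulNr.
Qed.

Definition symbol m lam : {poly R} := \prod_(i < m) ('X^2 - ((lam + 2 * i%:R) ^+ 2)%:P).

(** The order is essential: derivatives of order below [m] meet positive exponents, the higher ones
    negative exponents. *)
Definition exponents m lam (k : nat) : R :=
  if (k < m)%N then lam + 2 * k%:R else - (lam + 2 * (k - m)%:R).

Lemma newton_exponents m lam : newton (exponents m lam) (2 * m) = symbol m lam.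
Proof.
rewrite /newton mul2n -addnn big_split_ord /= -big_split /=; apply: eq_bigr => i _.
rewrite /exponents ltn_ord ltnNge leq_addr /= addKn polyCN opprK polyC_exp; ring.
Qed.

Lemma exponents_pos m lam k : 0 < lam -> (k < m)%N -> lam <= exponents m lam k.
Proof. by move=> lam0 km; rewrite /exponents km lerDl mulr_ge0. Qed.

Lemma exponents_neg m lam k : 0 < lam -> (m <= k)%N -> exponents m lam k <= - lam.
Proof. by move=> lam0 mk; rewrite /exponents ltnNge mk /= lerN2 lerDl mulr_ge0. Qed.

(** The two ends differ: derivatives of order below [2 m] are controlled at -oo, by nonsingularity
    at the origin, but only those below [m] at +oo, by the energy. *)
Definition admissible m phi :=
  [/\ smooth (2 * m) phi,
      forall p, (size p <= 2 * m)%N -> exists M, forall t, t <= 0 -> `|Pop p phi t| <= M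
    & forall p, (size p <= m)%N -> exists M, forall t, 0 <= t -> `|Pop p phi t| <= M].

Definition exp_decay phi := exists M d, [/\ 0 <= M, 0 < d & forall t, `|phi t| <= M * expR (- d * `|t|)].

Lemma exp_decayW phi psi : exp_decay phi -> exp_decay psi -> exists M d,
  [/\ 0 <= M, 0 < d, forall t, `|phi t| <= M * expR (- d * `|t|) &
      forall t, `|psi t| <= M * expR (- d * `|t|)].
Proof.
move=> [M [d [M0 d0 H]]] [M' [d' [M0' d0' H']]].
exists (Num.max M M'), (Num.min d d'); split.
- by rewrite le_max M0.
- by rewrite lt_min d0.
- move=> t; apply: le_trans (H t) _; rewrite ler_pM ?expR_ge0// ?le_max ?lexx//.
  by rewrite ler_expR ler_wpM2r// lerN2 ge_min lexx.
- move=> t; apply: le_trans (H' t) _; rewrite ler_pM ?expR_ge0// ?le_max ?lexx ?orbT//.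
  by rewrite ler_expR ler_wpM2r// lerN2 ge_min lexx orbT.
Qed.

Lemma expR_pow_le (M d q t : R) : 0 <= M -> 0 < q ->
  (M * expR (- d * `|t|)) `^ q = M `^ q * expR (- (d * q) * `|t|).
Proof.
move=> M0 q0; rewrite powRM ?expR_ge0// -expRM; congr (_ * expR _); ring.
Qed.

Lemma equal_profiles m lam q c phi psi : (0 < m)%N -> 0 < lam -> 0 < q ->
  admissible m phi -> admissible m psi -> exp_decay phi -> exp_decay psi ->
  (forall t, (-1) ^+ m * Pop (symbol m lam) phi t = c * fpow q (phi t)) ->
  (forall t, (-1) ^+ m * Pop (symbol m lam) psi t = c * fpow q (psi t)) ->
  (forall e, 0 < e -> exists T, forall t, t <= T ->
     `|expR (- lam * t) * (phi t - psi t)| < e) ->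
  forall t, phi t = psi t.
Proof.
move=> m0 lam0 q0 [sphi Lphi Rphi] [spsi Lpsi Rpsi] Dphi Dpsi Ephi Epsi L0 t.
pose nu := exponents m lam.
pose Y k t := Pop (newton nu k) phi t - Pop (newton nu k) psi t.
have cY : chain (2 * m) nu Y.
  exact: chainB (Pop_newton_chain nu sphi) (Pop_newton_chain nu spsi).
have Y0 s : Y 0%N s = phi s - psi s by rewrite /Y /newton !big_ord0 !Pop1.
have Yn s : (-1) ^+ m * Y (2 * m)%N s = c * (fpow q (phi s) - fpow q (psi s)).
  by rewrite /Y newton_exponents mulrBr Ephi Epsi mulrBr.
have nYn s : `|Y (2 * m)%N s| = `|c| * `|fpow q (phi s) - fpow q (psi s)|.
  by rewrite -normrM -Yn normrM normrX normrN1 expr1n mul1r.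
have [M [d [M0 d0 HM HM']]] := exp_decayW Dphi Dpsi.
pose C := `|c| * ((q + 1) * M `^ q).
have q1 : 0 <= q + 1 by rewrite addr_ge0// ltW.
have C0 : 0 <= C by rewrite !mulr_ge0 ?powR_ge0.
have YC s : `|Y (2 * m)%N s| <= C * expR (- (d * q) * `|s|) * `|Y 0%N s|.
  rewrite nYn Y0 /C -!mulrA ler_wpM2l//.
  apply: le_trans (fpow_lipschitz q0 (HM s) (HM' s)) _.
  by rewrite expR_pow_le// !mulrA.
have eM s : expR (- d * `|s|) <= 1 by rewrite expR_le1 mulNr oppr_le0 mulr_ge0// ltW.
have pM s : `|phi s| <= M by apply: le_trans (HM s) _; rewrite ler_piMr.
have pM' s : `|psi s| <= M by apply: le_trans (HM' s) _; rewrite ler_piMr.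
suff : Y 0%N t = 0 by rewrite Y0 => /eqP; rewrite subr_eq0 => /eqP.
have m2 : (0 < 2 * m)%N by rewrite muln_gt0.
apply: (@chain_eq0 R (2 * m) nu Y C (d * q) (M + M)) => //.
- exact: mulr_gt0.
- move=> s; apply: le_trans (YC s) _; rewrite ler_wpM2r// ler_piMr//.
  by rewrite expR_le1 mulNr oppr_le0 mulr_ge0// mulr_ge0// ltW.
- move=> s; rewrite Y0; apply: le_trans (ler_normB _ _) _.
  exact: lerD.
- have mono a b : 0 < (fpow q a - fpow q b) * (a - b) \/ a = b.
    have [ab|ab|->] := ltgtP a b; [left|left|by right].
      by rewrite nmulr_rgt0 ?subr_lt0// fpow_lt.
    by rewrite mulr_gt0 ?subr_gt0// fpow_lt.
  move=> a b Yab.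
  (* In a product of two values of [Y (2 * m)] the factors [(-1) ^ m] and [c] are squared, so the
     monotonicity of [fpow] alone decides the sign. *)
  have : (c * (fpow q (phi a) - fpow q (psi a))) * (c * (fpow q (phi b) - fpow q (psi b))) < 0.
    rewrite -!Yn mulrACA -exprD addnn -mul2n exprM sqrrN expr1n expr1n mul1r.
    exact: Yab.
  rewrite mulrACA -expr2 => H; rewrite !Y0.
  have {}H : (fpow q (phi a) - fpow q (psi a)) * (fpow q (phi b) - fpow q (psi b)) < 0.
    rewrite ltNge; apply: contraL H => H; rewrite -leNgt mulr_ge0// sqr_ge0//.
  have [Ha|Ea] := mono (phi a) (psi a); last by move: H; rewrite Ea subrr mul0r ltxx.
  have [Hb|Eb] := mono (phi b) (psi b); last by move: H; rewrite Eb subrr mulr0 ltxx.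
  by apply: (mulr_lt0_trans Ha); rewrite mulrC; apply: (mulr_lt0_trans Hb); rewrite mulrC.
(* Here the matching of the limits at -oo enters, since [nu 0 = lam]. *)
- apply: vanishes_left_small => e e0; have [T HT] := L0 e e0.
  exists T => s sT; rewrite Y0 /nu /exponents m0 mulr0 addr0; exact: HT.
- apply: vanishes_right_small => e e0.
  apply: (@small_exp_right _ _ (M + M)) => //.
    exact: lt_le_trans lam0 (exponents_pos lam0 m0).
  move=> s _; rewrite Y0; apply: le_trans (ler_normB _ _) _.
  exact: lerD.
- move=> k /andP[k0 kn]; have [km|mk] := ltnP k m; [right|left].
    have sz : (size (newton nu k) <= m)%N by rewrite size_newton.
    have [M1 H1] := Rphi _ sz; have [M2 H2] := Rpsi _ sz.
    apply: vanishes_right_small => e e0.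
    apply: (@small_exp_right _ _ (M1 + M2)) => //.
      exact: lt_le_trans lam0 (exponents_pos lam0 km).
    by move=> s s0; apply: le_trans (ler_normB _ _) _; rewrite lerD ?H1 ?H2.
  have sz : (size (newton nu k) <= 2 * m)%N by rewrite size_newton.
  have [M1 H1] := Lphi _ sz; have [M2 H2] := Lpsi _ sz.
  apply: vanishes_left_small => e e0.
  apply: (@small_exp_left _ _ (M1 + M2)) => //.
    by apply: le_lt_trans (exponents_neg lam0 mk) _; rewrite oppr_lt0.
  by move=> s s0; apply: le_trans (ler_normB _ _) _; rewrite lerD ?H1 ?H2.
Qed.

(** At -oo the decay is assumed. At +oo [phi] tends to 0, so the nonlinearity is eventually a small
    multiple of [phi], and the linear decay lemma applies with half the smallest exponent. *)
Lemma exp_decay_solution m lam q c phi : (0 < m)%N -> 0 < lam -> 0 < q ->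
  admissible m phi ->
  (forall t, (-1) ^+ m * Pop (symbol m lam) phi t = c * fpow q (phi t)) ->
  (exists M, forall t, t <= 0 -> `|phi t| <= M * expR (lam * t)) ->
  (forall e, 0 < e -> exists T, forall t, T <= t -> `|phi t| <= e) ->
  exp_decay phi.
Proof.
move=> m0 lam0 q0 [sphi Lphi Rphi] Ephi [M1 H1] R0.
pose nu := exponents m lam; pose Y k t := Pop (newton nu k) phi t.
have cY : chain (2 * m) nu Y := Pop_newton_chain nu sphi.
have Y0 s : Y 0%N s = phi s by rewrite /Y /newton big_ord0 Pop1.
pose d := lam / 2; have d0 : 0 < d by rewrite divr_gt0.
(* Chosen so that [(|c| + 1) e ^ q = d ^ (2 m) / 2], the smallness that [chain_exponential_decay]
   requires. *)
pose e := (d ^+ (2 * m) / 2 / (`|c| + 1)) `^ q^-1.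
have c1 : 0 < `|c| + 1 by rewrite ltr_wpDl.
have e0 : 0 < e by rewrite powR_gt0// !divr_gt0// exprn_gt0.
have eq : e `^ q = d ^+ (2 * m) / 2 / (`|c| + 1).
  rewrite -powRrM mulVf ?gt_eqF// powRr1// !divr_ge0// ?(ltW c1)// exprn_ge0// ltW//.
have [T HT] := R0 e e0.
have [M HM] := Rphi 1 (leq_trans (eq_leq (size_poly1 _)) m0).
have M0 : 0 <= M by apply: le_trans (HM 0 (lexx _)).
pose T1 := Num.max T 0.
have T1t t : T1 <= t -> 0 <= t by rewrite ge_max => /andP[].
have TT1 t : T1 <= t -> T <= t by rewrite ge_max => /andP[].
have [C HC] : exists C, forall t, T1 <= t -> `|Y 0%N t| <= C * expR (- d * t).
  apply: (@chain_exponential_decay R (2 * m) nu Y d T1 e cY d0).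
  - move=> i _; have [im|mi] := ltnP i m; [right|left].
      split; first by have := exponents_pos lam0 im; rewrite /d /nu; lra.
      have [M' HM'] := Rphi (newton nu i) (leq_trans (eq_leq (size_newton _ _)) im).
      by exists M' => t Tt; apply: HM'; exact: T1t.
    by have := exponents_neg lam0 mi; rewrite /d /nu; lra.
  - by move=> t Tt; rewrite Y0 HT// TT1.
  - move=> t Tt; rewrite Y0 /Y newton_exponents.
    have -> : `|Pop (symbol m lam) phi t| = `|c * fpow q (phi t)|.
      by rewrite -Ephi normrM normrX normrN1 expr1n mul1r.
    rewrite /fpow !normrM mulrA ler_wpM2r// (ger0_norm (powR_ge0 _ _)).
    apply: (@le_trans _ _ ((`|c| + 1) * e `^ q)); last first.
      by rewrite eq mulrC divfK// gt_eqF.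
    apply: ler_pM; rewrite ?powR_ge0// ?lerDl//.
    by apply: ge0_ler_powR; rewrite ?nnegrE ?(ltW q0)// ?(ltW e0)// HT// TT1.
(* One term for each of the ranges [t <= 0], [t >= T1] and [0 < t < T1]. *)
exists (`|M1| + `|C| + M * expR (d * T1)), d; split=> //.
  by rewrite !addr_ge0// mulr_ge0// expR_ge0.
move=> t; have [t0|t0] := leP t 0.
  rewrite (ler0_norm t0) mulrNN; apply: le_trans (H1 t t0) _.
  apply: (@le_trans _ _ (`|M1| * expR (d * t))).
    apply: ler_pM; rewrite ?expR_ge0 ?ler_norm//.
      by have := H1 0 (lexx _); rewrite mulr0 expR0 mulr1; exact: le_trans.
    by rewrite ler_expR ler_wnM2r//; rewrite /d; lra.
  rewrite ler_wpM2r ?expR_ge0// -addrA lerDl addr_ge0// mulr_ge0// expR_ge0.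
rewrite (gtr0_norm t0); have [Tt|tT] := leP T1 t.
  rewrite -Y0; apply: le_trans (HC t Tt) _; rewrite ler_wpM2r ?expR_ge0//.
  have h := ler_norm C; have h1 := normr_ge0 M1.
  have : 0 <= M * expR (d * T1) by rewrite mulr_ge0// expR_ge0.
  by move: h h1; move: `|C| `|M1| => x y; lra.
rewrite -(Pop1 phi t); apply: le_trans (HM t (ltW t0)) _.
apply: (@le_trans _ _ (M * expR (d * T1) * expR (- d * t))).
  rewrite -mulrA -expRD ler_peMr//.
  have -> : d * T1 + - d * t = d * (T1 - t) by ring.
  by rewrite -[leLHS]expR0 ler_expR mulr_ge0 ?(ltW d0)// subr_ge0 ltW.
by rewrite ler_wpM2r ?expR_ge0// lerDr addr_ge0.
Qed.

Lemma bubbleM s s' t : bubble s t * bubble s' t = bubble (s + s') t :> R.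
Proof. by rewrite /bubble -expRD; congr expR; ring. Qed.

Lemma admissible_profile m k lam tau : 0 <= lam -> admissible m (profile k lam tau).
Proof.
move=> lam0; split; first exact: smooth_profile.
  by move=> p _; have [M HM] := Pop_profile_bounded k tau p lam0; exists M => t _.
by move=> p _; have [M HM] := Pop_profile_bounded k tau p lam0; exists M => t _.
Qed.

Lemma exp_decay_profile k lam tau : 0 < lam -> exp_decay (profile k lam tau).
Proof.
move=> lam0; exists (`|k| * expR (lam * `|tau|)), lam; split=> //.
move=> t; rewrite /profile normrM -mulrA ler_wpM2l// -expRD.
rewrite (ger0_norm (ltW (bubble_gt0 _ _))).
apply: le_trans (bubble_le_exp _ (ltW lam0)) _; rewrite ler_expR.
have : `|t| <= `|t - tau| + `|tau| by rewrite -{1}(subrK tau t) ler_normD.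
by move/(ler_wpM2l (ltW lam0)); rewrite mulrDr; lra.
Qed.

Lemma profile_solution m k lam q c tau t : 0 < lam -> lam * q = 2 * m%:R ->
  k = 0 \/ c * `|k| `^ q = \prod_(i < 2 * m) (2 * lam + 2 * i%:R) ->
  (-1) ^+ m * Pop (symbol m lam) (profile k lam tau) t = c * fpow q (profile k lam tau t).
Proof.
move=> lam0 lamq; rewrite profile_equation bubble_coefE.
case=> [->|E]; first by rewrite /profile /fpow !mul0r !mulr0.
(* Since [lam * (q + 1) = lam + 2 m], the nonlinearity raises the exponent of the bubble exactly as
   the operator does. *)
set b := t - tau; have -> : fpow q (profile k lam tau t) =
    `|k| `^ q * k * bubble (lam + 2 * m%:R) b.
  rewrite /fpow /profile -/b normrM (ger0_norm (ltW (bubble_gt0 _ _))).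
  rewrite powRM ?(ltW (bubble_gt0 _ _))// bubble_pow lamq -bubbleM; ring.
rewrite !mulrA E; have -> : (-1) ^+ m * k * (-1) ^+ m = ((-1) ^+ m * (-1) ^+ m) * k :> R by ring.
by rewrite -exprD addnn -mul2n exprM sqrrN expr1n expr1n mul1r [k * _]mulrC.
Qed.

Lemma continuous_exp_limit (h : R -> R) (a b e : R) : {for 0, continuous h} -> 0 < a -> 0 < e ->
  exists T, forall t, t <= T -> `|h (expR (a * t + b)) - h 0| < e.
Proof.
move=> ch a0 e0; have /cvgr_distC_lt/(_ e e0) := ch.
rewrite -nbhs_nearE => /nbhs_ballP[d /= d0 H].
exists ((ln d - b) / a - 1) => t tT; apply: H; rewrite /ball /= sub0r normrN.
rewrite ger0_norm ?expR_ge0// -[ltRHS]lnK ?posrE// ltr_expR.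
rewrite -ltrBrDr mulrC -ltr_pdivlMr//; apply: le_lt_trans tT _.
by rewrite ltrBlDr ltrDl.
Qed.

Lemma profile_left_limit k lam tau e : 0 < e ->
  exists T, forall t, t <= T ->
    `|expR (- lam * t) * profile k lam tau t - k * expR (- lam * tau)| < e.
Proof.
(* [e ^ (- lam t)] times the profile is [h] at [x = e ^ (2 t - tau)], and [h] is continuous at 0. *)
move=> e0; pose h x := k * expR (- lam * ln (x + expR tau)).
have ch : {for 0, continuous h}.
  have d1 := is_derive_fD (is_derive_id 0 (1 : R)) (is_derive_cst (expR tau) (0 : R) 1).
  have p0 : 0 < 0 + expR tau :> R by rewrite add0r expR_gt0.
  have d2 := @is_derive1_comp R (@ln R) _ 0 _ _ (is_derive1_ln p0) d1.
  have d3 := @is_derive1_comp R expR _ 0 _ _ (is_derive_expR _) (is_derive_fZ (- lam) d2).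
  exact: is_derive_continuous (is_derive_fZ k d3).
have [|T HT] := @continuous_exp_limit h 2 (- tau) e ch _ e0; first by [].
exists T => t /HT; rewrite /h add0r expRK; congr (`|_ - _| < _).
rewrite /profile mulrCA; congr (_ * _); rewrite /bubble -expRD; congr expR.
rewrite -mulrDr; congr (_ * _); rewrite -[X in _ = X + _]expRK -lnM ?posrE ?expR_gt0 ?expRDN_gt0//.
by rewrite mulrDr -!expRD; congr (ln (expR _ + expR _)); ring.
Qed.

(** A nonzero value is an alternating list of one point; the chain would carry it to [Y (2 * m)],
    which vanishes. This excludes the constant [c = 0]. *)
Lemma linear_solution_trivial m lam phi : (0 < m)%N -> 0 < lam -> admissible m phi ->
  (forall t, Pop (symbol m lam) phi t = 0) -> forall t, phi t = 0.
Proof.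
move=> m0 lam0 [sphi Lphi Rphi] E t1; apply/eqP; apply/negP => /negP nz.
pose nu := exponents m lam; pose Y k t := Pop (newton nu k) phi t.
have cY : chain (2 * m) nu Y := Pop_newton_chain nu sphi.
have Y0 s : Y 0%N s = phi s by rewrite /Y /newton big_ord0 Pop1.
have [|//||a [s [_ /andP[]]]] := @chain_alternates R (2 * m) nu Y 0 t1 [::] cY.
- by [].
- move=> k /andP[_ kn]; have [km|mk] := ltnP k m; [right|left].
    have [M HM] := Rphi (newton nu k) (leq_trans (eq_leq (size_newton _ _)) km).
    apply: vanishes_right_small => e e0; apply: small_exp_right HM e0.
    exact: lt_le_trans lam0 (exponents_pos lam0 km).
  have [M HM] := Lphi (newton nu k) (leq_trans (eq_leq (size_newton _ _)) kn).
  apply: vanishes_left_small => e e0; apply: small_exp_left HM e0.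
  by apply: le_lt_trans (exponents_neg lam0 mk) _; rewrite oppr_lt0.
- by rewrite /= Y0 nz.
- by rewrite /Y newton_exponents E eqxx.
Qed.

Theorem profile_classification m lam q c z0 phi : (0 < m)%N -> 0 < lam -> 0 < q ->
  lam * q = 2 * m%:R -> 0 <= c -> admissible m phi ->
  (forall t, (-1) ^+ m * Pop (symbol m lam) phi t = c * fpow q (phi t)) ->
  (exists M, forall t, t <= 0 -> `|phi t| <= M * expR (lam * t)) ->
  (forall e, 0 < e -> exists T, forall t, t <= T -> `|expR (- lam * t) * phi t - z0| < e) ->
  (forall e, 0 < e -> exists T, forall t, T <= t -> `|phi t| <= e) ->
  (exists t, phi t != 0) ->
  exists k tau, [/\ k != 0, forall t, phi t = profile k lam tau t &
    c * `|k| `^ q = \prod_(i < 2 * m) (2 * lam + 2 * i%:R)].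
Proof.
move=> m0 lam0 q0 lamq c0 aphi Ephi Lphi z0P R0 [t1 nz].
pose P := \prod_(i < 2 * m) (2 * lam + 2 * i%:R) : R.
have P0 : 0 < P by apply: prodr_gt0 => i _; rewrite ltr_pwDl ?mulr_gt0// mulr_ge0.
have cpos : 0 < c.
  rewrite lt_def c0 andbT; apply/eqP => cz; move: nz; apply/negP; rewrite negbK.
  apply/eqP; apply: (linear_solution_trivial m0 lam0 aphi) => t; have := Ephi t.
  by rewrite cz mul0r => /eqP; rewrite mulf_eq0 signr_eq0 => /eqP.
have dphi := exp_decay_solution m0 lam0 q0 aphi Ephi Lphi R0.
(* For [z0 != 0] the equation fixes [|k|], the sign of [k] is that of [z0], and the limit then fixes
   [tau]; for [z0 = 0] the comparison function is 0. *)
have [k [tau [ktau kP]]] : exists k tau, k * expR (- lam * tau) = z0 /\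
    (k = 0 \/ c * `|k| `^ q = P).
  have [->|z00] := eqVneq z0 0; first by exists 0, 0; split; [rewrite mul0r|left].
  pose k0 := (P / c) `^ q^-1; have k00 : 0 < k0 by rewrite powR_gt0// divr_gt0.
  have k0P : c * k0 `^ q = P.
    by rewrite -powRrM mulVf ?gt_eqF// powRr1 ?divr_ge0 ?(ltW P0)// mulrC divfK ?gt_eqF.
  have n0 : 0 < `|z0| by rewrite normr_gt0.
  exists (Num.sg z0 * k0), (- ln (`|z0| / k0) / lam); split; last first.
    by right; rewrite normrM normr_sg z00 mul1r gtr0_norm.
  have -> : - lam * (- ln (`|z0| / k0) / lam) = ln (`|z0| / k0) by field; rewrite gt_eqF.
  rewrite lnK ?posrE ?divr_gt0// -mulrA [k0 * _]mulrC divfK ?gt_eqF//.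
  by rewrite mulr_sg_norm.
have E : forall t, phi t = profile k lam tau t.
  apply: (equal_profiles m0 lam0 q0 aphi (admissible_profile m k tau (ltW lam0)) dphi
    (exp_decay_profile k tau lam0) Ephi).
    by move=> t; exact: profile_solution.
  move=> e e0; have e2 : 0 < e / 2 by rewrite divr_gt0.
  have [T1 H1] := z0P _ e2; have [T2 H2] := profile_left_limit k lam tau e2.
  exists (Num.min T1 T2) => t; rewrite le_min => /andP[/H1 h1 /H2].
  rewrite ktau => h2; rewrite mulrBr.
  have -> : expR (- lam * t) * phi t - expR (- lam * t) * profile k lam tau t =
    (expR (- lam * t) * phi t - z0) - (expR (- lam * t) * profile k lam tau t - z0) by ring.
  by apply: le_lt_trans (ler_normB _ _) _; rewrite [e]splitr ltrD.
have k0 : k != 0 by apply: contraNneq nz => k0; rewrite E k0 /profile mul0r.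
by exists k, tau; split=> //; case: kP => // k00; rewrite k00 eqxx in k0.
Qed.

End ProfileUniqueness.

(** * Change of variables and the gamma function *)

Section Substitution.
Variable R : realType.
Implicit Types (F f G : R -> R) (A : set R).
Local Notation mu := (@lebesgue_measure R).

Lemma continuous_at_within G (a b : R) :
  (forall y, a <= y -> y <= b -> {for y, continuous G}) -> {within `[a, b], continuous G}.
Proof.
move=> cG; apply: continuous_in_subspaceT => y.
by rewrite inE /= in_itv /= => /andP[ay yb]; exact: cG.
Qed.

(** Substitution on [[- n, n]], then monotone convergence along both exhausting families of
    intervals; the intermediate value theorem identifies [A] with the range of [F]. *)
Lemma integral_substitution_line F f G A :
  (forall t : R, is_derive t 1 F (f t)) -> continuous f -> (forall t, 0 < f t) ->
  (forall t, A (F t)) -> (forall y, A y -> exists s t, F s <= y /\ y <= F t) ->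
  (forall y, A y -> {for y, continuous G}) -> (forall y, A y -> 0 <= G y) ->
  (\int[mu]_(y in A) (G y)%:E = \int[mu]_t (G (F t) * f t)%:E)%E.
Proof.
move=> dF cf f0 AF FA cG G0.
have incF s t : s <= t -> F s <= F t.
  by move=> st; apply: (ge0_derive_le dF) => // x _ _; exact: ltW.
have sincF s t : s < t -> F s < F t.
  by move=> st; apply: (gt0_derive_lt dF).
have dFE : F^`() = f by apply/funext => t; rewrite derive1E; exact: derive_val.
pose I (n : nat) : set R := [set` `[- n%:R, n%:R]%R].
pose J (n : nat) : set R := [set` `[F (- n%:R), F n%:R]%R].
have IT : \bigcup_n I n = setT.
  apply/seteqP; split=> // x _; exists (Num.bound `|x|) => //=.
  by rewrite /I /= in_itv /= -ler_norml ltW// archi_boundP.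
have btw s t y : F s <= y -> y <= F t -> exists2 x, F x = y & s <= x <= t \/ s = t.
  move=> sy yt; have [st|ts] := leP s t; last first.
    have st : F t = F s by apply/le_anti; rewrite (incF _ _ (ltW ts)) (le_trans sy yt).
    by have := sincF _ _ ts; rewrite st ltxx.
  have [||x] := @IVT R F s t y st.
  - by apply: continuous_at_within => x _ _; exact: is_derive_continuous (dF x).
  - by rewrite min_l ?max_r ?incF// sy yt.
  by rewrite in_itv /= => sxt Fx; exists x => //; left.
have AE : A = range F.
  apply/seteqP; split=> [y /FA[s [t [sy yt]]]|y [x _ <-]]; last exact: AF.
  by have [x <- _] := btw s t y sy yt; exists x.
have JA : \bigcup_n J n = A.
  apply/seteqP; split=> [y [n _]|y].
    rewrite /J /= in_itv /= => /andP[y1 y2].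
    by have [x <- _] := btw _ _ _ y1 y2; exact: AF.
  rewrite AE => -[x _ <-]; exists (Num.bound `|x|) => //=.
  have : `|x| <= (Num.bound `|x|)%:R by rewrite ltW// archi_boundP.
  by rewrite ler_norml /J /= in_itv /= => /andP[h1 h2]; rewrite !incF.
have nat_le (n k : nat) : (n <= k)%N -> - k%:R <= - n%:R :> R /\ n%:R <= k%:R :> R.
  by move=> nk; rewrite lerN2 ler_nat.
have ndI : nondecreasing_seq I.
  move=> n k nk; rewrite subsetEset /I => x /=; rewrite !in_itv /= => /andP[x1 x2].
  by have [h1 h2] := nat_le n k nk; rewrite (le_trans h1)// (le_trans x2).
have ndJ : nondecreasing_seq J.
  move=> n k nk; rewrite subsetEset /J => x /=; rewrite !in_itv /= => /andP[x1 x2].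
  by have [h1 h2] := nat_le n k nk; rewrite (le_trans (incF _ _ h1))// (le_trans x2)// incF.
have cGJ n : {within J n, continuous G}.
  apply: continuous_at_within => y y1 y2; apply: cG.
  by have [x <- _] := btw _ _ _ y1 y2; exact: AF.
have cH : continuous (fun t => G (F t) * f t).
  move=> t; apply: continuousM; last exact: cf.
  apply: continuous_comp; first exact: is_derive_continuous (dF t).
  exact: cG (AF t).
have E n : (\int[mu]_(y in J n) (G y)%:E = \int[mu]_(t in I n) (G (F t) * f t)%:E)%E.
  transitivity (\int[mu]_(t in I n) (((G \o F) * (derive1 F)) t)%:E)%E; last by rewrite dFE.
  apply: integration_by_substitution_increasing; rewrite ?dFE.
  - by rewrite (@le_trans _ _ 0)// oppr_le0.
  - by move=> s t _ _; exact: sincF.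
  - by move=> t _; exact: cf.
  - by apply/cvg_ex; exists (f (- n%:R)); apply: cvg_at_right_filter; exact: cf.
  - by apply/cvg_ex; exists (f n%:R); apply: cvg_at_left_filter; exact: cf.
  - split; first by move=> t _; case: (dF t).
      by apply: cvg_at_right_filter; exact: is_derive_continuous (dF _).
    by apply: cvg_at_left_filter; exact: is_derive_continuous (dF _).
  - exact: cGJ.
have H1 : (\int[mu]_(y in J n) (G y)%:E @[n --> \oo] --> \int[mu]_(y in A) (G y)%:E)%E.
  rewrite -JA; apply: ge0_nondecreasing_set_cvg_integral => //.
  - by move=> n; exact: measurable_itv.
  - move=> n; apply/measurable_EFinP; apply: subspace_continuous_measurable_fun => //.
    exact: measurable_itv.
  - by move=> n y Jy; rewrite lee_fin; apply: G0; rewrite -JA; exists n.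
have H2 : (\int[mu]_(t in I n) (G (F t) * f t)%:E @[n --> \oo] -->
    \int[mu]_t (G (F t) * f t)%:E)%E.
  rewrite -IT; apply: ge0_nondecreasing_set_cvg_integral => //.
  - by move=> n; exact: measurable_itv.
  - move=> n; apply/measurable_EFinP; apply: subspace_continuous_measurable_fun => //.
      exact: measurable_itv.
    exact: continuous_subspaceT.
  - by move=> n y Jy; rewrite lee_fin mulr_ge0 ?G0 ?(ltW (f0 _)).
move: H1; under eq_fun do rewrite E.
by move=> H1; apply: cvg_unique H1 H2; exact: ereal_hausdorff.
Qed.

Lemma integral_exp G : (forall t, {for expR t, continuous G}) ->
  (forall t, 0 <= G (expR t)) ->
  (\int[mu]_(r in `]0%R, +oo[) (G r)%:E = \int[mu]_t (G (expR t) * expR t)%:E)%E.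
Proof.
move=> cG G0; have pos (y : R) : `]0%R, +oo[%classic y -> 0 < y.
  by rewrite /= in_itv /= andbT.
apply: (@integral_substitution_line expR expR G).
- exact: continuous_expR.
- by move=> t; exact: expR_gt0.
- by move=> t /=; rewrite in_itv /= expR_gt0.
- by move=> y /pos y0; exists (ln y), (ln y); rewrite lnK.
- by move=> y /pos y0; rewrite -(lnK y0); exact: cG.
- by move=> y /pos y0; rewrite -(lnK y0); exact: G0.
Qed.

End Substitution.

(** * Gamma and beta integrals over the line *)

Section GammaIntegrals.
Variable R : realType.
Implicit Types (x d M a b s t u : R) (G : R -> R).
Local Notation mu := (@lebesgue_measure R).

Lemma integral_affine G a b : 0 < a -> continuous G -> (forall t, 0 <= G t) ->
  (\int[mu]_t (G t)%:E = \int[mu]_t (G (a * t + b) * a)%:E)%E.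
Proof.
move=> a0 cG G0; apply: (@integral_substitution_line R (fun t => a * t + b) (fun=> a) G).
- move=> t; have d := is_derive_fD (is_deriveZ a (is_derive_id t (1 : R))) (is_derive_cst b t 1).
  by apply: (is_derive_cast d); rewrite /GRing.scale /= mulr1 addr0.
- by move=> t; exact: cst_continuous.
- by [].
- by [].
- by move=> y _; exists ((y - b) / a), ((y - b) / a); rewrite mulrC divfK ?gt_eqF// subrK.
- by move=> y _; exact: cG.
- by [].
Qed.

(** The integrand of [Gamma x] after the substitution [t = exp (- exp (- s))]. *)
Definition gamma_density x s := expR (- x * s - expR (- s)).

Lemma gamma_density_ge0 x s : 0 <= gamma_density x s.
Proof. exact: expR_ge0. Qed.

Lemma continuous_gamma_density x : continuous (gamma_density x).
Proof.
move=> s; apply: continuous_comp; last exact: continuous_expR.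
apply: continuousB; first by apply: continuousM; [exact: cst_continuous|exact: cvg_id].
exact: is_derive_continuous (is_derive_expRN s).
Qed.

(* logistic density: its primitive maps the line onto ]0, 1[ *)
Definition logistic t : R := expR (- t) / (1 + expR (- t)) ^+ 2.

Lemma continuous_expRN : continuous (fun t : R => expR (- t)).
Proof. by move=> t; exact: is_derive_continuous (is_derive_expRN t). Qed.

Lemma continuous_logistic : continuous logistic.
Proof.
move=> t; have p : 0 < 1 + expR (- t) :> R by rewrite addr_gt0 ?expR_gt0.
have d := is_derive_fD (is_derive_cst (1 : R) t 1) (is_derive_expRN t).
have d2 := @is_deriveV R _ t _ _ (lt0r_neq0 (mulr_gt0 p p)) (is_derive_fM d d).
have := is_derive_continuous (is_derive_fM (is_derive_expRN t) d2).
by congr continuous_at.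
Qed.

Lemma integral_logistic : (\int[mu]_t (logistic t)%:E = 1)%E.
Proof.
have p t : 0 < 1 + expR (- t) :> R by rewrite addr_gt0 ?expR_gt0.
have d t : is_derive (t : R) 1 (fun t => (1 + expR (- t))^-1) (logistic t).
  have d1 := is_derive_fD (is_derive_cst (1 : R) t 1) (is_derive_expRN t).
  have d2 := @is_deriveV R _ t _ _ (lt0r_neq0 (p t)) d1.
  apply: (is_derive_cast d2); rewrite /logistic /GRing.scale /=.
  by field; rewrite gt_eqF.
have cl := continuous_logistic.
have := @integral_substitution_line R (fun t => (1 + expR (- t))^-1) logistic (fun=> 1)
  `]0, 1[%classic d cl.
under [X in _ = X]eq_integral do rewrite mul1r.
move=> <- //.
- by rewrite integral_cst//= mul1e lebesgue_measure_itv/= lte01 sube0.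
- by move=> t; rewrite divr_gt0 ?expR_gt0// exprn_gt0.
- move=> t; rewrite /= in_itv /= invr_gt0 p /= invf_lt1// ltrDl; exact: expR_gt0.
- move=> y; rewrite /= in_itv /= => /andP[y0 y1].
  have y10 : 0 < 1 - y by rewrite subr_gt0.
  exists (- ln ((1 - y) / y)), (- ln ((1 - y) / y)).
  rewrite opprK lnK ?posrE ?divr_gt0//.
  have -> : 1 + (1 - y) / y = y^-1 by field; rewrite gt_eqF.
  by rewrite invrK.
- by move=> y _; exact: cst_continuous.
Qed.

(** Makes the logistic density, whose integral is known, a dominating function for exponential
    decay. *)
Lemma exp_le_logistic t : expR (- `|t|) <= 4 * logistic t.
Proof.
have p : 0 < 1 + expR (- t) :> R by rewrite addr_gt0 ?expR_gt0.
rewrite /logistic mulrA ler_pdivlMr ?exprn_gt0//.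
case: (ger0P t) => t0.
  rewrite mulrC ler_wpM2r ?expR_ge0//.
  have : expR (- t) <= 1 by rewrite expR_le1 oppr_le0.
  by have := expR_ge0 (- t); move: (expR (- t)) => x x0 x1; nra.
rewrite opprK; have e0 := expR_gt0 (- t); have e1 := expR_gt0 t.
have e : expR t <= 1 by rewrite expR_le1 ltW.
have ee : expR t * expR (- t) = 1 by rewrite expRxMexpNx_1.
rewrite -(ler_pM2l e1).
have -> : expR t * (expR t * (1 + expR (- t)) ^+ 2) = (expR t + expR t * expR (- t)) ^+ 2 by ring.
have -> : expR t * (4 * expR (- t)) = 4 * (expR t * expR (- t)) by ring.
rewrite ee; move: (expR t) e e1 => x; nra.
Qed.

Lemma integrable_exp_decay G M d : continuous G -> 0 < d ->
  (forall t, `|G t| <= M * expR (- d * `|t|)) -> mu.-integrable setT (EFin \o G).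
Proof.
move=> cG d0 HG.
have mG : measurable_fun setT G by exact: continuous_measurable_fun.
have cl := continuous_logistic.
have M0 : 0 <= M.
  by have := HG 0; rewrite normr0 mulr0 expR0 mulr1; exact: le_trans.
have l0 t : 0 <= logistic t by rewrite divr_ge0 ?expR_ge0// exprn_ge0// addr_ge0 ?expR_ge0.
apply/integrableP; split; first exact/measurable_EFinP.
have Ml (h : R -> R) : continuous h -> measurable_fun setT (EFin \o h).
  by move=> ch; apply/measurable_EFinP; exact: continuous_measurable_fun.
have cld : continuous (fun t => logistic (d * t + 0) * d).
  move=> t; apply: (@continuous_fM R (fun t => logistic (d * t + 0)) (fun=> d)).
    by apply: (@continuous_fcomp R (fun t => d * t + 0)); [exact: continuous_affine|exact: cl].
  exact: cst_continuous.
have c0 : 0 <= M * 4 / d by rewrite divr_ge0 ?mulr_ge0// ltW.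
apply: (@le_lt_trans _ _ (\int[mu]_t ((M * 4 / d)%:E * (logistic (d * t + 0) * d)%:E))%E).
  apply: ge0_le_integral => //.
  - by apply: measurableT_comp => //; exact/measurable_EFinP.
  - by apply: measurable_funeM; exact: Ml.
  - move=> t _; rewrite -EFinM lee_fin; apply: le_trans (HG t) _.
    have -> : M * 4 / d * (logistic (d * t + 0) * d) = M * (4 * logistic (d * t + 0)).
      by field; rewrite gt_eqF.
    rewrite ler_wpM2l// addr0; apply: le_trans (exp_le_logistic _).
    by rewrite normrM (gtr0_norm d0) mulNr.
rewrite ge0_integralZl_EFin//; last 2 first.
- by move=> t _; rewrite lee_fin mulr_ge0// ltW.
- exact: Ml.
by rewrite -(integral_affine 0 d0 cl l0) integral_logistic mule1 ltry.
Qed.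

Lemma gamma_density_decay x : 0 < x -> exists M, forall s,
  `|gamma_density x s| <= M * expR (- Num.min x 1 * `|s|).
Proof.
move=> x0; pose c := ln (x + 1); have x1 : 0 < x + 1 by rewrite addr_gt0.
pose M := Num.max 1 (expR ((x + 1) * (c - 1))); exists M => s.
rewrite ger0_norm ?gamma_density_ge0//.
have m1 : Num.min x 1 <= x by rewrite ge_min lexx.
have m2 : Num.min x 1 <= 1 by rewrite ge_min lexx orbT.
have m0 : 0 < Num.min x 1 by rewrite lt_min x0 ltr01.
case: (ger0P s) => s0.
  apply: (@le_trans _ _ (1 * expR (- Num.min x 1 * s))).
    rewrite mul1r ler_expR; have := expR_ge0 (- s).
    by have := ler_wpM2r s0 m1; rewrite !mulNr; lra.
  by rewrite ler_wpM2r ?expR_ge0// le_max lexx.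
apply: (@le_trans _ _ (expR ((x + 1) * (c - 1)) * expR (- Num.min x 1 * - s))); last first.
  by rewrite ler_wpM2r ?expR_ge0// le_max lexx orbT.
rewrite -expRD ler_expR.
(* Tangent of the exponential at [c = ln (x + 1)]: its slope exceeds [x] by 1, which leaves decay at
   rate 1. *)
have : (x + 1) * (1 + (- s - c)) <= expR (- s).
  have -> : expR (- s) = (x + 1) * expR (- s - c).
    by rewrite -{1}(lnK (x1 : x + 1 \is Num.pos)) -expRD -/c; congr expR; ring.
  by rewrite ler_wpM2l ?(ltW x1)// expR_ge1Dx.
have := ler_wpM2r (_ : 0 <= - s) m2; rewrite oppr_ge0 (ltW s0) => /(_ isT).
move: (Num.min x 1) => m; nra.
Qed.

Definition gamma_line x := (\int[mu]_s (gamma_density x s)%:E)%E.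

Lemma gamma_line_fin x : 0 < x -> gamma_line x \is a fin_num.
Proof.
move=> x0; have [M HM] := gamma_density_decay x0.
have m0 : 0 < Num.min x 1 by rewrite lt_min x0 ltr01.
have := integrable_exp_decay (@continuous_gamma_density x) m0 HM.
exact: integrable_fin_num.
Qed.

Lemma Gamma_lineE x : 1 < x -> (Gamma x)%:E = gamma_line x.
Proof.
move=> x1; have x0 : 0 < x by apply: lt_trans x1.
rewrite /Gamma /Rintegral.
have -> : (\int[mu]_(t in `]0%R, 1%R[) ((- ln t) `^ (x - 1))%:E = gamma_line x)%E.
  pose F s : R := expR (- expR (- s)).
  have dF (s : R) : is_derive s 1 F (F s * expR (- s)).
    have d := is_derive_fN (is_derive_expRN s).
    by apply: (is_derive_cast (@is_derive1_comp R expR _ s _ _ (is_derive_expR _) d)); rewrite opprK.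
  rewrite (@integral_substitution_line R F (fun s => F s * expR (- s)) _ _ dF).
  - apply: eq_integral => s _; congr EFin.
    rewrite /F expRK opprK -expRM mulrC mulrAC -!expRD /gamma_density.
    by congr expR; ring.
  - move=> s; apply: (@continuous_fM R F); last exact: continuous_expRN.
    exact: is_derive_continuous (dF s).
  - by move=> s; rewrite mulr_gt0 ?expR_gt0.
  - by move=> s; rewrite /= in_itv /= expR_gt0 expR_lt1 oppr_lt0 expR_gt0.
  - move=> y; rewrite /= in_itv /= => /andP[y0 y1].
    exists (- ln (- ln y)), (- ln (- ln y)).
    by rewrite /F opprK !lnK ?posrE ?oppr_gt0 ?ln_lt0 ?y0// opprK lnK.
  - move=> y; rewrite /= in_itv /= => /andP[y0 y1].
    have l0 : 0 < - ln y by rewrite oppr_gt0 ln_lt0// y0.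
    have d1 := is_derive_fN (is_derive1_ln y0).
    have d2 := @is_derive1_comp R (fun u => u `^ (x - 1)) _ y _ _ (is_derive1_powR (x - 1) l0) d1.
    exact: is_derive_continuous d2.
  - by move=> y _; exact: powR_ge0.
by rewrite fineK// gamma_line_fin.
Qed.

Lemma gamma_line_gt0 x : 0 < x -> (0 < gamma_line x)%E.
Proof.
move=> x0; rewrite lt_neqAle eq_sym; apply/andP; split; last first.
  by apply: integral_ge0 => s _; rewrite lee_fin gamma_density_ge0.
pose e := expR (- x - expR 0) : R.
have : (e%:E <= gamma_line x)%E.
  apply: (@le_trans _ _ (\int[mu]_(s in `[0%R, 1%R]) e%:E)%E).
    by rewrite integral_cst//= lebesgue_measure_itv/= lte01 sube0 mule1.
  apply: (@le_trans _ _ (\int[mu]_(s in `[0%R, 1%R]) (gamma_density x s)%:E)%E).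
    apply: ge0_le_integral => //.
    - by move=> s _; rewrite lee_fin expR_ge0.
    - apply/measurable_EFinP; apply: measurable_funTS.
      exact: continuous_measurable_fun (@continuous_gamma_density x).
    - move=> s; rewrite /= in_itv /= => /andP[s0 s1]; rewrite lee_fin ler_expR.
      have : expR (- s) <= expR 0 by rewrite ler_expR oppr_le0.
      by have := ler_wpM2l (ltW x0) s1; rewrite mulr1 mulNr; lra.
  apply: ge0_subset_integral => //.
    apply/measurable_EFinP; exact: continuous_measurable_fun (@continuous_gamma_density x).
  by move=> s _; rewrite lee_fin gamma_density_ge0.
move=> h; apply: contraTneq h => ->; rewrite -ltNge lte_fin; exact: expR_gt0.
Qed.

Lemma tonelli_exp (h : R * R -> R) : measurable_fun setT h ->
  (\int[mu]_s \int[mu]_t (expR (h (s, t)))%:E = \int[mu]_t \int[mu]_s (expR (h (s, t)))%:E)%E.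
Proof.
move=> mh; have mf : measurable_fun setT (fun z => (expR (h z))%:E).
  by apply/measurable_EFinP; apply: measurableT_comp => //; exact: measurable_expR.
have f0 z : (0%:E <= (expR (h z))%:E)%E by rewrite lee_fin expR_ge0.
exact: (@fubini_tonelli _ _ _ _ R mu mu _ mf f0).
Qed.

Lemma continuous_expR_sub3 (a b c d e f : R) :
  continuous (fun t => expR (a * t + b - expR (c * t + d) - expR (e * t + f))).
Proof.
move=> t; apply: (@continuous_fcomp R (fun t => a * t + b - expR (c * t + d) - expR (e * t + f))).
  have ce g h : {for t, continuous (fun t => - expR (g * t + h))}.
    apply: continuousN; apply: (@continuous_fcomp R (fun t => g * t + h)).
      exact: continuous_affine.
    exact: continuous_expR.
  apply: (@continuous_fD R (fun t => a * t + b - expR (c * t + d))); last exact: ce.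
  apply: (@continuous_fD R (fun t => a * t + b)); last exact: ce.
  exact: continuous_affine.
exact: continuous_expR.
Qed.

(** Gamma representation of a negative power: shifting [s] by the logarithm of [e ^ t + e ^ (- t)]
    brings this base into the inner exponential. *)
Lemma bubble_gamma_line x t :
  ((bubble x t)%:E * gamma_line x = \int[mu]_s (expR (- x * s - expR (t - s) - expR (- t - s)))%:E)%E.
Proof.
pose b := - ln (expR t + expR (- t)).
have -> : gamma_line x = (\int[mu]_s (gamma_density x (1 * s + b) * 1)%:E)%E.
  by rewrite -integral_affine//; [exact: continuous_gamma_density|move=> s; exact: gamma_density_ge0].
rewrite -ge0_integralZl_EFin//; first last.
- exact: ltW (bubble_gt0 _ _).
- apply/measurable_EFinP; apply: continuous_measurable_fun => s.
  apply: (@continuous_fM R (fun s => gamma_density x (1 * s + b)) (fun=> 1)).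
    apply: (@continuous_fcomp R (fun s => 1 * s + b)); first exact: continuous_affine.
    exact: continuous_gamma_density.
  exact: cst_continuous.
- by move=> s _; rewrite lee_fin mulr_ge0// gamma_density_ge0.
apply: eq_integral => s _; rewrite -EFinM mulr1 /gamma_density /bubble -expRD; congr (expR _)%:E.
have -> : expR (- (1 * s + b)) = expR (- s) * (expR t + expR (- t)).
  by rewrite mul1r /b opprD opprK expRD lnK// posrE expRDN_gt0.
rewrite !expRD /b; ring.
Qed.

Lemma measurable_exp_proj (a b : R) :
  measurable_fun setT (fun z : R * R => expR (a * z.1 + b * z.2)).
Proof.
apply: measurableT_comp; first exact: measurable_expR.
by apply: measurable_funD; apply: measurable_funM.
Qed.

(** Between two uses of Tonelli's theorem, the substitutions [t = u - s] and [s = (v + u) / 2] split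
    the exponent into [- (x / 2) u - e ^ (- u)] and the same expression in [v]; the second has
    Jacobian 1/2. *)
Lemma beta_line x : 0 < x ->
  ((\int[mu]_t (bubble x t)%:E) * gamma_line x =
   (2^-1)%:E * (gamma_line (x / 2) * gamma_line (x / 2)))%E.
Proof.
move=> x0; have gf := gamma_line_fin x0.
have x20 : 0 < x / 2 by rewrite divr_gt0.
have cb : continuous (bubble x) by move=> t; exact: is_derive_continuous (is_derive_bubble x t).
rewrite -ge0_integralZr//; first last.
- exact: ltW (gamma_line_gt0 x0).
- by move=> t _; rewrite lee_fin ltW ?bubble_gt0.
- by apply/measurable_EFinP; exact: continuous_measurable_fun.
under eq_integral do rewrite bubble_gamma_line.
pose h1 (z : R * R) : R := - x * z.2 - expR (1 * z.1 + (- 1) * z.2) - expR ((- 1) * z.1 + (- 1) * z.2).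
have mh1 : measurable_fun setT h1.
  apply: measurable_funB; last exact: measurable_exp_proj.
  apply: measurable_funB; last exact: measurable_exp_proj.
  by apply: measurable_funM => //; exact: measurable_snd.
transitivity (\int[mu]_t \int[mu]_s (expR (h1 (t, s)))%:E)%E.
  apply: eq_integral => t _; apply: eq_integral => s _.
  by rewrite /h1 /= !mulN1r mul1r.
rewrite tonelli_exp//.
pose h2 (z : R * R) : R := - x * z.1 - expR (1 * z.2 + (- 2) * z.1) - expR ((- 1) * z.2 + 0 * z.1).
have mh2 : measurable_fun setT h2.
  have mz (a b : R) : measurable_fun setT (fun z : R * R => expR (a * z.2 + b * z.1)).
    by have := measurable_exp_proj b a; under eq_fun do rewrite addrC.
  apply: measurable_funB; last exact: mz.
  apply: measurable_funB; last exact: mz.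
  by apply: measurable_funM => //; exact: measurable_fst.
transitivity (\int[mu]_s \int[mu]_u (expR (h2 (s, u)))%:E)%E.
  apply: eq_integral => s _.
  rewrite (@integral_affine (fun t => expR (h1 (t, s))) 1 (- s))//.
  - apply: eq_integral => u _; rewrite mulr1; congr EFin; congr expR; rewrite /h1 /h2 /=.
    have -> : 1 * (1 * u + - s) + - 1 * s = 1 * u + - 2 * s by ring.
    have -> : - 1 * (1 * u + - s) + - 1 * s = - 1 * u + 0 * s by ring.
    by [].
  - have := @continuous_expR_sub3 0 (- x * s) 1 (- s) (- 1) (- s).
    by under eq_fun do rewrite mul0r add0r; rewrite /h1 /= mulN1r.
rewrite tonelli_exp//.
transitivity (\int[mu]_u ((gamma_density (x / 2) u)%:E * ((2^-1)%:E * gamma_line (x / 2))))%E.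
  apply: eq_integral => u _.
  rewrite (@integral_affine (fun s => expR (h2 (s, u))) (2^-1) (u / 2))//.
  - rewrite -ge0_integralZl_EFin//; first last.
    + by apply/measurable_EFinP; exact: continuous_measurable_fun (@continuous_gamma_density _).
    + by move=> s _; rewrite lee_fin gamma_density_ge0.
    rewrite -ge0_integralZl_EFin//; first last.
    + exact: gamma_density_ge0.
    + apply: measurable_funeM; apply/measurable_EFinP.
      exact: continuous_measurable_fun (@continuous_gamma_density _).
    + by move=> s _; rewrite mule_ge0// lee_fin gamma_density_ge0.
    apply: eq_integral => v _; rewrite -!EFinM; congr _%:E.
    rewrite mulrCA mulrC; congr (_ * _); rewrite /gamma_density -expRD /h2 /=.
    have -> : 1 * u + - 2 * (2^-1 * v + u / 2) = - v by field.
    by rewrite mul0r addr0 mulN1r; congr expR; field.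
  - rewrite (_ : (fun s => expR (h2 (s, u))) = (fun t =>
      expR (- x * t + 0 - expR (- 2 * t + u) - expR (0 * t + - u)))).
      exact: continuous_expR_sub3.
    apply/funext => s.
    by rewrite /h2 /= addr0 [1 * u + _]addrC [- 1 * u + _]addrC mul1r mulN1r.
rewrite ge0_integralZr//; last 2 first.
- by move=> u _; rewrite lee_fin gamma_density_ge0.
- by rewrite mule_ge0// ltW ?gamma_line_gt0.
- by rewrite muleCA.
by apply/measurable_EFinP; exact: continuous_measurable_fun (@continuous_gamma_density _).
Qed.

Lemma integral_bubble x : 2 < x ->
  (\int[mu]_t (bubble x t)%:E = (Gamma (x / 2) * Gamma (x / 2) / (2 * Gamma x))%:E)%E /\
  0 < Gamma x /\ 0 < Gamma (x / 2).
Proof.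
move=> x2; have x1 : 1 < x by lra.
have x21 : 1 < x / 2 by lra.
have g0 (y : R) : 1 < y -> 0 < Gamma y.
  move=> y1; have y0 : 0 < y by lra.
  by have := gamma_line_gt0 y0; rewrite -(Gamma_lineE y1) lte_fin.
split; last by split; exact: g0.
have x0 : 0 < x by lra.
have := beta_line x0; rewrite -!Gamma_lineE//.
have : (0 <= \int[mu]_t (bubble x t)%:E)%E.
  by apply: integral_ge0 => t _; rewrite lee_fin ltW ?bubble_gt0.
have gx := g0 x x1.
(* An infinite integral would make the left side of [beta_line] infinite, while its right side is
   finite. *)
case: (integral _ _ _) => [I|_|//]; last first.
  by rewrite gt0_mulye ?lte_fin// -!EFinM => /eqP; rewrite eqe.
rewrite -!EFinM => I0 [E]; congr _%:E.
have -> : Gamma (x / 2) * Gamma (x / 2) = 2 * (I * Gamma x) by rewrite E; field.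
by field; rewrite gt_eqF.
Qed.

End GammaIntegrals.

(** * Square-integrable functions on the line *)

Section LineIntegrals.
Variable R : realType.
Implicit Types (a b t e M : R) (f g G H Y x y : R -> R).
Local Notation mu := (@lebesgue_measure R).

Definition line_integrable G := mu.-integrable setT (EFin \o G).
Definition line_integral G : R := \int[mu]_t G t.
Definition square_integrable Y := continuous Y /\ line_integrable (fun t => Y t ^+ 2).

Lemma line_integrable_le G H : continuous G -> (forall t, `|G t| <= H t) ->
  line_integrable H -> line_integrable G.
Proof.
move=> cG GH iH; apply: le_integrable iH => //.
  by apply/measurable_EFinP; exact: continuous_measurable_fun.
move=> t _; rewrite /= lee_fin (le_trans (GH t))//; exact: le_normr.
Qed.

Lemma line_integrableD G H : line_integrable G -> line_integrable H ->
  line_integrable (fun t => G t + H t).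
Proof.
move=> iG iH; have := integrableD measurableT iG iH.
by apply: eq_integrable => // t _.
Qed.

Lemma line_integrableZ (a : R) G : line_integrable G -> line_integrable (fun t => a * G t).
Proof.
move=> iG; have := integrableZl measurableT a iG.
by apply: eq_integrable => // t _.
Qed.

Lemma line_integralD G H : line_integrable G -> line_integrable H ->
  line_integral (fun t => G t + H t) = line_integral G + line_integral H.
Proof. by move=> iG iH; exact: RintegralD. Qed.

Lemma line_integralZ (a : R) G : line_integrable G ->
  line_integral (fun t => a * G t) = a * line_integral G.
Proof. by move=> iG; exact: RintegralZl. Qed.

Lemma line_integral_le G H : line_integrable G -> line_integrable H ->
  (forall t, G t <= H t) -> line_integral G <= line_integral H.
Proof. by move=> iG iH GH; apply: le_Rintegral. Qed.

Lemma line_integral_EFin G : line_integrable G ->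
  (\int[mu]_t (G t)%:E)%E = (line_integral G)%:E.
Proof. by move=> iG; rewrite /line_integral /Rintegral fineK//; exact: integrable_fin_num. Qed.

Lemma eq_line_integral G H : (forall t, G t = H t) -> line_integral G = line_integral H.
Proof. by move=> GH; apply: eq_Rintegral => t _. Qed.

Lemma line_integrable_support a b G : continuous G ->
  (forall t, t < a \/ b < t -> G t = 0) -> line_integrable G.
Proof.
move=> cG G0; have [ab|ba] := leP a b; last first.
  apply: (@integrable_exp_decay R _ 0 1) => // t; rewrite mul0r G0 ?normr0//.
  by have [ta|ta] := ltP t a; [left|right; exact: lt_le_trans ta].
have [c _ Hc] : exists2 c, c \in `[a, b]%R & forall t, t \in `[a, b]%R -> `|G t| <= `|G c|.
  apply: (@EVT_max R (fun t => `|G t|)) => //.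
  by apply: continuous_subspaceT => t; exact: cvg_norm (cG t).
pose B := Num.max `|a| `|b|.
apply: (@integrable_exp_decay R _ (`|G c| * expR B) 1) => // t.
have [tab|] := boolP (t \in `[a, b]%R); last first.
  rewrite in_itv /= negb_and -!ltNge => /orP tab.
  by rewrite G0// normr0 mulr_ge0 ?mulr_ge0 ?expR_ge0.
apply: le_trans (Hc t tab) _; rewrite -mulrA -expRD ler_peMr//.
rewrite -[leLHS]expR0 ler_expR mulN1r subr_ge0 /B le_max.
move: tab; rewrite in_itv /= => /andP[at_ tb].
case: (ger0P t) => t0; apply/orP; [right|left].
  exact: le_trans tb (ler_norm _).
by rewrite -(normrN a); apply: le_trans (ler_norm _); rewrite lerN2.
Qed.

Lemma integrable_itv G a b : line_integrable G -> mu.-integrable [set` `[a, b]%R] (EFin \o G).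
Proof. by move=> iG; apply: integrableS iG => //; exact: measurable_itv. Qed.

Lemma ftc_line f g a b : (forall t : R, is_derive t 1 f (g t)) -> continuous g -> a < b ->
  \int[mu]_(t in `[a, b]) g t = f b - f a.
Proof.
move=> df cg ab; rewrite /Rintegral (@continuous_FTC2 R g f)//.
- exact: continuous_subspaceT.
- split; first by move=> t _; case: (df t).
    by apply: cvg_at_right_filter; exact: is_derive_continuous (df _).
  by apply: cvg_at_left_filter; exact: is_derive_continuous (df _).
- by move=> t _; rewrite derive1E; exact: derive_val.
Qed.

Lemma ftc_le f g H a b : (forall t : R, is_derive t 1 f (g t)) -> continuous g ->
  line_integrable H -> a <= b -> (forall t, a <= t -> t <= b -> g t <= H t) ->
  f b - f a <= \int[mu]_(t in `[a, b]) H t.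
Proof.
move=> df cg iH; rewrite le_eqVlt => /orP[/eqP<-|ab] gH.
  by rewrite subrr set_itv1 Rintegral_set1.
rewrite -(ftc_line df cg ab); apply: le_Rintegral => //.
- apply: continuous_compact_integrable; first exact: segment_compact.
  exact: continuous_subspaceT.
- exact: integrable_itv.
- by move=> t; rewrite /= in_itv /= => /andP[at_ tb]; exact: gH.
Qed.

Lemma itv_integral_le H a b : line_integrable H -> (forall t, 0 <= H t) ->
  \int[mu]_(t in `[a, b]) H t <= line_integral H.
Proof.
move=> iH H0; rewrite /line_integral /Rintegral fine_le//.
- by apply: integrable_fin_num; [exact: measurable_itv|exact: integrable_itv].
- exact: integrable_fin_num.
- apply: ge0_subset_integral => //; first by case/integrableP: iH.
  by move=> t _; rewrite lee_fin.
Qed.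

(** The integrals over [[- n, n]] increase to the full one, and intervals beyond [n + 1] share only
    what is left. *)
Lemma itv_integral_tail H e : line_integrable H -> (forall t, 0 <= H t) -> 0 < e ->
  exists2 T, 0 <= T & forall a b, T <= a -> \int[mu]_(t in `[a, b]) H t <= e.
Proof.
move=> iH H0 e0; have [mH _] := integrableP _ _ _ iH.
pose I (n : nat) : set R := [set` `[- n%:R, n%:R]%R].
have IT : \bigcup_n I n = setT.
  apply/seteqP; split=> // x _; exists (Num.bound `|x|) => //=.
  by rewrite /I /= in_itv /= -ler_norml ltW// archi_boundP.
have ndI : nondecreasing_seq I.
  move=> n k nk; rewrite subsetEset /I => x /=; rewrite !in_itv /= => /andP[x1 x2].
  have nk' : n%:R <= k%:R :> R by rewrite ler_nat.
  by rewrite (le_trans _ x1) ?lerN2// (le_trans x2).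
have cv : (\int[mu]_(t in I n) (H t)%:E @[n --> \oo] --> (line_integral H)%:E)%E.
  rewrite -line_integral_EFin// -IT; apply: ge0_nondecreasing_set_cvg_integral => //.
  - by move=> n; exact: measurable_itv.
  - by move=> n; apply: measurable_funTS.
  - by move=> n t _; rewrite lee_fin.
have [n Hn] : exists n, (line_integral H - e) < \int[mu]_(t in I n) H t.
  have cv' : \int[mu]_(t in I n) H t @[n --> \oo] --> line_integral H by exact: fine_cvg cv.
  have : line_integral H - e < line_integral H by rewrite ltrBlDr ltrDl.
  move=> /(cvgr_gt _ cv')[N _ HN]; exists N; exact: HN (leqnn _).
exists (n%:R + 1) => [|a b Ta]; first by rewrite addr_ge0.
have dis : [disjoint I n & [set` `[a, b]%R]].
  rewrite disj_set2E; apply/eqP; rewrite -subset0 => t [/=].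
  rewrite /I /= !in_itv /= => /andP[_ tn] /andP[at_ _].
  have : n%:R + 1 <= n%:R :> R by apply: le_trans Ta (le_trans at_ tn).
  by rewrite gerDl ler10.
have E : \int[mu]_(t in I n `|` [set` `[a, b]%R]) H t =
    \int[mu]_(t in I n) H t + \int[mu]_(t in `[a, b]) H t.
  apply: Rintegral_setU => [| | |//].
  - exact: measurable_itv.
  - exact: measurable_itv.
  - by apply: integrableS iH => //; apply: measurableU; exact: measurable_itv.
have : \int[mu]_(t in I n `|` [set` `[a, b]%R]) H t <= line_integral H.
  rewrite /line_integral /Rintegral fine_le//.
  - apply: integrable_fin_num; first by apply: measurableU; exact: measurable_itv.
    by apply: integrableS iH => //; apply: measurableU; exact: measurable_itv.
  - exact: integrable_fin_num.
  - apply: ge0_subset_integral => //; first by apply: measurableU; exact: measurable_itv.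
    by move=> t _; rewrite lee_fin.
rewrite E => h; rewrite -(lerD2l (\int[mu]_(t in I n) H t)); apply: le_trans h _.
by rewrite -lerBlDr ltW.
Qed.

Lemma square_integrableD Y Z : square_integrable Y -> square_integrable Z ->
  square_integrable (fun t => Y t + Z t).
Proof.
move=> [cY iY] [cZ iZ]; have cYZ : continuous (fun t => Y t + Z t).
  by move=> t; exact: (@continuous_fD R _ _ t (cY t) (cZ t)).
split=> //; apply: (@line_integrable_le _ (fun t => 2 * Y t ^+ 2 + 2 * Z t ^+ 2)).
- move=> t; have := @continuous_fM R _ _ t (cYZ t) (cYZ t).
  by congr continuous_at; apply/funext => s; rewrite expr2.
- move=> t; rewrite ger0_norm ?sqr_ge0//.
  by have := sqr_ge0 (Y t - Z t); rewrite sqrrB sqrrD !mulr2n; lra.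
- by apply: line_integrableD; exact: line_integrableZ.
Qed.

Lemma square_integrableZ (c : R) Y : square_integrable Y -> square_integrable (fun t => c * Y t).
Proof.
move=> [cY iY]; split.
  by move=> t; apply: (@continuous_fM R (fun=> c)); [exact: cst_continuous|exact: cY].
have := line_integrableZ (c ^+ 2) iY; congr line_integrable.
by apply/funext => t; rewrite exprMn.
Qed.

Lemma square_integrable_span (J : nat -> R -> R) (c : nat -> R) k :
  (forall i, (i < k)%N -> square_integrable (J i)) ->
  square_integrable (fun t => \sum_(i < k) c i * J i t).
Proof.
elim: k => [_|k IH HJ].
  have -> : (fun t => \sum_(i < 0) c i * J i t) = fun=> 0 by apply/funext => t; rewrite big_ord0.
  split; first by move=> t; exact: cst_continuous.
  by apply: (@line_integrable_support 0 0) => [t|t _]; [exact: cst_continuous|rewrite expr0n].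
have -> : (fun t => \sum_(i < k.+1) c i * J i t) =
    fun t => (\sum_(i < k) c i * J i t) + c k * J k t.
  by apply/funext => t; rewrite big_ord_recr.
apply: square_integrableD; first by apply: IH => i ik; exact: HJ (ltnW ik).
by apply: square_integrableZ; exact: HJ.
Qed.

Lemma line_integrableM Y Z : square_integrable Y -> square_integrable Z ->
  line_integrable (fun t => Y t * Z t).
Proof.
move=> [cY iY] [cZ iZ]; apply: (@line_integrable_le _ (fun t => Y t ^+ 2 + Z t ^+ 2)).
- by move=> t; exact: (@continuous_fM R _ _ t (cY t) (cZ t)).
- move=> t; have := sqr_ge0 (Y t - Z t); have := sqr_ge0 (Y t + Z t).
  rewrite sqrrB sqrrD !mulr2n ler_norml => h1 h2; apply/andP; split; nra.
- exact: line_integrableD.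
Qed.

Lemma square_integrable_support a b Y : continuous Y ->
  (forall t, t < a \/ b < t -> Y t = 0) -> square_integrable Y.
Proof.
move=> cY Y0; split=> //; apply: (@line_integrable_support a b).
  move=> t; have := @continuous_fM R _ _ t (cY t) (cY t).
  by congr continuous_at; apply/funext => s; rewrite expr2.
by move=> t /Y0 ->; rewrite expr0n.
Qed.

(* the one-dimensional Sobolev embedding *)
Lemma square_integrable_decay Y Z (nu : R) : square_integrable Y -> square_integrable Z ->
  (forall t : R, is_derive t 1 Y (nu * Y t + Z t)) ->
  (exists M, forall t, `|Y t| <= M) /\
  (forall e, 0 < e -> exists T, forall t, T <= t -> `|Y t| <= e).
Proof.
move=> LY LZ dY; have [cY iY] := LY; have [cZ iZ] := LZ.
(* [H] dominates the derivative of [Y ^ 2], so [Y ^ 2] varies little where the tail of [H] is small;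
   it also dominates [Y ^ 2] itself. *)
pose H t := (2 * `|nu| + 1) * Y t ^+ 2 + Z t ^+ 2.
have iH : line_integrable H by apply: line_integrableD => //; exact: line_integrableZ.
have H0 t : 0 <= H t.
  by rewrite addr_ge0 ?sqr_ge0// mulr_ge0 ?sqr_ge0// addr_ge0// mulr_ge0.
pose W t := Y t * Y t; pose dW t := (nu * Y t + Z t) * Y t + Y t * (nu * Y t + Z t).
have dWP (t : R) : is_derive t 1 W (dW t) by exact: is_derive_fM.
have cdW : continuous dW.
  have c1 : continuous (fun t => nu * Y t + Z t).
    move=> t; apply: (@continuous_fD R (fun t => nu * Y t)); last exact: cZ.
    by apply: (@continuous_fM R (fun=> nu)); [exact: cst_continuous|exact: cY].
  move=> t; apply: (@continuous_fD R (fun t => (nu * Y t + Z t) * Y t)).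
    exact: (@continuous_fM R _ _ t (c1 t) (cY t)).
  exact: (@continuous_fM R _ _ t (cY t) (c1 t)).
have HW t : `|dW t| <= H t.
  have h1 : `|nu * Y t ^+ 2| <= `|nu| * Y t ^+ 2.
    by rewrite normrM (ger0_norm (sqr_ge0 _)).
  have h2 : `|2 * (Y t * Z t)| <= Y t ^+ 2 + Z t ^+ 2.
    have := sqr_ge0 (Y t - Z t); have := sqr_ge0 (Y t + Z t).
    by rewrite sqrrB sqrrD !mulr2n ler_norml => *; apply/andP; split; lra.
  have -> : dW t = 2 * (nu * Y t ^+ 2) + 2 * (Y t * Z t) by rewrite /dW; ring.
  apply: le_trans (ler_normD _ _) _; rewrite normrM ger0_norm//.
  by rewrite /H; move: h1 h2; move: `|nu * Y t ^+ 2| `|2 * (Y t * Z t)| => u v; lra.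
have step a b : a <= b -> `|W b - W a| <= \int[mu]_(t in `[a, b]) H t.
  move=> ab; rewrite ler_norml; apply/andP; split.
    rewrite lerNl opprB -[W a - W b]opprK opprB -[leLHS](_ : - W b - - W a = _); last by ring.
    apply: (ftc_le (fun t => is_derive_fN (dWP t))) => //.
      by move=> t; apply: continuousN; exact: cdW.
    by move=> t _ _; apply: le_trans (HW t); rewrite -normrN le_normr.
  apply: (ftc_le dWP) => // t _ _; apply: le_trans (HW t); exact: le_normr.
have YW t : `|Y t| ^+ 2 = W t by rewrite real_normK ?num_real// expr2.
split.
  exists (W 0 + line_integral H + 1) => t.
  have : W t <= W 0 + line_integral H.
    have [t0|t0] := leP 0 t.
      have := le_trans (step 0 t t0) (itv_integral_le 0 t iH H0).
      by rewrite ler_norml => /andP[_]; lra.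
    have := le_trans (step t 0 (ltW t0)) (itv_integral_le t 0 iH H0).
    by rewrite ler_norml => /andP[]; lra.
  rewrite -YW; have := sqr_ge0 (`|Y t| - 1); rewrite sqrrB1; have := sqr_ge0 `|Y t|.
  move: `|Y t| => y; nra.
move=> e e0; have e2 : 0 < e ^+ 2 / 2 by rewrite divr_gt0// exprn_gt0.
have [T T0 HT] := itv_integral_tail iH H0 e2.
(* Otherwise [H >= e ^ 2 / 2] on [[T, T + 2]], and its integral there exceeds the tail bound. *)
have [t1 Tt1 Wt1] : exists2 t1, T <= t1 & W t1 <= e ^+ 2 / 2.
  apply: contrapT => no.
  have big t : T <= t -> e ^+ 2 / 2 <= H t.
    move=> Tt; apply: (@le_trans _ _ (W t)).
      by rewrite leNgt; apply/negP => /ltW h; apply: no; exists t.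
    rewrite /H /W -expr2; have := sqr_ge0 (Y t); have := sqr_ge0 (Z t).
    have := mulr_ge0 (normr_ge0 nu) (sqr_ge0 (Y t)); lra.
  pose b := T + 2.
  have Tb : T <= b by rewrite lerDl.
  have d (t : R) : is_derive t 1 (fun s => (e ^+ 2 / 2) * s) (e ^+ 2 / 2).
    apply: (is_derive_cast (is_derive_fZ (e ^+ 2 / 2) (is_derive_id t (1 : R)))).
    by rewrite mulr1.
  have cc : continuous (fun _ : R => e ^+ 2 / 2) by move=> t; exact: cst_continuous.
  have := le_trans (ftc_le d cc iH Tb (fun t Tt _ => big t Tt)) (HT T b (lexx _)).
  rewrite -mulrBr /b addrAC subrr add0r; lra.
exists t1 => t t1t; have := le_trans (step t1 t t1t) (HT t1 t Tt1).
rewrite ler_norml => /andP[_ h]; rewrite -ler_sqr ?nnegrE ?(ltW e0)// YW.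
by move: Wt1 h; lra.
Qed.

Lemma line_integral_gt0 H : continuous H -> line_integrable H -> (forall t, 0 <= H t) ->
  (exists t, H t != 0) -> 0 < line_integral H.
Proof.
move=> cH iH H0 [t0 Ht0]; have h0 : 0 < H t0 by rewrite lt_def Ht0 H0.
have h2 : H t0 / 2 < H t0 by lra.
move: (h2) => /(cvgr_gt _ (cH t0)); rewrite -nbhs_nearE => /nbhs_ballP[e /= e0 He].
have ab : t0 <= t0 + e / 2 by rewrite lerDl divr_ge0// ltW.
have d (t : R) : is_derive t 1 (fun s => (H t0 / 2) * s) (H t0 / 2).
  apply: (is_derive_cast (is_derive_fZ (H t0 / 2) (is_derive_id t (1 : R)))).
  by rewrite mulr1.
have cc : continuous (fun _ : R => H t0 / 2) by move=> t; exact: cst_continuous.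
have lo t : t0 <= t -> t <= t0 + e / 2 -> H t0 / 2 <= H t.
  move=> t1 t2; apply/ltW/He; rewrite /ball /= ltr_norml; apply/andP; split; lra.
apply: lt_le_trans (itv_integral_le t0 (t0 + e / 2) iH H0).
apply: lt_le_trans (ftc_le d cc iH ab lo).
by rewrite -mulrBr [t0 + _]addrC addrK mulr_gt0// divr_gt0.
Qed.

Lemma line_integral_by_parts y dy x dx a b : a < b ->
  (forall t : R, is_derive t 1 y (dy t)) -> (forall t : R, is_derive t 1 x (dx t)) ->
  continuous dy -> continuous dx ->
  (forall t, t < a \/ b < t -> x t = 0) -> (forall t, t < a \/ b < t -> dx t = 0) ->
  line_integral (fun t => y t * dx t) = - line_integral (fun t => dy t * x t).
Proof.
move=> ab dY dX cdy cdx x0 dx0.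
have cy : continuous y by move=> t; exact: is_derive_continuous (dY t).
have cx : continuous x by move=> t; exact: is_derive_continuous (dX t).
have c1 : continuous (fun t => y t * dx t).
  by move=> t; exact: (@continuous_fM R _ _ t (cy t) (cdx t)).
have c2 : continuous (fun t => dy t * x t).
  by move=> t; exact: (@continuous_fM R _ _ t (cdy t) (cx t)).
have i1 : line_integrable (fun t => y t * dx t).
  by apply: (line_integrable_support c1) => t /dx0 ->; rewrite mulr0.
have i2 : line_integrable (fun t => dy t * x t).
  by apply: (line_integrable_support c2) => t /x0 ->; rewrite mulr0.
apply/eqP; rewrite -addr_eq0 -line_integralD//.
pose F t := dy t * x t + y t * dx t.
have dF (t : R) : is_derive t 1 (fun t => y t * x t) (F t) by exact: is_derive_fM.
have cF : continuous F by move=> t; exact: (@continuous_fD R _ _ t (c2 t) (c1 t)).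
have ab1 : a - 1 < b + 1 by lra.
have := ftc_line dF cF ab1.
rewrite (x0 (a - 1)); last by left; rewrite ltrBlDr ltrDl.
rewrite (x0 (b + 1)); last by right; rewrite ltrDl.
rewrite !mulr0 subrr Rintegral_mkcond => E; apply/eqP; rewrite -[RHS]E /line_integral.
apply: eq_Rintegral => t _; rewrite patchE; case: ifPn => [_|]; first by rewrite addrC.
rewrite notin_setE /= in_itv /= => /negP; rewrite negb_and -!ltNge => /orP h.
have h' : t < a \/ b < t by case: h => h; [left|right]; lra.
by rewrite x0// dx0// !mulr0 addr0.
Qed.

End LineIntegrals.

(** * Test functions and adjoints *)

Section TestFunctions.
Variable R : realType.
Implicit Types (a b t : R) (f x phi : R -> R) (p : {poly R}) (nu : nat -> R).

(** Truncated powers: finite smoothness is enough for the integrations by parts, so they serve to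
    build the test functions. *)
Definition relu_pow (n : nat) t : R := Num.max t 0 ^+ n.

Lemma continuous_relu_pow n : continuous (relu_pow n).
Proof.
move=> t; apply: (@continuous_fcomp R (fun t => Num.max t 0) (fun y => y ^+ n)).
  by apply: continuous_max; [exact: cvg_id|exact: cst_continuous].
exact: exprn_continuous.
Qed.

Lemma is_derive_exprn n t : is_derive t 1 (fun s : R => s ^+ n.+1) (n.+1%:R * t ^+ n).
Proof.
elim: n => [|n IH]; first by rewrite mulr1; exact: is_derive_id.
have -> : (fun s : R => s ^+ n.+2) = fun s => s * s ^+ n.+1.
  by apply/funext => s; rewrite exprS.
apply: (is_derive_cast (is_derive_fM (is_derive_id t (1 : R)) IH)).
by rewrite -[in RHS]natr1 exprS; ring.
Qed.

Lemma is_derive_relu_pow n t : is_derive t 1 (relu_pow n.+2) (n.+2%:R * relu_pow n.+1 t).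
Proof.
have [t0|t0|->] := ltgtP t 0.
- rewrite /relu_pow max_r ?(ltW t0)// expr0n mulr0.
  apply: (@near_eq_is_derive _ _ _ (fun=> 0)) => //.
  by near=> s; rewrite max_r ?expr0n//; apply/ltW; near: s; exact: lt_nbhsl.
- rewrite /relu_pow max_l ?(ltW t0)//.
  apply: (@near_eq_is_derive R R R (fun s : R => s ^+ n.+2)).
    by near=> s; rewrite max_l//; apply/ltW; near: s; exact: lt_nbhsr.
  exact: is_derive_exprn.
(* The difference quotient of [relu_pow n.+2] at 0 is [relu_pow n.+1], the continuous slope required
   by Caratheodory's criterion. *)
- apply/is_derive1_caratheodory; exists (relu_pow n.+1); split.
  + move=> s; rewrite subr0 /relu_pow maxxx expr0n subr0 exprSr.
    by case: (leP s 0) => s0; rewrite ?expr0n ?mulr0 ?mul0r.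
  + exact: continuous_relu_pow.
  + by rewrite /relu_pow maxxx expr0n mulr0.
Unshelve. all: by end_near. Qed.

Lemma smooth_relu_pow n k : (n < k)%N -> smooth n (relu_pow k).
Proof.
elim: n k => [|n IH] k nk; first exact: smooth0.
case: k nk => [|[|k]] nk; [by rewrite ltn0 in nk|by rewrite ltnS ltn0 in nk|].
apply: (smoothS (fun t => is_derive_relu_pow k t)).
by apply: smoothZ; exact: IH.
Qed.

Lemma smooth_shift n f (c : R) : smooth n f -> smooth n (fun t => f (t - c)).
Proof.
elim: n f => [|n IH] f sf; first exact: smooth0.
have d t : is_derive (t : R) 1 (fun t => f (t - c)) (f^`() (t - c)).
  have d1 := is_derive_fB (is_derive_id t (1 : R)) (is_derive_cst c t 1).
  apply: (is_derive_cast (@is_derive1_comp R f _ t _ _ (smooth_is_derive (t - c) sf) d1)).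
  by rewrite subr0 mulr1.
by apply: (smoothS d); apply: IH; exact: smooth_derive1.
Qed.

Definition bump n a b t := relu_pow n.+1 (t - a) * relu_pow n.+1 (b - t).

Lemma smooth_bump n a b : smooth n (bump n a b).
Proof.
apply: smoothM; first by apply: smooth_shift; exact: smooth_relu_pow.
have := @smooth_shift n _ b (smooth_reflect (smooth_relu_pow (ltnSn n))).
by congr smooth; apply/funext => t; rewrite opprB.
Qed.

Lemma bump_ge0 n a b t : 0 <= bump n a b t.
Proof. by rewrite mulr_ge0// exprn_ge0// le_max lexx orbT. Qed.

Lemma bump_gt0 n a b t : a < t -> t < b -> 0 < bump n a b t.
Proof. by move=> at_ tb; rewrite mulr_gt0// exprn_gt0// lt_max subr_gt0 ?at_ ?tb. Qed.

Lemma relu_pow_eq0 n t : t <= 0 -> relu_pow n.+1 t = 0.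
Proof. by move=> t0; rewrite /relu_pow max_r// expr0n. Qed.

Lemma bump_support n a b t : t <= a \/ b <= t -> bump n a b t = 0.
Proof.
rewrite /bump; case=> h; first by rewrite (@relu_pow_eq0 n (t - a)) ?subr_le0// mul0r.
by rewrite (@relu_pow_eq0 n (b - t)) ?subr_le0// mulr0.
Qed.

Definition supported a b f := forall t, t < a \/ b < t -> f t = 0.

Lemma supported_derive1n a b f j : supported a b f -> supported a b (derive1n j f).
Proof.
move=> sf; elim: j => [|j IH] //= t tab; rewrite derive1E.
rewrite (@near_eq_derive _ _ _ _ (fun=> 0)) ?derive_cst//.
case: tab => h; near=> s; apply: IH; [left|right]; near: s.
  exact: lt_nbhsl.
exact: lt_nbhsr.
Unshelve. all: by end_near. Qed.

Lemma supported_Pop a b f p : supported a b f -> supported a b (Pop p f).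
Proof. by move=> sf t tab; apply: Pop_zero => i _; exact: (supported_derive1n i sf tab). Qed.

Lemma continuous_Pop n f p : smooth n f -> (size p <= n)%N -> continuous (Pop p f).
Proof. by move=> sf pn t; exact: is_derive_continuous (PopXM t sf pn). Qed.

Definition test_function n a b x := smooth n x /\ supported a b x.

(** Integrations by parts move the factors from [x] to [phi] one at a time, the last first: [D - nu]
    on [x] becomes [- (D + nu)] on [phi], where it meets [D - nu]. Continuity is assumed up to order
    [2 m] because [smooth] leaves the top order open. *)
Lemma Pop_adjoint m nu phi x a b : a < b -> smooth (2 * m) phi ->
  (forall p, (size p <= (2 * m).+1)%N -> continuous (Pop p phi)) ->
  test_function (2 * m).+1 a b x ->
  line_integral (fun t => Pop (newton nu m) phi t * Pop (newton nu m) x t) =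
  (-1) ^+ m * line_integral (fun t =>
    Pop (\prod_(k < m) ('X^2 - ((nu k) ^+ 2)%:P)) phi t * x t).
Proof.
move=> ab sphi cphi [sx x0].
(* The operator on [phi] after [j] moves; the factors leave [x] in the order [m - 1], [m - 2], and
   so on. *)
pose Q (j : nat) : {poly R} := newton nu m * \prod_(i < j) ('X + (nu (m - i.+1)%N)%:P).
have sQ j : (size (Q j) <= m + j.+1)%N.
  have sP : size (\prod_(i < j) ('X + (nu (m - i.+1)%N)%:P)) = j.+1.
    under eq_bigr do rewrite -[_%:P]opprK -polyCN.
    by rewrite size_prod_XsubC /index_enum -enumT size_enum_ord.
  by apply: leq_trans (size_polyMleq _ _) _; rewrite size_newton sP addSn.
have step j : (j <= m)%N -> line_integral (fun t => Pop (newton nu m) phi t * Pop (newton nu m) x t) =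
    (-1) ^+ j * line_integral (fun t => Pop (Q j) phi t * Pop (newton nu (m - j)) x t).
  elim: j => [_|j IH jm].
    by rewrite expr0 mul1r subn0 /Q big_ord0 mulr1.
  rewrite (IH (ltnW jm)) exprS -mulrA mulrCA; congr (_ * _).
  pose k := (m - j.+1)%N; have -> : (m - j)%N = k.+1 by rewrite /k subnSK.
  set q := newton nu k; pose y := Pop (Q j) phi.
  have sq : (size q <= 2 * m)%N.
    rewrite size_newton mul2n -addnn ltn_addr// /k ltn_subrL /=.
    exact: leq_ltn_trans jm.
  have sQj : (size (Q j) <= 2 * m)%N by apply: leq_trans (sQ j) _; rewrite mul2n -addnn leq_add2l.
  have sXQ : (size ('X * Q j)%R <= (2 * m).+1)%N.
    by apply: leq_trans (size_polyMleq _ _) _; rewrite size_polyX addSn add1n /= ltnS.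
  have sXq : (size ('X * q)%R <= (2 * m).+1)%N.
    by apply: leq_trans (size_polyMleq _ _) _; rewrite size_polyX addSn add1n /= ltnS.
  have dy (t : R) : is_derive t 1 y (Pop ('X * Q j) phi t) := PopXM t sphi sQj.
  have dx (t : R) : is_derive t 1 (Pop q x) (Pop ('X * q) x t).
    by apply: PopXM sx _; exact: leqW.
  have cdx : continuous (Pop ('X * q) x) by apply: continuous_Pop sx sXq.
  have cy : continuous y by apply: cphi; exact: leqW.
  have cq : continuous (Pop q x) by apply: continuous_Pop sx (leqW sq).
  have E1 : line_integral (fun t => y t * Pop ('X * q) x t) =
      - line_integral (fun t => Pop ('X * Q j) phi t * Pop q x t).
    apply: (line_integral_by_parts ab dy dx (cphi _ sXQ) cdx); exact: supported_Pop.
  have I f : continuous f -> line_integrable (fun t => f t * Pop q x t).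
    move=> cf; apply: (@line_integrable_support R a b).
      by move=> t; exact: (@continuous_fM R _ _ t (cf t) (cq t)).
    by move=> t tab; rewrite (supported_Pop q x0 tab) mulr0.
  have I2 : line_integrable (fun t => y t * Pop ('X * q) x t).
    apply: (@line_integrable_support R a b).
      by move=> t; exact: (@continuous_fM R _ _ t (cy t) (cdx t)).
    by move=> t tab; rewrite (supported_Pop ('X * q) x0 tab) mulr0.
  transitivity (line_integral (fun t => y t * Pop ('X * q) x t + (- nu k) * (y t * Pop q x t))).
    apply: eq_line_integral => t; rewrite newtonS -scaleNr PopD PopZ -/q -/(y t); ring.
  rewrite (line_integralD I2 (line_integrableZ (- nu k) (I _ cy))) (line_integralZ _ (I _ cy)) E1.
  transitivity (- (line_integral (fun t => Pop ('X * Q j) phi t * Pop q x t) +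
     nu k * line_integral (fun t => y t * Pop q x t))); first by ring.
  rewrite mulN1r; congr (- _).
  rewrite -(line_integralZ _ (I _ cy)) -(line_integralD (I _ (cphi _ sXQ)) (line_integrableZ (nu k) (I _ cy))).
  apply: eq_line_integral => t.
  have -> : Q j.+1 = 'X * Q j + nu k *: Q j.
    rewrite /Q big_ord_recr /= -/k -mul_polyC; ring.
  by rewrite PopD PopZ -/(y t); ring.
rewrite (step m (leqnn m)) subnn; congr (_ * _); apply: eq_line_integral => t.
have -> : newton nu 0 = 1 by rewrite /newton big_ord0.
rewrite Pop1; congr (Pop _ _ _ * _).
rewrite /Q /newton [X in _ * X](reindex_inj rev_ord_inj) -big_split /=; apply: eq_bigr => i _.
by rewrite subnSK// subKn ?(ltnW (ltn_ord i))// polyC_exp; ring.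
Qed.

Lemma test_function_bump n a b : test_function n a b (bump n a b).
Proof. by split; [exact: smooth_bump|move=> t [h|h]; apply: bump_support; [left|right]; exact: ltW]. Qed.

Lemma fundamental_lemma n (G : R -> R) : continuous G ->
  (forall a b x, a < b -> test_function n a b x -> line_integral (fun t => G t * x t) = 0) ->
  forall t, G t = 0.
Proof.
move=> cG HG t0; apply/eqP; apply/negP => /negP Gt0.
have c1 : continuous (fun t => G t0 * G t).
  by move=> t; apply: (@continuous_fM R (fun=> G t0)); [exact: cst_continuous|exact: cG].
have G0 : 0 < G t0 * G t0 by rewrite lt_def mulf_neq0//= -expr2 sqr_ge0.
move: (G0) => /(cvgr_gt _ (c1 t0)); rewrite -nbhs_nearE => /nbhs_ballP[e /= e0 He].
pose a := t0 - e; pose b := t0 + e; pose x := bump n a b.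
have ab : a < b by rewrite /a /b; lra.
have cx : continuous x.
  move=> t; apply: (@continuous_fM R (fun t => relu_pow n.+1 (t - a)) (fun t => relu_pow n.+1 (b - t))).
    apply: (@continuous_fcomp R (fun t => t - a)); last exact: continuous_relu_pow.
    by apply: continuousB; [exact: cvg_id|exact: cst_continuous].
  apply: (@continuous_fcomp R (fun t => b - t)); last exact: continuous_relu_pow.
  by apply: continuousB; [exact: cst_continuous|exact: cvg_id].
have cGx : continuous (fun t => G t * x t) by move=> t; exact: (@continuous_fM R _ _ t (cG t) (cx t)).
have iGx : line_integrable (fun t => G t * x t).
  by apply: (@line_integrable_support R a b) => // t [h|h]; rewrite /x bump_support ?mulr0//; [left|right]; exact: ltW.
have : 0 < line_integral (fun t => G t0 * (G t * x t)).
  apply: line_integral_gt0.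
  - by move=> t; apply: (@continuous_fM R (fun=> G t0) (fun t => G t * x t)); [exact: cst_continuous|exact: cGx].
  - exact: line_integrableZ.
  - move=> t; have [[at_ tb]|no] := pselect (a < t /\ t < b).
      rewrite mulrA mulr_ge0 ?bump_ge0// ltW//; apply: He.
      by rewrite /ball /= ltr_norml; apply/andP; split; move: at_ tb; rewrite /a /b; lra.
    rewrite /x bump_support ?mulr0//.
    have [ta|at_] := leP t a; [by left|right].
    by rewrite leNgt; apply/negP => tb; exact: no.
  - exists t0; rewrite mulrA gt_eqF// mulr_gt0// bump_gt0//; rewrite /a /b; lra.
by rewrite (line_integralZ _ iGx) (HG a b x ab (test_function_bump n a b)) mulr0 ltxx.
Qed.

End TestFunctions.

(** * The logarithmic change of variable *)

Section LogarithmicLift.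
Variable R : realType.
Implicit Types (a b lam alpha r t : R) (u v w phi Y Z : R -> R) (m n : nat).
Local Notation mu := (@lebesgue_measure R).

(** [u r = r ^ (- a) Y (ln r)] on the half-line. *)
Definition is_lift a Y u := forall r, 0 < r -> u r = expR (- a * ln r) * Y (ln r).

Lemma is_derive_log_profile a Y Z r : (forall t : R, is_derive t 1 Y (a * Y t + Z t)) -> 0 < r ->
  is_derive r 1 (fun r => expR (- a * ln r) * Y (ln r)) (expR (- (a + 1) * ln r) * Z (ln r)).
Proof.
move=> dY r0; have dl := is_derive1_ln r0.
have d1 := @is_derive1_comp R expR _ r _ _ (is_derive_expR _) (is_derive_fZ (- a) dl).
have d2 := @is_derive1_comp R Y (@ln R) r _ _ (dY (ln r)) dl.
apply: (is_derive_cast (is_derive_fM d1 d2)).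
have -> : - (a + 1) * ln r = - a * ln r + - ln r by ring.
by rewrite /= expRD expRN lnK ?posrE//; ring.
Qed.

Lemma lift_is_derive a Y Z u r : is_lift a Y u ->
  (forall t : R, is_derive t 1 Y (a * Y t + Z t)) -> 0 < r ->
  is_derive r 1 u (expR (- (a + 1) * ln r) * Z (ln r)).
Proof.
move=> uY dY r0; apply: near_eq_is_derive (is_derive_log_profile dY r0).
by near=> s; rewrite uY//; near: s; exact: lt_nbhsr.
Unshelve. all: by end_near. Qed.

Lemma lift_derive1 a Y Z u : is_lift a Y u ->
  (forall t : R, is_derive t 1 Y (a * Y t + Z t)) -> is_lift (a + 1) Z u^`().
Proof.
move=> uY dY r r0; have d := lift_is_derive uY dY r0.
by rewrite derive1E; exact: derive_val.
Qed.

(** A derivative in [r] of [r ^ (- a) Y (ln r)] applies [D - a] to [Y] and raises [a] by 1. *)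
Definition jet_exponents lam (k : nat) : R := lam + k%:R.

Lemma lift_derive1n n lam phi u j : smooth n phi -> is_lift lam phi u -> (j <= n)%N ->
  is_lift (lam + j%:R) (Pop (newton (jet_exponents lam) j) phi) (u^`(j)).
Proof.
move=> sphi uphi; elim: j => [_|j IH jn].
  by rewrite addr0 /newton big_ord0 => r r0; rewrite Pop1 /= uphi.
rewrite derive1nS -natr1 addrA; apply: (lift_derive1 (IH (ltnW jn))).
by move=> t; exact: (Pop_newton_chain (jet_exponents lam) sphi t jn).
Qed.

Lemma lift_derivable n lam phi u j r : smooth n phi -> is_lift lam phi u -> (j < n)%N -> 0 < r ->
  is_derive r 1 (u^`(j)) (u^`(j.+1) r).
Proof.
move=> sphi uphi jn r0.
have d := @lift_is_derive _ _ (Pop (newton (jet_exponents lam) j.+1) phi) _ _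
  (lift_derive1n sphi uphi (ltnW jn)) (fun t => Pop_newton_chain (jet_exponents lam) sphi t jn) r0.
by rewrite (lift_derive1n sphi uphi jn r0) -natr1 addrA.
Qed.

(** On [r ^ (- a) Y (ln r)], [Lap alpha] acts as [(D - a) (D - (a + 1 - alpha))] and raises [a] by
    2; the odd entries come from the second factors. *)
Definition lap_exponents alpha lam (k : nat) : R :=
  if odd k then lam + k%:R - alpha else lam + k%:R.

Lemma lift_Lap n alpha lam phi u i : smooth n phi -> is_lift lam phi u -> (2 * i <= n)%N ->
  is_lift (lam + (2 * i)%:R) (Pop (newton (lap_exponents alpha lam) (2 * i)) phi)
    (iter i (Lap alpha) u).
Proof.
move=> sphi uphi; elim: i => [_|i IH].
  by rewrite addr0 /newton big_ord0 => r r0; rewrite Pop1 /= uphi.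
rewrite mulnS add2n => i2n r r0; rewrite iterS /Lap.
have /IH lv : (2 * i <= n)%N by exact: ltnW (ltnW i2n).
set a := lam + (2 * i)%:R in lv; set v := iter i _ _ in lv *.
have cK := Pop_newton_chain (lap_exponents alpha lam) sphi.
set K := fun k : nat => _ in cK.
have d0 (t : R) : is_derive t 1 (K (2 * i)%N) (a * K (2 * i)%N t + K (2 * i).+1 t).
  have := cK (2 * i)%N t (ltnW i2n).
  by rewrite {1}/lap_exponents oddM /=.
have l1 := lift_derive1 lv d0.
(* The remainder for the exponent [a + 1] that one more derivative produces; its term in [alpha]
   cancels against [alpha / r] times the first derivative. *)
pose Z t := K (2 * i).+2 t - alpha * K (2 * i).+1 t.
have d1 (t : R) : is_derive t 1 (K (2 * i).+1) ((a + 1) * K (2 * i).+1 t + Z t).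
  apply: (is_derive_cast (cK (2 * i).+1 t i2n)).
  by rewrite /lap_exponents /= oddM /= /Z /a -natr1; ring.
have l2 := lift_derive1 l1 d1.
rewrite derive1nS derive1n1 (l2 r r0) (l1 r r0) /Z.
have -> : alpha / r = alpha * expR (- ln r) by rewrite expRN lnK ?posrE.
have -> : lam + (2 * i).+2%:R = a + 1 + 1 by rewrite /a -!natr1 !addrA.
have -> : - (a + 1 + 1) * ln r = - (a + 1) * ln r + - ln r by ring.
rewrite expRD -/(K (2 * i).+2); ring.
Qed.

Lemma lift_grad n alpha lam phi u m : smooth n phi -> is_lift lam phi u -> (m <= n)%N ->
  is_lift (lam + m%:R) (Pop (newton (lap_exponents alpha lam) m) phi) (grad alpha m u).
Proof.
move=> sphi uphi mn; rewrite /grad.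
have E : m = (odd m + 2 * m./2)%N by rewrite mul2n odd_double_half.
have m2n : (2 * m./2 <= n)%N by apply: leq_trans mn; rewrite {2}E leq_addl.
have lv := lift_Lap alpha sphi uphi m2n.
case: ifPn => om; last first.
  by move: lv; congr is_lift; [congr (_ + _%:R)|congr (Pop (newton _ _) _)]; rewrite {2}E (negbTE om).
have E1 : m = (2 * m./2).+1 by rewrite {1}E om add1n.
have m2n' : (2 * m./2 < n)%N by rewrite -E1.
have H : is_lift (lam + (2 * m./2)%:R + 1)
    (Pop (newton (lap_exponents alpha lam) (2 * m./2).+1) phi)
    (derive1 (iter m./2 (Lap alpha) u)).
  apply: (lift_derive1 lv) => t.
  have e : lap_exponents alpha lam (2 * m./2) = lam + (2 * m./2)%:R by rewrite /lap_exponents oddM.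
  by rewrite -{1}e; exact: (Pop_newton_chain (lap_exponents alpha lam) sphi t m2n').
by move: H; rewrite -addrA natr1 -E1.
Qed.

Lemma continuous_fpow q : 0 < q -> continuous (fpow q : R -> R).
Proof.
move=> q0 a; apply/cvgrPdist_lt => e e0.
pose M := `|a| + 1; pose C := (q + 1) * M `^ q + 1.
have C0 : 0 < C by rewrite ltr_wpDl// mulr_ge0 ?powR_ge0//; lra.
near=> b; have ab1 : `|a - b| < 1 by near: b; apply: cvgr_dist_lt; [exact: cvg_id|].
have abe : `|a - b| < e / C by near: b; apply: cvgr_dist_lt; [exact: cvg_id|rewrite divr_gt0].
have bM : `|b| <= M.
  rewrite -[b](subKr a); apply: le_trans (ler_normB _ _) _; rewrite lerD2l; exact: ltW.
have aM : `|a| <= M by rewrite lerDl.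
apply: le_lt_trans (fpow_lipschitz q0 aM bM) _.
apply: (@le_lt_trans _ _ (C * `|a - b|)); first by rewrite ler_wpM2r// lerDl.
by rewrite mulrC -ltr_pdivlMr.
Unshelve. all: by end_near. Qed.

Lemma norm_fpow q (x : R) : 0 < q -> `|fpow q x| = `|x| `^ (q + 1).
Proof.
move=> q0; rewrite normrM (ger0_norm (powR_ge0 _ _)) mulrC.
by have := @mulr_powRB1 R `|x| (q + 1) (normr_ge0 _); rewrite addrK; apply; lra.
Qed.

Lemma continuous_norm_powR p : 1 < p -> continuous (fun x : R => `|x| `^ p).
Proof.
move=> p1; have p0 : 0 < p - 1 by rewrite subr_gt0.
have -> : (fun x : R => `|x| `^ p) = fun x => `|fpow (p - 1) x|.
  by apply/funext => x; rewrite norm_fpow// subrK.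
by move=> x; exact: cvg_norm (continuous_fpow p0 (x := x)).
Qed.

(** The weight [r ^ (p a - 1)] is the one for which [r = e ^ t] leaves no exponential under the
    integral. *)
Lemma Lwnorm_lift p a Y w : 1 < p -> continuous Y -> is_lift a Y w ->
  Lwnorm p (p * a - 1) w = poweR (\int[mu]_t (`|Y t| `^ p)%:E) p^-1.
Proof.
move=> p1 cY wY; rewrite /Lwnorm; congr poweR.
pose G r := `|Y (ln r)| `^ p * expR (- ln r).
transitivity (\int[mu]_(r in `]0%R, +oo[) (G r)%:E)%E.
  apply: eq_integral => r; rewrite inE /= in_itv /= andbT => r0; congr EFin.
  rewrite (wY r r0) normrM (ger0_norm (expR_ge0 _)) powRM ?expR_ge0// -expRM.
  rewrite /G [in X in _ * X = _]/powR gt_eqF// mulrAC mulrC -expRD; congr (_ * expR _); ring.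
rewrite integral_exp.
- by apply: eq_integral => t _; rewrite /G expRK -mulrA -expRD addNr expR0 mulr1.
- move=> t; have cl : {for expR t, continuous (@ln R)}.
    exact: is_derive_continuous (is_derive1_ln (expR_gt0 t)).
  apply: (@continuous_fM R (fun r => `|Y (ln r)| `^ p) (fun r => expR (- ln r))).
    apply: (@continuous_fcomp R (fun r => Y (ln r)) (fun y => `|y| `^ p)).
      by apply: (@continuous_fcomp R (@ln R)); [exact: cl|exact: cY].
    exact: continuous_norm_powR.
  apply: (@continuous_fcomp R (@ln R) (fun y => expR (- y))); first exact: cl.
  exact: continuous_expRN.
- by move=> t; rewrite mulr_ge0 ?powR_ge0 ?expR_ge0.
Qed.

Lemma Lw2_square_integrable a Y w : continuous Y -> is_lift a Y w ->
  Lw 2 (2 * a - 1) w -> square_integrable Y.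
Proof.
move=> cY wY [_]; rewrite (Lwnorm_lift _ cY wY); last by lra.
have E t : `|Y t| `^ 2 = Y t ^+ 2 by rewrite powR_mulrn// real_normK ?num_real.
under eq_integral do rewrite E.
move=> H; split=> //; apply/integrableP; split.
  apply/measurable_EFinP; apply: continuous_measurable_fun => t.
  by have := @continuous_fM R _ _ t (cY t) (cY t); congr continuous_at; apply/funext => s; rewrite expr2.
under eq_integral do rewrite /= ger0_norm ?sqr_ge0//.
move: H; case: (integral _ _ _) => [x _||//]; first exact: ltry.
by rewrite poweRyr ?invr_eq0.
Qed.

Lemma square_integrable_Lw2 a Y w : square_integrable Y -> is_lift a Y w ->
  Lw 2 (2 * a - 1) w.
Proof.
move=> [cY iY] wY; split.
  apply: (@eq_measurable_fun _ _ _ _ _ (fun r => expR (- a * ln r) * Y (ln r))).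
    by move=> r; rewrite inE /= in_itv /= andbT => r0; rewrite wY.
  apply: open_continuous_measurable_fun; first exact: interval_open.
  move=> r; rewrite inE /= in_itv /= andbT => r0.
  have cl : {for r, continuous (@ln R)} by exact: is_derive_continuous (is_derive1_ln r0).
  apply: (@continuous_fM R (fun r => expR (- a * ln r)) (fun r => Y (ln r))).
    apply: (@continuous_fcomp R (fun r => - a * ln r)); last exact: continuous_expR.
    by apply: (@continuous_fM R (fun=> - a)); [exact: cst_continuous|exact: cl].
  by apply: (@continuous_fcomp R (@ln R)); [exact: cl|exact: cY].
rewrite (Lwnorm_lift _ cY wY); last by lra.
have E t : `|Y t| `^ 2 = Y t ^+ 2 by rewrite powR_mulrn// real_normK ?num_real.
under eq_integral do rewrite E.
by rewrite line_integral_EFin// poweR_EFin ltry.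
Qed.

End LogarithmicLift.

(** * Functions of finite energy on the line *)

Section EnergySpace.
Variable R : realType.
Implicit Types (a b lam alpha r t : R) (u v w phi Y Z : R -> R) (m n : nat) (p : {poly R}).
Local Notation mu := (@lebesgue_measure R).

Lemma loc_abs_continuous_C1 u v : (forall r, 0 < r -> is_derive r 1 u (v r)) ->
  (forall r, 0 < r -> {for r, continuous v}) -> loc_abs_continuous u.
Proof.
move=> du cv a b a0 ab e e0.
have [c _ Hc] : exists2 c, c \in `[a, b]%R & forall t, t \in `[a, b]%R -> `|v t| <= `|v c|.
  apply: (@EVT_max R (fun t => `|v t|)) => //.
  apply: continuous_at_within => y ay _; exact: cvg_norm (cv y (lt_le_trans a0 ay)).
have M0 : 0 < `|v c| + 1 by rewrite ltr_wpDl.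
have lip x y : a <= x -> x <= y -> y <= b -> `|u y - u x| <= (`|v c| + 1) * (y - x).
  move=> ax; rewrite le_eqVlt => /orP[/eqP<- _|xy yb]; first by rewrite !subrr normr0 mulr0.
  have ds s : s \in `]x, y[%R -> is_derive s 1 u (v s).
    by rewrite in_itv /= => /andP[xs _]; apply: du; apply: lt_trans xs; exact: lt_le_trans ax.
  have cu : {within `[x, y], continuous u}.
    apply: continuous_at_within => s xs _; apply: is_derive_continuous (du s _).
    by apply: lt_le_trans xs; exact: lt_le_trans ax.
  have [s] := MVT xy ds cu.
  rewrite in_itv /= => /andP[xs sy] ->.
  rewrite normrM (ger0_norm (_ : 0 <= y - x)) ?subr_ge0 ?(ltW xy)// ler_wpM2r ?subr_ge0 ?(ltW xy)//.
  apply: le_trans (Hc s _) _; last by rewrite lerDl.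
  by rewrite in_itv /= (le_trans ax (ltW xs)) (le_trans (ltW sy) yb).
exists (e / (`|v c| + 1)); first by rewrite divr_gt0.
move=> n x y xy _; rewrite ltr_pdivlMr// mulrC mulr_sumr; apply: le_lt_trans.
by apply: ler_sum => i _; have [? ? ?] := xy i; exact: lip.
Qed.

Lemma lift_continuous a Y w r : continuous Y -> is_lift a Y w -> 0 < r -> {for r, continuous w}.
Proof.
move=> cY wY r0; have cl : {for r, continuous (@ln R)}.
  exact: is_derive_continuous (is_derive1_ln r0).
have c : {for r, continuous (fun r => expR (- a * ln r) * Y (ln r))}.
  apply: (@continuous_fM R (fun r => expR (- a * ln r)) (fun r => Y (ln r))).
    apply: (@continuous_fcomp R (fun r => - a * ln r)); last exact: continuous_expR.
    by apply: (@continuous_fM R (fun=> - a)); [exact: cst_continuous|exact: cl].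
  by apply: (@continuous_fcomp R (@ln R)); [exact: cl|exact: cY].
have E : \forall s \near r, expR (- a * ln s) * Y (ln s) = w s.
  by near=> s; rewrite wY//; near: s; exact: lt_nbhsr.
suff : w x @[x --> r] --> w r by [].
by rewrite (wY r r0); apply: cvg_trans c; exact: near_eq_cvg.
Unshelve. all: by end_near. Qed.

Lemma lift_vanishes a Y w : 0 < a -> is_lift a Y w ->
  (forall e, 0 < e -> exists T, forall t, T <= t -> `|Y t| <= e) ->
  w r @[r --> +oo] --> (0 : R).
Proof.
move=> a0 wY Y0; apply/cvgrPdist_le => e /Y0[T HT].
near=> r; have Tr : expR (Num.max T 0) <= r by near: r; exact: nbhs_pinfty_ge.
have r0 : 0 < r by apply: lt_le_trans Tr; exact: expR_gt0.
move: Tr; rewrite -[r in X in X -> _]lnK ?posrE// ler_expR ge_max => /andP[Tr lr0].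
rewrite sub0r normrN wY// normrM ger0_norm ?expR_ge0//.
apply: le_trans (HT _ Tr); rewrite ler_piMl// -expR0 ler_expR mulNr oppr_le0.
by rewrite mulr_ge0// ltW.
Unshelve. all: by end_near. Qed.

(** On the line the weighted conditions of [Dspace] become square integrability of all derivatives
    up to order [m]. *)
Definition energy_profile m phi := smooth (2 * m) phi /\
  forall p, (size p <= m.+1)%N -> square_integrable (Pop p phi).

Lemma energy_profileD m phi psi : (0 < m)%N -> energy_profile m phi -> energy_profile m psi ->
  energy_profile m (fun t => phi t + psi t).
Proof.
move=> m0 [sf Lf] [sg Lg]; split=> [|p pm]; first exact: smoothD.
have := square_integrableD (Lf p pm) (Lg p pm); congr square_integrable.
apply/funext => t; rewrite (PopDf t sf sg)// (leq_trans pm)// ltnS mul2n -addnn.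
exact: leq_addr.
Qed.

Lemma energy_profileZ m (c : R) phi : (0 < m)%N -> energy_profile m phi ->
  energy_profile m (fun t => c * phi t).
Proof.
move=> m0 [sf Lf]; split=> [|p pm]; first exact: smoothZ.
have := square_integrableZ c (Lf p pm); congr square_integrable.
apply/funext => t; rewrite (PopZf c t sf)// (leq_trans pm)// ltnS mul2n -addnn.
exact: leq_addr.
Qed.

Lemma energy_profile_test m a b x : test_function (2 * m).+1 a b x -> energy_profile m x.
Proof.
move=> [sx x0]; split=> [|p pm]; first by apply: smoothW sx.
apply: (@square_integrable_support R a b); last exact: supported_Pop.
apply: (continuous_Pop sx); apply: leq_trans pm _; rewrite ltnS mul2n -addnn.
exact: leq_addr.
Qed.

Lemma energy_profile_Pop_decay m p phi : (0 < m)%N -> (size p <= m)%N -> energy_profile m phi ->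
  (exists M, forall t, `|Pop p phi t| <= M) /\
  (forall e, 0 < e -> exists T, forall t, T <= t -> `|Pop p phi t| <= e).
Proof.
move=> m0 pm [sphi Lphi].
have LX : square_integrable (Pop ('X * p) phi).
  by apply: Lphi; apply: leq_trans (size_polyMleq _ _) _; rewrite size_polyX addSn add1n.
apply: (square_integrable_decay (nu := 0) (Lphi p (leqW pm)) LX) => t.
rewrite mul0r add0r; apply: (PopXM t sphi); apply: leq_trans pm _.
by rewrite mul2n -addnn leq_addr.
Qed.

Lemma energy_profile_decay m phi : (0 < m)%N -> energy_profile m phi ->
  (exists M, forall t, `|phi t| <= M) /\
  (forall e, 0 < e -> exists T, forall t, T <= t -> `|phi t| <= e).
Proof.
move=> m0 ephi; have := @energy_profile_Pop_decay m 1 phi m0.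
have -> : Pop 1 phi = phi by apply/funext => t; rewrite Pop1.
by rewrite size_poly1; exact.
Qed.

(** Supplies the competitors in the infimum. *)
Lemma Dspace_lift m alpha lam phi u : (0 < m)%N -> 0 < lam -> alpha = 2 * (lam + m%:R) - 1 ->
  energy_profile m phi -> is_lift lam phi u -> Dspace alpha m u.
Proof.
move=> m0 lam0 alphaE [sphi Lphi] uphi.
have m2 : (m < 2 * m)%N by rewrite mul2n -addnn -{1}[m]addn0 ltn_add2l.
pose Y j := Pop (newton (jet_exponents lam) j) phi.
have LY j : (j <= m)%N -> square_integrable (Y j) by move=> jm; apply: Lphi; rewrite size_newton.
have uY j : (j <= m)%N -> is_lift (lam + j%:R) (Y j) (u^`(j)).
  by move=> jm; apply: (lift_derive1n sphi uphi); exact: leq_trans jm (ltnW m2).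
have du j r : (j < m)%N -> 0 < r -> is_derive r 1 (u^`(j)) (u^`(j.+1) r).
  by move=> jm r0; apply: (lift_derivable sphi uphi) => //; exact: ltn_trans jm m2.
have AC : ACloc m.-1 u.
  split=> [j r jm r0|].
    have jm' : (j < m)%N by apply: leq_trans jm _; exact: leq_pred.
    by case: (du j r jm' r0).
  apply: (@loc_abs_continuous_C1 _ (u^`(m))).
    by move=> r r0; have := du m.-1 r; rewrite prednK//; apply.
  move=> r r0; apply: (lift_continuous _ (uY m (leqnn m)) r0).
  by case: (LY m (leqnn m)).
have LW j : (j <= m)%N -> Lw 2 (alpha - 2 * (m%:R - j%:R)) (u^`(j)).
  move=> jm; have -> : alpha - 2 * (m%:R - j%:R) = 2 * (lam + j%:R) - 1 by rewrite alphaE; ring.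
  exact: square_integrable_Lw2 (LY j jm) (uY j jm).
(* The lift already lies in [Dpre], so a constant sequence approximates it. *)
split=> //; exists (fun=> u) => [_|].
  split=> // [j jm|].
    have jm' : (j < 2 * m)%N by exact: ltn_trans jm m2.
    have [_ V] := square_integrable_decay (LY j (ltnW jm)) (LY j.+1 jm)
      (fun t => Pop_newton_chain (jet_exponents lam) sphi t jm').
    by apply: (lift_vanishes _ (uY j (ltnW jm)) V); rewrite ltr_wpDr.
  by have := LW m (leqnn m); rewrite subrr mulr0 subr0.
have -> : (fun n : nat => Lwnorm 2 alpha ((u^`(m)) \- u^`(m))) = fun=> (0%R)%:E.
  apply/funext => _; rewrite /Lwnorm.
  under eq_integral do rewrite /= subrr normr0 powR0 ?pnatr_eq0// mul0r.
  by rewrite integral0 poweR_EFin powR0// invr_neq0.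
exact: cvg_cst.
Qed.

Lemma energy_profile_powR m phi q : (0 < m)%N -> 0 < q -> energy_profile m phi ->
  continuous (fun t => `|phi t| `^ (q + 2)) /\ line_integrable (fun t => `|phi t| `^ (q + 2)).
Proof.
move=> m0 q0 ephi; have [[M HM] _] := energy_profile_decay m0 ephi.
have [cphi iphi] : square_integrable phi.
  have := ephi.2 1; rewrite size_poly1 => /(_ isT); congr square_integrable.
  by apply/funext => t; rewrite Pop1.
have c : continuous (fun t => `|phi t| `^ (q + 2)).
  move=> t; apply: (@continuous_fcomp R phi (fun x => `|x| `^ (q + 2))); first exact: cphi.
  by apply: continuous_norm_powR; lra.
split=> //; apply: (line_integrable_le c _ (line_integrableZ (M `^ q) iphi)) => t.
rewrite ger0_norm ?powR_ge0// powRD; last by rewrite (gt_eqF (addr_gt0 q0 _)).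
rewrite powR_mulrn// real_normK ?num_real// ler_wpM2r ?sqr_ge0//.
by rewrite ge0_ler_powR// ?nnegrE ?(ltW q0)//; exact: le_trans (HM t).
Qed.

Definition lap_energy alpha lam m phi psi : R := line_integral (fun t =>
  Pop (newton (lap_exponents alpha lam) m) phi t *
  Pop (newton (lap_exponents alpha lam) m) psi t).

Definition mass q phi : R := line_integral (fun t => `|phi t| `^ (q + 2)).

Lemma mass_ge0 q phi : 0 <= mass q phi.
Proof. by apply: Rintegral_ge0 => t _; exact: powR_ge0. Qed.

(** Both norms carry the weight of [Lwnorm_lift]: [alpha = 2 (lam + m) - 1] for the gradient and
    [alpha = (q + 2) lam - 1] for the function, [q + 2] being the critical exponent. *)
Lemma quotient_lift m alpha lam q phi u : (0 < m)%N -> 0 < lam -> 0 < q ->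
  lam * q = 2 * m%:R -> alpha = 2 * (lam + m%:R) - 1 ->
  energy_profile m phi -> is_lift lam phi u ->
  quotient alpha m u = lap_energy alpha lam m phi phi / (mass q phi `^ (q + 2)^-1) ^+ 2.
Proof.
move=> m0 lam0 q0 lamq alphaE ephi uphi; have [sphi Lphi] := ephi.
have mm : (m <= 2 * m)%N by rewrite mul2n -addnn leq_addr.
have ug := lift_grad alpha sphi uphi mm.
set K := Pop _ phi in ug; have [cK iK] : square_integrable K by apply: Lphi; rewrite size_newton.
have [cphi2 iphi] := energy_profile_powR m0 q0 ephi.
have cphi : continuous phi.
  by move=> t; apply: is_derive_continuous; apply: (@smooth_is_derive R 0); apply: smoothW sphi; rewrite muln_gt0.
have pE : critexp alpha m = q + 2.
  rewrite /critexp alphaE; have -> : 2 * (lam + m%:R) - 1 - 2 * m%:R + 1 = 2 * lam by ring.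
  have -> : 2 * (2 * (lam + m%:R) - 1 + 1) = 2 * lam * (q + 2).
    by transitivity (2 * (lam * q) + 4 * lam); [rewrite lamq; ring|ring].
  by rewrite mulrAC mulfV ?mul1r// gt_eqF// mulr_gt0.
have aE : alpha = (q + 2) * lam - 1 by rewrite mulrDl [q * _]mulrC lamq alphaE; ring.
rewrite /quotient; congr (_ / _ ^+ 2).
  rewrite {1}alphaE (Lwnorm_lift _ cK ug); last by lra.
  have E t : `|K t| `^ 2 = K t ^+ 2 by rewrite powR_mulrn// real_normK ?num_real.
  under eq_integral do rewrite E.
  rewrite line_integral_EFin// poweR_EFin /= -powR_mulrn ?powR_ge0// -powRrM mulVf ?powRr1//.
    by apply: Rintegral_ge0 => t _; exact: sqr_ge0.
rewrite pE {1}aE (Lwnorm_lift _ cphi uphi); last by lra.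
by rewrite line_integral_EFin// poweR_EFin.
Qed.

End EnergySpace.

(** * The Euler-Lagrange equation *)

Section EulerLagrange.
Variable R : realType.
Implicit Types (a b lam alpha q S c r t : R) (u v w phi psi x : R -> R) (m n : nat) (p : {poly R}).
Local Notation mu := (@lebesgue_measure R).

Lemma lap_exponents_lt m (k : 'I_m) : ((if odd k then m.-1 - k./2 else k./2) < m)%N.
Proof. by case: k => k /=; case: ifP; lia. Qed.

(** At even [k] the exponent is [lam + k], at odd [k] it is [- (lam + 2 m - 1 - k)]; so the squares
    run once through those of [lam + 2 i] for [i < m]. *)
Lemma lap_symbol m alpha lam : alpha = 2 * (lam + m%:R) - 1 ->
  \prod_(k < m) ('X^2 - ((lap_exponents alpha lam k) ^+ 2)%:P) = symbol m lam.
Proof.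
move=> alphaE; pose h (k : 'I_m) : 'I_m := Ordinal (lap_exponents_lt k).
have h_inj : injective h.
  move=> i j /(congr1 val) /= E; apply: val_inj; move: E.
  by case: i j => [i im] [j jm] /=; case: ifP; case: ifP; lia.
rewrite /symbol [RHS](reindex_inj h_inj); apply: eq_bigr => k _.
congr ('X^2 - _%:P); rewrite /lap_exponents /=; case: ifPn => ok.
  have -> : 2 * (m.-1 - k./2)%:R = 2 * m%:R - 1 - k%:R :> R.
    have e : (2 * (m.-1 - k./2) + 1 + k = 2 * m)%N by have := ltn_ord k; lia.
    by rewrite -natrM -[2 * m%:R]natrM -e !natrD; ring.
  by rewrite alphaE; ring.
have -> // : k%:R = 2 * (k./2)%:R :> R.
by rewrite -natrM; congr _%:R; lia.
Qed.

Lemma lap_energy_expand m alpha lam phi x (e : R) : (0 < m)%N ->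
  energy_profile m phi -> energy_profile m x ->
  lap_energy alpha lam m (fun t => phi t + e * x t) (fun t => phi t + e * x t) =
  lap_energy alpha lam m phi phi + 2 * e * lap_energy alpha lam m phi x +
  e ^+ 2 * lap_energy alpha lam m x x.
Proof.
move=> m0 [sphi Lphi] [sx Lx]; rewrite /lap_energy.
have sK : (size (newton (lap_exponents alpha lam) m) <= m.+1)%N by rewrite size_newton.
have sK2 : (size (newton (lap_exponents alpha lam) m) <= (2 * m).+1)%N.
  by rewrite size_newton ltnS mul2n -addnn leq_addr.
have L1 := Lphi _ sK; have L2 := Lx _ sK; set K := newton _ m in L1 L2 sK2 *.
transitivity (line_integral (fun t => Pop K phi t * Pop K phi t +
  ((2 * e) * (Pop K phi t * Pop K x t) + e ^+ 2 * (Pop K x t * Pop K x t)))).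
  apply: eq_line_integral => t.
  by rewrite (PopDf t sphi (smoothZ (a := e) sx) sK2) (PopZf e t sx sK2); ring.
have i11 := line_integrableM L1 L1; have i12 := line_integrableM L1 L2.
have i22 := line_integrableM L2 L2.
rewrite line_integralD//; last by apply: line_integrableD; exact: line_integrableZ.
by rewrite line_integralD ?line_integralZ ?addrA//; exact: line_integrableZ.
Qed.

Lemma line_integrable_fpow m q phi x : (0 < m)%N -> 0 < q ->
  energy_profile m phi -> energy_profile m x ->
  line_integrable (fun t => fpow q (phi t) * x t).
Proof.
move=> m0 q0 ephi ex; have [[M HM] _] := energy_profile_decay m0 ephi.
have L0 (f : R -> R) : energy_profile m f -> square_integrable f.
  move=> ef; have := ef.2 1; rewrite size_poly1 => /(_ isT); congr square_integrable.
  by apply/funext => t; rewrite Pop1.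
have [cphi iphi] := L0 _ ephi; have [cx ix] := L0 _ ex.
apply: (line_integrable_le _ _ (line_integrableZ (M `^ q) (line_integrableD iphi ix))).
  move=> t; apply: (@continuous_fM R (fun t => fpow q (phi t))); last exact: cx.
  by apply: (@continuous_fcomp R phi); [exact: cphi|exact: continuous_fpow].
move=> t; rewrite /fpow normrM normrM ger0_norm ?powR_ge0// -mulrA.
apply: ler_pM; rewrite ?powR_ge0 ?mulr_ge0//.
  by rewrite ge0_ler_powR// ?nnegrE ?(ltW q0)//; exact: le_trans (HM t).
rewrite -[phi t ^+ 2]real_normK ?num_real// -[x t ^+ 2]real_normK ?num_real//.
by move: `|phi t| `|x t| (normr_ge0 (phi t)) (normr_ge0 (x t)) => y z; nra.
Qed.

Lemma mass_tangent m q phi x (e : R) : (0 < m)%N -> 0 < q ->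
  energy_profile m phi -> energy_profile m x ->
  mass q phi + (q + 2) * e * line_integral (fun t => fpow q (phi t) * x t) <=
  mass q (fun t => phi t + e * x t).
Proof.
move=> m0 q0 ephi ex; have [_ i0] := energy_profile_powR m0 q0 ephi.
have i1 := line_integrable_fpow m0 q0 ephi ex.
have [_ i2] := energy_profile_powR m0 q0 (energy_profileD m0 ephi (energy_profileZ e m0 ex)).
rewrite -line_integralZ// -line_integralD//; last exact: line_integrableZ.
apply: line_integral_le => //; first by apply: line_integrableD => //; exact: line_integrableZ.
move=> t; have := powR_norm_tangent (phi t) (phi t + e * x t) q0.
by congr (_ + _ <= _); ring.
Qed.

Lemma mass_gt0 m q phi : (0 < m)%N -> 0 < q -> energy_profile m phi ->
  (exists t, phi t != 0) -> 0 < mass q phi.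
Proof.
move=> m0 q0 ephi [t0 nz]; have [c i] := energy_profile_powR m0 q0 ephi.
apply: line_integral_gt0 => //.
by exists t0; rewrite gt_eqF// powR_gt0// normr_gt0.
Qed.

Lemma lap_energy_ge0 alpha lam m phi : 0 <= lap_energy alpha lam m phi phi.
Proof. by apply: Rintegral_ge0 => t _; rewrite -expr2 sqr_ge0. Qed.

Section FirstVariation.
Variables (m : nat) (alpha lam q S : R) (phi : R -> R).
Hypotheses (m0 : (0 < m)%N) (q0 : 0 < q) (S0 : 0 <= S) (ephi : energy_profile m phi).
Hypothesis phi_neq0 : exists t, phi t != 0.
Hypothesis S_lower_bound : forall psi, energy_profile m psi -> (exists t, psi t != 0) ->
  S <= lap_energy alpha lam m psi psi / (mass q psi `^ (q + 2)^-1) ^+ 2.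
Hypothesis S_attained :
  lap_energy alpha lam m phi phi / (mass q phi `^ (q + 2)^-1) ^+ 2 = S.

Let sqr_powR psi : (mass q psi `^ (q + 2)^-1) ^+ 2 = mass q psi `^ (2 / (q + 2)).
Proof. by rewrite -powR_mulrn ?powR_ge0// -powRrM mulrC. Qed.

(** Free of division, so that it also covers [psi = 0], which a perturbation of [phi] might be. *)
Lemma sobolev_inequality psi : energy_profile m psi ->
  S * mass q psi `^ (2 / (q + 2)) <= lap_energy alpha lam m psi psi.
Proof.
move=> epsi; have [nz|/forallNP z] := pselect (exists t, psi t != 0).
  have M0 := mass_gt0 m0 q0 epsi nz.
  have := S_lower_bound epsi nz; rewrite sqr_powR ler_pdivlMr// powR_gt0//.
have -> : mass q psi = 0.
  rewrite /mass; transitivity (line_integral (fun _ : R => 0 * psi 0)).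
    apply: eq_line_integral => t; have /negP := z t; rewrite negbK => /eqP ->.
    by rewrite normr0 powR0 ?mul0r// gt_eqF// addr_gt0.
  rewrite line_integralZ ?mul0r//; apply: (@line_integrable_support R 0 0).
    by move=> t; exact: cst_continuous.
  by move=> t _; have /negP := z 0; rewrite negbK => /eqP.
rewrite powR0 ?mulr0; first exact: lap_energy_ge0.
by rewrite mulf_neq0 ?pnatr_eq0// invr_neq0// gt_eqF// addr_gt0.
Qed.

(** The mass of [phi + e x] is at least its tangent [N + P e]. Hence [g e], in which the mass is
    replaced by this affine function, is nonnegative by the Sobolev inequality and vanishes at
    [e = 0]; the claim is [g' 0 = 0]. *)
Lemma first_variation x : energy_profile m x ->
  lap_energy alpha lam m phi x =
  S * mass q phi `^ (2 / (q + 2) - 1) * line_integral (fun t => fpow q (phi t) * x t).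
Proof.
move=> ex; set J := line_integral _; set B := lap_energy _ _ _ phi x.
pose A := lap_energy alpha lam m phi phi; pose E := lap_energy alpha lam m x x.
have N0 := mass_gt0 m0 q0 ephi phi_neq0; set N := mass q phi in N0 *.
pose s := 2 / (q + 2); pose P := (q + 2) * J.
have q2 : 0 < q + 2 by rewrite addr_gt0.
have s0 : 0 <= s by rewrite divr_ge0// ltW.
have AE : A = S * N `^ s.
  by rewrite -S_attained sqr_powR divfK// gt_eqF// powR_gt0.
pose g (e : R) := A + (2 * B) * e + E * (e * e) - S * expR (s * ln (P * e + N)).
have P1 : 0 < `|P| + 1 by rewrite ltr_wpDl.
(* Keeps [P * e + N] positive, so that its power is differentiable. *)
pose d := N / (`|P| + 1); have d0 : 0 < d by rewrite divr_gt0.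
have pos (e : R) : e \in `](- d), d[%R -> 0 < P * e + N.
  rewrite in_itv /= -ltr_norml ltr_pdivlMr// => ed.
  have : - (P * e) < N.
    apply: le_lt_trans ed; apply: le_trans (le_normr _) _; rewrite normrN normrM mulrC.
    by rewrite ler_wpM2l// lerDl.
  by rewrite -subr_gt0 opprK addrC.
have powE (e : R) : e \in `](- d), d[%R -> expR (s * ln (P * e + N)) = (P * e + N) `^ s.
  by move=> /pos e0; rewrite /powR gt_eqF.
have zin : 0 \in `](- d), d[%R by rewrite in_itv /= oppr_lt0 d0.
have dg (e : R) : e \in `](- d), d[%R -> is_derive e 1 g
    (2 * B + E * (e + e) - S * (expR (s * ln (P * e + N)) * (s * ((P * e + N)^-1 * P)))).
  move=> /pos e0; have di := is_derive_id e (1 : R).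
  have dl := @is_derive1_comp R (@ln R) (fun e => P * e + N) e _ _ (is_derive1_ln e0)
    (is_derive_fD (is_derive_fZ P di) (is_derive_cst N e 1)).
  have dx := @is_derive1_comp R expR _ e _ _ (is_derive_expR _) (is_derive_fZ s dl).
  apply: (is_derive_cast (is_derive_fB (is_derive_fD (is_derive_fD (is_derive_cst A e 1)
    (is_derive_fZ (2 * B) di)) (is_derive_fZ E (is_derive_fM di di))) (is_derive_fZ S dx))).
  by rewrite /=; ring.
have gmin (e : R) : e \in `](- d), d[%R -> g 0 <= g e.
  move=> ein; have e0 := pos e ein; rewrite /g (powE e ein) (powE 0 zin).
  rewrite !mulr0 !addr0 add0r -AE subrr subr_ge0.
  have := sobolev_inequality (energy_profileD m0 ephi (energy_profileZ e m0 ex)).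
  rewrite (lap_energy_expand alpha lam e m0 ephi ex) -/A -/B -/E -/s.
  have -> : A + 2 * e * B + e ^+ 2 * E = A + 2 * B * e + E * (e * e) by ring.
  apply: le_trans; apply: (ler_wpM2l S0).
  apply: (ge0_ler_powR s0); [by rewrite nnegrE ltW|by rewrite nnegrE; exact: mass_ge0|].
  have := mass_tangent e m0 q0 ephi ex; rewrite -/J -/N.
  by congr (_ <= _); rewrite /P; ring.
have dd (e : R) : e \in `](- d), d[%R -> derivable g e 1 by move=> /dg[].
have [_ D1] := derive1_at_min (ge0_cp (ltW d0)).2 dd zin gmin.
have [_] := dg 0 zin; rewrite {}D1 (mulr0 P) add0r (add0r N) mulr0 addr0 => /eqP.
have -> : expR (s * ln N) = N `^ s by rewrite /powR gt_eqF.
have -> : N `^ (s - 1) = N `^ s * N^-1.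
  by rewrite powRD ?powR_inv1 ?(ltW N0)//; apply/implyP => _; rewrite gt_eqF.
have sP : s * P = 2 * J by rewrite /s /P mulrA divfK// gt_eqF.
rewrite (mulrCA s) sP eq_sym subr_eq0 => /eqP E2.
have : 2 * B = 2 * (S * (N `^ s * N^-1) * J) by rewrite E2; ring.
by move=> /mulfI; apply; rewrite pnatr_eq0.
Qed.

(** [Pop_adjoint] turns the first variation into a weak equation for [phi], and [lap_symbol]
    identifies its operator. *)
Lemma euler_lagrange : alpha = 2 * (lam + m%:R) - 1 ->
  (forall p, (size p <= (2 * m).+1)%N -> continuous (Pop p phi)) ->
  forall t, (-1) ^+ m * Pop (symbol m lam) phi t =
    S * mass q phi `^ (2 / (q + 2) - 1) * fpow q (phi t).
Proof.
move=> alphaE cphi t; set c := S * _.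
have csym : continuous (Pop (symbol m lam) phi).
  by apply: cphi; rewrite -newton_exponents size_newton.
have cphi0 : continuous phi.
  by have -> : phi = Pop 1 phi by [apply/funext => s; rewrite Pop1]; apply: cphi; rewrite size_poly1.
have cf : continuous (fun t => fpow q (phi t)).
  by move=> s; apply: (@continuous_fcomp R phi); [exact: cphi0|exact: continuous_fpow].
pose G t := (-1) ^+ m * Pop (symbol m lam) phi t + - c * fpow q (phi t).
have cG : continuous G.
  move=> s; apply: (@continuous_fD R (fun t => (-1) ^+ m * Pop (symbol m lam) phi t)).
    by apply: (@continuous_fM R (fun=> (-1) ^+ m)); [exact: cst_continuous|exact: csym].
  by apply: (@continuous_fM R (fun=> - c)); [exact: cst_continuous|exact: cf].
suff /(_ t) : forall t, G t = 0 by move/eqP; rewrite /G mulNr subr_eq0 => /eqP.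
apply: (@fundamental_lemma R (2 * m).+1 G cG) => a b x ab tx.
have ex := energy_profile_test tx; have [sx x0] := tx.
have cx : continuous x.
  by move=> s; apply: is_derive_continuous; apply: (@smooth_is_derive R (2 * m)).
have i1 : line_integrable (fun t => Pop (symbol m lam) phi t * x t).
  apply: (@line_integrable_support R a b); last by move=> s /x0 ->; rewrite mulr0.
  by move=> s; exact: (@continuous_fM R _ _ s (csym s) (cx s)).
have i2 := line_integrable_fpow m0 q0 ephi ex.
transitivity (line_integral (fun t => (-1) ^+ m * (Pop (symbol m lam) phi t * x t) +
    (- c) * (fpow q (phi t) * x t))).
  by apply: eq_line_integral => s; rewrite /G; ring.
rewrite line_integralD; [|exact: line_integrableZ|exact: line_integrableZ].
rewrite !line_integralZ// -(lap_symbol alphaE).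
have := Pop_adjoint (lap_exponents alpha lam) ab ephi.1 cphi tx => <-.
by have := first_variation ex; rewrite /lap_energy -/c => ->; ring.
Qed.

End FirstVariation.
End EulerLagrange.

(** * The profile of a minimizer *)

Section Jets.
Variable R : realType.
Implicit Types (a b lam alpha q S c r t : R) (u v w z phi psi x : R -> R) (m n j : nat) (p : {poly R}).
Local Notation mu := (@lebesgue_measure R).

(** [r ^ (lam + j)] times the derivative of order [j] of [z], at [r = e ^ t]; [jet lam z 0] is the
    transform of [z]. *)
Definition jet lam z j t : R := expR ((lam + j%:R) * t) * derive1n j z (expR t).

Lemma lift_jet lam z j : is_lift (lam + j%:R) (jet lam z j) (derive1n j z).
Proof.
by move=> r r0; rewrite /jet lnK ?posrE// mulrA -expRD mulNr addNr expR0 mul1r.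
Qed.

Lemma jet_chain lam z n : Cclass n z -> chain n (jet_exponents lam) (jet lam z).
Proof.
move=> [dz _] j t jn.
have d1 : is_derive (expR t) 1 (derive1n j z) (derive1n j.+1 z (expR t)).
  by rewrite derive1nS derive1E; apply: derivableP; apply: dz; rewrite ?expR_gt0.
have d2 := @is_derive1_comp R (derive1n j z) expR t _ _ d1 (is_derive_expR t).
apply: (is_derive_cast (is_derive_fM (is_derive_expRM (lam + j%:R) t) d2)).
rewrite /jet /jet_exponents -natr1.
have -> : (lam + (j%:R + 1)) * t = (lam + j%:R) * t + t by ring.
by rewrite expRD /comp; ring.
Qed.

Lemma continuous_jet lam z n j : Cclass n z -> (j <= n)%N -> continuous (jet lam z j).
Proof.
move=> Cz; rewrite leq_eqVlt => /orP[/eqP -> t|jn t]; last first.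
  exact: is_derive_continuous (jet_chain lam Cz t jn).
apply: (@continuous_fM R (fun t => expR ((lam + n%:R) * t)) (fun t => derive1n n z (expR t))).
  exact: is_derive_continuous (is_derive_expRM _ t).
apply: (@continuous_fcomp R expR (derive1n n z)); first exact: continuous_expR.
by apply: Cz.2; exact: expR_gt0.
Qed.

Lemma continuous_span (J : nat -> R -> R) (c : nat -> R) k :
  (forall i, (i < k)%N -> continuous (J i)) -> continuous (fun t => \sum_(i < k) c i * J i t).
Proof.
elim: k => [_|k IH HJ].
  have -> : (fun t => \sum_(i < 0) c i * J i t) = fun=> 0 by apply/funext => t; rewrite big_ord0.
  by move=> t; exact: cst_continuous.
have -> : (fun t => \sum_(i < k.+1) c i * J i t) =
    fun t => \sum_(i < k) c i * J i t + c k * J k t.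
  by apply/funext => t; rewrite big_ord_recr.
move=> t; apply: (@continuous_fD R (fun t => \sum_(i < k) c i * J i t)).
  by apply: IH => i ik; apply: HJ; exact: ltnW.
by apply: (@continuous_fM R (fun=> c k)); [exact: cst_continuous|exact: HJ].
Qed.

Lemma continuous_Pop_jet lam z n p : Cclass n z -> (size p <= n.+1)%N ->
  continuous (Pop p (jet lam z 0)).
Proof.
move=> Cz pn; have [c cE] := chain_Pop_span (jet_chain lam Cz) (leqnn n) pn.
have -> : Pop p (jet lam z 0) = fun t => \sum_(i < n.+1) c i * jet lam z i t by apply/funext.
by apply: continuous_span => i; rewrite ltnS; exact: continuous_jet Cz.
Qed.

(** Because [alpha - 2 (m - i) = 2 (lam + i) - 1], the jets of order [i <= m] are square integrable,
    and they span the differential polynomials of that order. *)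
Lemma Dspace_energy_profile m alpha lam z : alpha = 2 * (lam + m%:R) - 1 ->
  Cclass (2 * m) z -> Dspace alpha m z -> energy_profile m (jet lam z 0).
Proof.
move=> alphaE Cz [_ Lz _]; have cJ := jet_chain lam Cz.
split=> [|p pm]; first by apply: (chain_smooth cJ).
have mm : (m <= 2 * m)%N by rewrite mul2n -addnn leq_addr.
have [c cE] := chain_Pop_span cJ mm pm.
have -> : Pop p (jet lam z 0) = fun t => \sum_(i < m.+1) c i * jet lam z i t by apply/funext.
apply: square_integrable_span => i; rewrite ltnS => im.
have ci : continuous (jet lam z i) by move=> t; exact: (continuous_jet Cz (leq_trans im mm)).
apply: (Lw2_square_integrable ci (@lift_jet lam z i)).
have -> // : 2 * (lam + i%:R) - 1 = alpha - 2 * (m%:R - i%:R) by rewrite alphaE; ring.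
exact: Lz.
Qed.

Lemma right_limit_exp v l : v r @[r --> 0^'+] --> l ->
  forall e, 0 < e -> exists T, forall t, t <= T -> `|v (expR t) - l| < e.
Proof.
move=> /cvgrPdist_lt vl e /vl; rewrite near_withinE -nbhs_nearE => /nbhs_ballP[d /= d0 Hd].
exists (ln (d / 2)) => t td; rewrite distrC; apply: Hd; last exact: expR_gt0.
rewrite /ball /= sub0r normrN ger0_norm ?expR_ge0//.
have : expR t <= d / 2 by rewrite -[d / 2]lnK ?posrE ?divr_gt0// ler_expR.
by move=> /le_lt_trans; apply; rewrite ltr_pdivrMr// ltr_pMr// ltr1n.
Qed.

Lemma bounded_exp_left v : (forall r, 0 < r -> {for r, continuous v}) ->
  cvg (v r @[r --> 0^'+]) -> exists M, forall t, t <= 0 -> `|v (expR t)| <= M.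
Proof.
move=> cv vl; have [T HT] := right_limit_exp vl ltr01.
have [c _ Hc] : exists2 c, c \in `[Num.min T 0, 0]%R &
    forall t, t \in `[Num.min T 0, 0]%R -> `|v (expR t)| <= `|v (expR c)|.
  apply: (@EVT_max R (fun t => `|v (expR t)|)); first by rewrite ge_min lexx orbT.
  apply: continuous_subspaceT => t.
  apply: (@continuous_fcomp R (fun t => v (expR t)) (fun y => `|y|)); last exact: norm_continuous.
  by apply: (@continuous_fcomp R expR v); [exact: continuous_expR|apply: cv; exact: expR_gt0].
exists (Num.max `|v (expR c)| (`|lim (v r @[r --> 0^'+])| + 1)) => t t0.
rewrite le_max; have [tT|tT] := leP t T; apply/orP; [right|left].
  rewrite -[v _](subrK (lim (v r @[r --> 0^'+]))) addrC.
  by apply: le_trans (ler_normD _ _) _; rewrite lerD2l ltW// HT.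
by apply: Hc; rewrite in_itv /= t0 ge_min (ltW tT).
Qed.

Lemma jet_bounded_left lam z j : 0 < lam -> (forall r, 0 < r -> {for r, continuous (derive1n j z)}) ->
  cvg ((derive1n j z) r @[r --> 0^'+]) -> exists M, forall t, t <= 0 -> `|jet lam z j t| <= M * expR (lam * t).
Proof.
move=> lam0 cz zl; have [M HM] := bounded_exp_left cz zl; exists M => t t0.
rewrite /jet normrM ger0_norm ?expR_ge0// mulrC ler_pM ?expR_ge0 ?HM//.
by rewrite ler_expR mulrDl gerDl mulr_ge0_le0.
Qed.

Lemma jet_admissible m alpha lam z : (0 < m)%N -> 0 < lam -> alpha = 2 * (lam + m%:R) - 1 ->
  nonsingular m (2 * m - 1) z -> Dspace alpha m z -> admissible m (jet lam z 0).
Proof.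
move=> m0 lam0 alphaE [Cz zl] Dz; have ez := Dspace_energy_profile alphaE Cz Dz.
have cJ := jet_chain lam Cz.
have m20 : (0 < 2 * m)%N by rewrite muln_gt0.
split; first exact: ez.1.
(* The span stops at the jet of order [2 m - 1], the last one with a finite limit at the origin by
   assumption. *)
- move=> p p2m; have [|||M HM] := @chain_Pop_bounded R (2 * m) _ _ (2 * m - 1) p [set t | t <= 0] cJ.
  + exact: leq_subr.
  + by rewrite subn1 prednK.
  + move=> i im; have i2m : (i < 2 * m)%N by rewrite -(prednK m20) ltnS -subn1.
    have [||M HM] := @jet_bounded_left lam z i lam0.
    * move=> r r0; apply: is_derive_continuous; apply: derivableP; exact: Cz.1.
    * exact: zl.
    * exists `|M| => t t0; apply: le_trans (HM t t0) _; apply: le_trans (le_normr _) _.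
      rewrite normrM ler_piMr// ger0_norm ?expR_ge0// -expR0 ler_expR.
      by rewrite mulr_ge0_le0// ltW.
  + by exists M.
- by move=> p pm; have [[M HM] _] := energy_profile_Pop_decay m0 pm ez; exists M.
Qed.

End Jets.

(** * The value of the infimum *)

Section SharpConstant.
Variable R : realType.
Implicit Types (a b lam alpha q S c r t : R) (u v w z phi psi x : R -> R) (m n j : nat) (p : {poly R}).
Local Notation mu := (@lebesgue_measure R).

Lemma mass_profile q lam k tau (I : R) : 0 < q -> 0 < lam ->
  (\int[mu]_t (bubble (lam * (q + 2)) t)%:E = I%:E)%E ->
  mass q (profile k lam tau) = `|k| `^ (q + 2) * I.
Proof.
move=> q0 lam0 HI; have q2 : 0 < q + 2 by rewrite addr_gt0.
have cb : continuous (bubble (lam * (q + 2)) : R -> R).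
  by move=> t; exact: is_derive_continuous (is_derive_bubble _ t).
have E t : `|profile k lam tau t| `^ (q + 2) =
    `|k| `^ (q + 2) * bubble (lam * (q + 2)) (1 * t + - tau).
  rewrite /profile mul1r normrM powRM// (ger0_norm (ltW (bubble_gt0 _ _))).
  by rewrite bubble_pow.
rewrite /mass /line_integral /Rintegral; under eq_integral do rewrite E EFinM.
rewrite ge0_integralZl_EFin ?powR_ge0//; last 2 first.
- by move=> t _; rewrite lee_fin ltW// bubble_gt0.
- apply/measurable_EFinP; apply: continuous_measurable_fun => t.
  apply: (@continuous_fcomp R (fun t => 1 * t + - tau)); last exact: cb.
  exact: continuous_affine.
have -> : (\int[mu]_t (bubble (lam * (q + 2)) (1 * t + - tau))%:E = I%:E)%E; last by [].
have b0 t : 0 <= bubble (lam * (q + 2)) t :> R by rewrite ltW// bubble_gt0.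
have IA := @integral_affine R _ 1 (- tau) ltr01 cb b0.
rewrite {}HI in IA; rewrite {}IA.
by apply: eq_integral => t _; rewrite mulr1.
Qed.

Lemma minimizer_attains m alpha lam q z : (0 < m)%N -> 0 < lam -> 0 < q ->
  lam * q = 2 * m%:R -> alpha = 2 * (lam + m%:R) - 1 ->
  minimizer alpha m z -> energy_profile m (jet lam z 0) ->
  [/\ 0 <= Sconst alpha m,
    forall psi, energy_profile m psi -> (exists t, psi t != 0) ->
      Sconst alpha m <= lap_energy alpha lam m psi psi / (mass q psi `^ (q + 2)^-1) ^+ 2,
    lap_energy alpha lam m (jet lam z 0) (jet lam z 0) /
      (mass q (jet lam z 0) `^ (q + 2)^-1) ^+ 2 = Sconst alpha m &
    exists t, jet lam z 0 t != 0].
Proof.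
move=> m0 lam0 q0 lamq alphaE [Dz [r r0 zr] Sz] ez.
(* [inf] is a true infimum only for a nonempty set that is bounded below. *)
have lb : lbound [set quotient alpha m u | u in [set u | Dspace alpha m u /\ Dnonzero u]] 0.
  by move=> _ [u _ <-]; rewrite /quotient divr_ge0 ?sqr_ge0.
split.
- by apply: lb_le_inf lb; exists (quotient alpha m z), z => //; split=> //; exists r.
- move=> psi epsi [t nz]; pose u r := expR (- lam * ln r) * psi (ln r).
  have lu : is_lift lam psi u by [].
  rewrite -(quotient_lift m0 lam0 q0 lamq alphaE epsi lu).
  apply: (ge_inf (ex_intro _ 0 lb)).
  exists u; last by [].
  split; first exact: Dspace_lift epsi lu.
  by exists (expR t); rewrite ?expR_gt0// /u expRK mulf_neq0// gt_eqF// expR_gt0.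
- rewrite -(quotient_lift m0 lam0 q0 lamq alphaE ez (u := z))//.
  by have := lift_jet lam z 0; rewrite addr0.
- by exists (ln r); rewrite /jet lnK ?posrE// mulf_neq0// gt_eqF// expR_gt0.
Qed.

Lemma Pprod_gt0 alpha m : 0 < alpha - 2 * m%:R + 1 -> 0 < Pprod alpha m.
Proof.
move=> h; apply: prodr_gt0 => i _; have : 0 <= (nat_of_ord i)%:R :> R by [].
have : 0 <= m%:R :> R by []. lra.
Qed.

(** The classification gives [S N ^ (2 / (q + 2) - 1) |k| ^ q = Pprod], and the mass of the bubble
    is [N = |k| ^ (q + 2) I]; the amplitude [k] cancels, by homogeneity of the quotient, and [S]
    remains. *)
Lemma Sconst_minimizer m alpha z : (0 < m)%N -> 0 < alpha - 2 * m%:R + 1 ->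
  minimizer alpha m z -> nonsingular m (2 * m - 1) z ->
  forall I : R, 0 < I -> (\int[mu]_t (bubble (alpha + 1) t)%:E = I%:E)%E ->
  Sconst alpha m = Pprod alpha m * I `^ (2 * m%:R / (alpha + 1)).
Proof.
move=> m0 ha hz hns I I0 HI; pose lam := (alpha - 2 * m%:R + 1) / 2.
have lam0 : 0 < lam by rewrite divr_gt0.
have mR : 0 < m%:R :> R by rewrite ltr0n.
pose q := 2 * m%:R / lam; have q0 : 0 < q by rewrite divr_gt0// mulr_gt0.
have lamq : lam * q = 2 * m%:R by rewrite /q mulrC divfK// gt_eqF.
have alphaE : alpha = 2 * (lam + m%:R) - 1 by rewrite /lam; lra.
have q2 : 0 < q + 2 by rewrite addr_gt0.
have lq2 : lam * (q + 2) = alpha + 1 by rewrite mulrDr lamq alphaE; ring.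
have a1 : 0 < alpha + 1 by rewrite -lq2 mulr_gt0.
have [Cz zl] := hns; have [Dz _ _] := hz.
have ez := Dspace_energy_profile alphaE Cz Dz.
have [S0 Slb Seq nz] := minimizer_attains m0 lam0 q0 lamq alphaE hz ez.
have cphi p : (size p <= (2 * m).+1)%N -> continuous (Pop p (jet lam z 0)).
  exact: continuous_Pop_jet.
have EL := euler_lagrange m0 q0 S0 ez nz Slb Seq alphaE cphi.
set S := Sconst alpha m in S0 Slb Seq EL *.
have N0 := mass_gt0 m0 q0 ez nz; set N := mass q _ in N0 Seq EL.
pose c := S * N `^ (2 / (q + 2) - 1).
have c0 : 0 <= c by rewrite mulr_ge0// powR_ge0.
have m20 : (0 < 2 * m)%N by rewrite muln_gt0.
have z0l : cvg ((derive1n 0 z) r @[r --> 0^'+]) by exact: zl.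
have [k [tau [k0 prof]]] : exists k tau, [/\ k != 0, forall t, jet lam z 0 t = profile k lam tau t &
    c * `|k| `^ q = \prod_(i < 2 * m) (2 * lam + 2 * i%:R)].
  apply: (profile_classification (z0 := lim (z r @[r --> 0^'+])) m0 lam0 q0 lamq c0
    (jet_admissible m0 lam0 alphaE hns Dz) EL _ _ _ nz).
  - apply: (jet_bounded_left lam0 _ z0l) => r r0; apply: is_derive_continuous.
    by apply: derivableP; exact: (Cz.1 0%N r m20 r0).
  - move=> e e0; have [T HT] := right_limit_exp z0l e0; exists T => t /HT.
    by rewrite /jet addr0 mulrA -expRD mulNr addNr expR0 mul1r.
  - exact: (energy_profile_decay m0 ez).2.
have -> : \prod_(i < 2 * m) (2 * lam + 2 * i%:R) = Pprod alpha m.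
  by apply: eq_bigr => i _; rewrite alphaE; ring.
have NE : N = `|k| `^ (q + 2) * I.
  rewrite -lq2 in HI; rewrite -(mass_profile k tau q0 lam0 HI).
  by apply: eq_line_integral => t; rewrite prof.
have ak : 0 < `|k| by rewrite normr_gt0.
move=> <-; rewrite /c NE powRM ?powR_ge0 ?(ltW I0)// -powRrM.
have -> : (q + 2) * (2 / (q + 2) - 1) = - q.
  by rewrite mulrBr mulrC divfK ?gt_eqF//; ring.
have -> : 2 * m%:R / (alpha + 1) = - (2 / (q + 2) - 1).
  by rewrite -lamq -lq2; field; rewrite !gt_eqF.
rewrite !powRN; set x := `|k| `^ q; set y := I `^ _.
have x0 : x != 0 by rewrite gt_eqF// powR_gt0.
have y0 : y != 0 by rewrite gt_eqF// powR_gt0.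
by field; apply/andP.
Qed.

End SharpConstant.

Theorem theorem1p4 (R : realType) (m : nat) (alpha : R)
    (hm : (1 <= m)%N) (halpha : -1 < alpha) (halpham : 0 < alpha - 2 * m%:R + 1)
    (z : R -> R) (hz : minimizer alpha m z)
    (hns : nonsingular m (2 * m - 1) z)
    (hodd : forall i : nat, odd i -> (i <= 2 * m - 1)%N -> deriv_at0 i z = 0) :
  Sconst alpha m `^ (- (1 / 2)) =
    Pprod alpha m `^ (- (1 / 2)) *
    (2 * Gamma (alpha + 1) /
       (Gamma ((alpha + 1) / 2) * Gamma ((alpha + 1) / 2)))
      `^ (m%:R / (alpha + 1)).
Proof.
have m1 : 1 <= m%:R :> R by rewrite ler1n.
(* [alpha + 1 > 2 m >= 2] is the range in which [integral_bubble] applies. *)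
have a2 : 2 < alpha + 1 by lra.
have [HI [G1 G2]] := integral_bubble a2.
set I := _ / _ in HI.
have I0 : 0 < I by rewrite divr_gt0 ?mulr_gt0.
have -> : 2 * Gamma (alpha + 1) / (Gamma ((alpha + 1) / 2) * Gamma ((alpha + 1) / 2)) = I^-1.
  by rewrite invf_div.
have P0 := Pprod_gt0 halpham.
rewrite (Sconst_minimizer hm halpham hz hns I0 HI) powRM ?powR_ge0 ?(ltW P0)//.
congr (_ * _); rewrite -(powR_inv1 (ltW I0)) -!powRrM; congr (_ `^ _).
by field; rewrite gt_eqF//; lra.
Qed.
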